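(* Let $m_0,m_1,m_2$ be integers with $0\le m_0<m_1<m_2$. For all $a_0,a_1,a_2,b_0,b_1,b_2\in\mathbb{R}$, the Abel equation $$\frac{dx}{dt}=(a_0t^{m_0}+a_1t^{m_1}+a_2t^{m_2})x^3+(b_0t^{m_0}+b_1t^{m_1}+b_2t^{m_2})x^2,\qquad t\in[0,1],$$ has at most three limit cycles (including $x=0$, i.e., the solution $x\equiv 0$ is counted when it is a limit cycle). Furthermore, this upper bound is sharp, i.e., for such $m_0,m_1,m_2$ there exist parameters $a_0,a_1,a_2,b_0,b_1,b_2\in\mathbb{R}$ for which the equation has exactly three limit cycles (including $x=0$).
   Context: A closed solution is a solution $x(t)$ defined on all of $[0,1]$ with $x(0)=x(1)$. A limit cycle is a closed solution that is isolated among the closed solutions. *)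

(* Defs.v *)
From Stdlib Require Import Reals List SetoidList.
Open Scope R_scope.

Definition unit_interval (t : R) : Prop := 0 <= t <= 1.

(* A function on [0,1] is represented by a total function R -> R whose values
   off [0,1] are irrelevant; two such functions are the same when they agree
   on [0,1]. *)
Definition eq01 (x y : R -> R) : Prop :=
  forall t, unit_interval t -> x t = y t.

(* D_in is the derivative relative to [0,1], hence one-sided at 0 and 1. *)
Definition abel_solution (A B x : R -> R) : Prop :=
  forall t, unit_interval t ->
    D_in x (fun s => A s * x s ^ 3 + B s * x s ^ 2) unit_interval t.

Definition closed_solution (A B x : R -> R) : Prop :=
  abel_solution A B x /\ x 0 = x 1.

(* Isolated for the uniform distance on [0,1]. *)
Definition limit_cycle (A B x : R -> R) : Prop :=
  closed_solution A B x /\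
  exists eps : R, 0 < eps /\
    forall y, closed_solution A B y ->
      (forall t, unit_interval t -> Rabs (y t - x t) < eps) ->
      eq01 y x.

(* The solutions are counted up to eq01; the zero solution is treated like any
   other one. *)
Definition has_exactly_limit_cycles (A B : R -> R) (n : nat) : Prop :=
  exists l : list (R -> R),
    NoDupA eq01 l /\ length l = n /\
    forall x, limit_cycle A B x <-> InA eq01 x l.

Definition trinomial (m0 m1 m2 : nat) (c0 c1 c2 : R) (t : R) : R :=
  c0 * t ^ m0 + c1 * t ^ m1 + c2 * t ^ m2.

(* Main.v *)
Require Import Defs.
From Stdlib Require Import Reals Lra Psatz List SetoidList Classical ClassicalEpsilon.
From Coquelicot Require Import Coquelicot.
Open Scope R_scope.
Set Bullet Behavior "Strict Subproofs".

(** A closed solution of x' = A x^3 + B x^2 that is not identically zero never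
    vanishes, so y = 1/x is defined and y' = - A/y - B.  Write n = - B/A, so
    that x = n is the curve where x' = 0, and W = A B' - A' B.

    Upper bound.  The heart of the matter is that three distinct nonzero closed
    solutions force A and B to be proportional ([three_periodic_dependent]).
    For proportional A and B the variables separate, and a closed solution that
    is not constant belongs to a continuum of closed solutions, hence is not a
    limit cycle ([dependent_limit_cycle]).

    Suppose first that W vanishes at a point of (0,1).  Then some combination
    of A and B has a double zero there, and a trinomial with a double positive
    zero has no other one, so this combination keeps its sign.  If it is
    C = k A + B and H' = 1/(x^2 (x - k)), then H(x(t)) has derivative
    A + C/(x - k) along solutions.  The difference of this quantity for two
    solutions on the same side of the line x = k is strictly monotone in t, so
    each side contains at most one of them; and closed solutions do not cross
    the line ([one_signed_three]).

    Suppose now that W has no zero in (0,1).  If A keeps its sign, the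
    argument above applies to C = A.  Otherwise glue t = 1 to t = 0.  On the
    resulting circle A is positive on one arc and negative on the complementary
    one; n is monotone on each arc, in the same direction.  Monotonicity
    persists across the gluing point because a combination k A + B changes
    sign at most twice in (0,1).  Let x_a, x_b, x_c be three closed solutions with
    x_b > x_c > 0.  The gap e = y_c - y_b satisfies e' = A e / (y_b y_c), so it
    runs through the same interval on both arcs, upwards on one and downwards
    on the other.  With e as independent variable, Y = y_b and d = y_a - y_b
    satisfy
      dY/de = (n Y - 1) (Y + e) / e,      dd/de = d (Y + e) / (e (Y + d)).
    Along the two branches n varies in opposite directions, so the difference of
    its two values changes sign at most once; as the two functions Y agree at
    both ends, one of them lies above the other throughout.  The equation for d
    does not contain n and is monotone in Y, and the two functions d also agree
    at both ends.  This leaves only equality, for d, then for Y, then for n,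
    which contradicts strict monotonicity ([no_two_branches],
    [no_three_around_loop]).

    Sharpness.  For x' = eps^2 A x^3 + eps B x^2, where A and B have mean value
    of order eps and eps^2, the displacement y(1) - y(0) is
    - eps^3 c (1/rho - 1) (1/rho - 2) + O(eps^4), with rho = y(0) and an
    explicit c > 0 ([orbit_displacement]).  It changes sign twice between
    1/rho = 1/2 and 1/rho = 3, which gives two nonzero closed solutions; by the
    upper bound these and zero are the only ones, hence all are isolated. *)

(** * Mean values, differential inequalities and inverse functions *)

Lemma locally_near (P : R -> Prop) (t eps : R) :
  0 < eps -> (forall z, t - eps < z < t + eps -> P z) -> locally t P.
Proof.
intros He H; exists (mkposreal _ He); intros z Hz.
unfold ball in Hz; simpl in Hz; unfold AbsRing_ball, abs, minus, plus, opp in Hz; simpl in Hz.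
apply Rabs_def2 in Hz; apply H; lra.
Qed.

Lemma derivable_continuity_pt (f : R -> R) (t d : R) : is_derive f t d -> continuity_pt f t.
Proof.
intros H; apply derivable_continuous_pt, ex_derive_Reals_0; now exists d.
Qed.

Lemma continuity_sub (f g : R -> R) :
  continuity f -> continuity g -> continuity (fun t => f t - g t).
Proof. intros Hf Hg t; apply continuity_pt_minus; auto. Qed.

Lemma is_derive_add (f g : R -> R) (t a b : R) :
  is_derive f t a -> is_derive g t b -> is_derive (fun z => f z + g z) t (a + b).
Proof. intros; now apply @is_derive_plus. Qed.

Lemma is_derive_sub (f g : R -> R) (t a b : R) :
  is_derive f t a -> is_derive g t b -> is_derive (fun z => f z - g z) t (a - b).
Proof. intros; now apply @is_derive_minus. Qed.

(** The derivative is only asked for in the open interval and given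
    existentially, so that the mean value theorem transports any property [P] of
    the derivative without naming a derivative function. *)
Lemma mean_value (f : R -> R) (P : R -> R -> Prop) (a b : R) :
  (forall t, a <= t <= b -> continuity_pt f t) -> a < b ->
  (forall t, a < t < b -> exists d : R, is_derive f t d /\ P t d) ->
  exists c d, a < c < b /\ P c d /\ f b - f a = d * (b - a).
Proof.
intros Hf Hab Hd.
assert (pr : forall c, a < c < b -> derivable_pt f c).
{ intros c Hc; apply ex_derive_Reals_0.
  destruct (Hd c Hc) as [d [H _]]; now exists d. }
destruct (MVT f id a b pr (fun c _ => derivable_pt_id c) Hab)
  as [c [Hc E]].
- exact Hf.
- intros; apply derivable_continuous_pt, derivable_pt_id.
- destruct (Hd c Hc) as [d [H HP]].
  exists c, d; split; [exact Hc|split; [exact HP|]].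
  rewrite (derive_pt_eq_0 f c d (pr c Hc)) in E by now apply is_derive_Reals.
  rewrite (derive_pt_eq_0 id c 1) in E by apply derivable_pt_lim_id.
  unfold id in E; lra.
Qed.

Lemma increasing_of_derive_pos (f : R -> R) (a b : R) :
  (forall t, a <= t <= b -> continuity_pt f t) -> a < b ->
  (forall t, a < t < b -> exists d : R, is_derive f t d /\ 0 < d) ->
  f a < f b.
Proof.
intros Hf Hab Hd.
destruct (mean_value f (fun _ d => 0 < d) a b Hf Hab Hd) as [c [d [_ [H E]]]].
assert (0 < d * (b - a)) by (apply Rmult_lt_0_compat; lra).
lra.
Qed.

Lemma increasing_of_derive_pos_except (f : R -> R) (a b j : R) :
  continuity f -> a < b ->
  (forall t, a < t < b -> t <> j -> exists d : R, is_derive f t d /\ 0 < d) ->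
  f a < f b.
Proof.
intros Hf Hab Hd.
assert (H0 : forall u v, a <= u -> u < v -> v <= b -> (v <= j \/ j <= u) ->
  f u < f v).
{ intros u v ? ? ? ?; apply increasing_of_derive_pos; auto.
  intros t Ht; apply Hd; lra. }
destruct (Rle_dec j a); [apply H0; lra|].
destruct (Rle_dec b j); [apply H0; lra|].
apply Rlt_trans with (f j); apply H0; lra.
Qed.

Lemma last_nonneg (f : R -> R) (a t : R) :
  continuity f -> a <= t -> 0 <= f a -> f t < 0 ->
  exists u, a <= u < t /\ 0 <= f u /\ forall z, u < z <= t -> f z < 0.
Proof.
intros Hf Hat Ha Ht.
destruct (completeness (fun z => a <= z <= t /\ 0 <= f z)) as [u [Hu1 Hu2]].
{ exists t; intros z Hz; lra. }
{ exists a; lra. }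
assert (Hau : a <= u) by (apply Hu1; lra).
assert (Hut : u <= t) by (apply Hu2; intros z Hz; lra).
assert (Hfu : 0 <= f u).
{ destruct (Rle_lt_dec 0 (f u)) as [H|H]; [exact H|exfalso].
  destruct (Hf u (- f u)) as [del [Hdel Hc]]; [lra|].
  assert (u <= u - del); [|lra].
  apply Hu2; intros z [Hz Hfz].
  destruct (Rle_lt_dec z (u - del)) as [H1|H1]; [exact H1|exfalso].
  assert (z <= u) by (apply Hu1; split; assumption).
  destruct (Req_dec z u) as [->|Hne]; [lra|].
  specialize (Hc z); simpl in Hc; unfold R_dist, D_x, no_cond in Hc.
  assert (H3 : Rabs (f z - f u) < - f u).
  { apply Hc; repeat split; auto. rewrite Rabs_left1; lra. }
  apply Rabs_def2 in H3; lra. }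
exists u; repeat split; try assumption.
- destruct (Req_dec u t) as [->|]; lra.
- intros z Hz; destruct (Rle_lt_dec 0 (f z)) as [H|H]; [exfalso|exact H].
  assert (z <= u) by (apply Hu1; lra); lra.
Qed.

(** If f were negative somewhere, then after the last nonnegative point the
    function f(t) exp(-Q t) would be nondecreasing.  As the
    inequality is asked for where f < 0 only, linear equations whose coefficient
    is bounded on one side are covered. *)
Lemma nonneg_forward (f : R -> R) (a b Q : R) :
  continuity f -> 0 <= f a ->
  (forall t, a < t < b -> f t < 0 -> exists d : R, is_derive f t d /\ Q * f t <= d) ->
  forall t, a <= t <= b -> 0 <= f t.
Proof.
intros Hf Ha Hd t Ht.
destruct (Rle_lt_dec 0 (f t)) as [H|H]; [exact H|exfalso].
destruct (last_nonneg f a t) as [u [Hu [Hfu Hz]]]; auto; [lra|].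
set (g := fun z => f z * exp (- Q * z)).
destruct (mean_value g (fun _ d => 0 <= d) u t) as [c [d [_ [H1 E]]]].
- intros z _; apply continuity_pt_mult; [apply Hf|].
  apply derivable_continuous_pt, ex_derive_Reals_0.
  auto_derive; auto.
- lra.
- intros z Hzz.
  destruct (Hd z) as [d [H1 H2]]; [lra|apply Hz; lra|].
  exists ((d - Q * f z) * exp (- Q * z)); split.
  + unfold g; evar_last.
    { apply @is_derive_mult; [exact H1| |intros; apply Rmult_comm].
      instantiate (1 := - Q * exp (- Q * z)); auto_derive; auto; ring. }
    unfold plus, mult; simpl; ring.
  + apply Rmult_le_pos; [lra|apply Rlt_le, exp_pos].
- assert (0 <= d * (t - u)) by (apply Rmult_le_pos; lra).
  assert (0 <= g u) by (apply Rmult_le_pos; [lra|apply Rlt_le, exp_pos]).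
  assert (0 < - f t * exp (- Q * t))
    by (apply Rmult_lt_0_compat; [lra|apply exp_pos]).
  unfold g in *; lra.
Qed.

(** The exceptional point [j] accommodates the instant where a periodic
    extension is glued. *)
Lemma nonneg_forward_except (f : R -> R) (a b j Q : R) :
  continuity f -> 0 <= f a ->
  (forall t, a < t < b -> t <> j -> f t < 0 ->
     exists d : R, is_derive f t d /\ Q * f t <= d) ->
  forall t, a <= t <= b -> 0 <= f t.
Proof.
intros Hf Ha Hd.
assert (H0 : forall u v, a <= u -> v <= b -> (v <= j \/ j <= u) ->
  0 <= f u -> forall t, u <= t <= v -> 0 <= f t).
{ intros u v ? ? ? ?; apply (nonneg_forward f u v Q); auto.
  intros t Ht; apply Hd; lra. }
intros t Ht.
destruct (Rle_dec j a); [apply (H0 a b); lra|].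
destruct (Rle_dec b j); [apply (H0 a b); lra|].
destruct (Rle_dec t j); [apply (H0 a j); lra|].
apply (H0 j b); try lra; apply (H0 a j); lra.
Qed.

Lemma continuity_reflect (f : R -> R) :
  continuity f -> continuity (fun t => f (- t)).
Proof.
intros Hf t; apply (continuity_pt_comp Ropp f); [|apply Hf].
apply derivable_continuous_pt, derivable_pt_opp, derivable_pt_id.
Qed.

Lemma is_derive_reflect (f : R -> R) (t d : R) :
  is_derive f (- t) d -> is_derive (fun z => f (- z)) t (- d).
Proof.
intros H; evar_last.
- apply (is_derive_comp f Ropp); [exact H|].
  instantiate (1 := -1); auto_derive; auto; ring.
- unfold scal; simpl; unfold mult; simpl; ring.
Qed.

Lemma nonneg_backward_except (f : R -> R) (a b j Q : R) :
  continuity f -> 0 <= f b ->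
  (forall t, a < t < b -> t <> j -> f t < 0 ->
     exists d : R, is_derive f t d /\ d <= - Q * f t) ->
  forall t, a <= t <= b -> 0 <= f t.
Proof.
intros Hf Hb Hd t Ht.
rewrite <- (Ropp_involutive t).
apply (nonneg_forward_except (fun z => f (- z)) (- b) (- a) (- j) Q); try lra.
- now apply continuity_reflect.
- now rewrite Ropp_involutive.
- intros z Hz Hj Hn.
  destruct (Hd (- z)) as [d [H1 H2]]; try lra.
  exists (- d); split; [now apply is_derive_reflect|lra].
Qed.

Lemma linear_ode_zero (f : R -> R) (a b t0 Q : R) :
  continuity f -> a <= t0 <= b -> f t0 = 0 ->
  (forall t, a < t < b -> exists q : R, is_derive f t (q * f t) /\ Rabs q <= Q) ->
  forall t, a <= t <= b -> f t = 0.
Proof.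
intros Hf Ht0 H0 Hd.
assert (Hc : continuity (fun z => - f z)) by (intros z; apply continuity_pt_opp, Hf).
assert (A : forall t, a <= t <= t0 -> 0 <= f t).
{ apply (nonneg_backward_except f a t0 a Q); auto; [lra|].
  intros t Ht _ Hn; destruct (Hd t) as [q [H1 H2]]; [lra|].
  exists (q * f t); split; auto. apply Rabs_le_between in H2.
  nra. }
assert (B : forall t, a <= t <= t0 -> 0 <= - f t).
{ apply (nonneg_backward_except (fun z => - f z) a t0 a Q); auto; [lra|].
  intros t Ht _ Hn; destruct (Hd t) as [q [H1 H2]]; [lra|].
  exists (- (q * f t)); split; [now apply @is_derive_opp|].
  apply Rabs_le_between in H2.
  replace (- (q * f t)) with (q * (- f t)) by ring.
  nra. }
assert (C : forall t, t0 <= t <= b -> 0 <= f t).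
{ apply (nonneg_forward f t0 b Q); auto; [lra|].
  intros t Ht Hn; destruct (Hd t) as [q [H1 H2]]; [lra|].
  exists (q * f t); split; auto. apply Rabs_le_between in H2.
  nra. }
assert (D : forall t, t0 <= t <= b -> 0 <= - f t).
{ apply (nonneg_forward (fun z => - f z) t0 b Q); auto; [lra|].
  intros t Ht Hn; destruct (Hd t) as [q [H1 H2]]; [lra|].
  exists (- (q * f t)); split; [now apply @is_derive_opp|].
  apply Rabs_le_between in H2.
  replace (- (q * f t)) with (q * (- f t)) by ring.
  nra. }
intros t Ht; destruct (Rle_dec t t0);
  [specialize (A t); specialize (B t)|specialize (C t); specialize (D t)]; lra.
Qed.

Lemma bounded_on (f : R -> R) (a b : R) :
  continuity f -> exists K, forall t, a <= t <= b -> Rabs (f t) <= K.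
Proof.
intros Hf; destruct (Rle_dec a b) as [Hab|Hab].
- destruct (continuity_ab_maj (fun t => Rabs (f t)) a b Hab) as [m [Hm _]].
  + intros c _; apply (continuity_pt_comp f Rabs); [apply Hf|apply Rcontinuity_abs].
  + exists (Rabs (f m)); exact Hm.
- exists 0; intros; lra.
Qed.

Lemma same_sign (f : R -> R) (a b s t : R) :
  continuity f -> (forall z, a <= z <= b -> f z <> 0) ->
  a <= s <= b -> a <= t <= b -> 0 < f s * f t.
Proof.
intros Hf Hn Hs Ht.
destruct (Rlt_le_dec 0 (f s * f t)) as [H|H]; [exact H|exfalso].
destruct (Rle_dec s t) as [Hst|Hst].
- destruct (IVT_cor f s t Hf Hst H) as [z [Hz Hz0]]; apply (Hn z); lra.
- destruct (IVT_cor f t s Hf) as [z [Hz Hz0]]; [lra|lra|apply (Hn z); lra].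
Qed.

Lemma mean_value_bound (f : R -> R) (M : R) :
  continuity f ->
  (forall t, 0 < t < 1 -> exists d : R, is_derive f t d /\ Rabs d <= M) ->
  forall t, 0 <= t <= 1 -> Rabs (f t - f 0) <= M.
Proof.
intros Cf Hd t Ht.
assert (HM : 0 <= M).
{ destruct (Hd (1/2)) as [d [_ H]]; [lra|]; apply Rle_trans with (2 := H), Rabs_pos. }
destruct (Req_dec t 0) as [->|]; [rewrite Rminus_diag, Rabs_R0; exact HM|].
destruct (mean_value f (fun _ d => Rabs d <= M) 0 t) as [c [d [_ [H1 H2]]]]; auto; [lra| |].
- intros z Hz; apply Hd; lra.
- rewrite H2, Rminus_0_r, Rabs_mult, (Rabs_pos_eq t) by lra.
  assert (0 <= Rabs d) by apply Rabs_pos. nra.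
Qed.

Lemma is_derive_primitive (phi : R -> R) (a : R) : continuity phi ->
  forall u, is_derive (fun u => RInt phi a u) u (phi u).
Proof.
intros Hphi u.
assert (Hc : forall z, continuous phi z) by (intros z; apply continuity_pt_filterlim, Hphi).
apply (is_derive_RInt phi (fun u => RInt phi a u) a u); [|apply Hc].
exists (mkposreal 1 Rlt_0_1); intros z _; apply @RInt_correct.
apply @ex_RInt_continuous; intros; apply Hc.
Qed.

(** The inverse is clamped outside the image so as to be continuous on the
    whole line. *)
Lemma increasing_inverse (f : R -> R) (u w : R) :
  continuity f -> u <= w ->
  (forall s t, u <= s -> s < t -> t <= w -> f s < f t) ->
  exists T : R -> R,
    continuity T /\
    (forall t, u <= t <= w -> T (f t) = t) /\
    (forall e, f u <= e <= f w -> u <= T e <= w /\ f (T e) = e) /\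
    (forall e d, f u < e < f w -> 0 < d -> is_derive f (T e) d -> is_derive T e (/ d)).
Proof.
intros Hf Huw Hinc.
assert (Hle : f u <= f w).
{ destruct (Req_dec u w) as [->|]; [lra|apply Rlt_le, Hinc; lra]. }
set (cl := fun e => Rmax (f u) (Rmin (f w) e)).
assert (Hcl : forall e, Rmin (f u) (f w) <= cl e <= Rmax (f u) (f w)).
{ intros e; rewrite Rmin_left, Rmax_right by lra; unfold cl; split; [apply Rmax_l|].
  apply Rmax_lub; [lra|apply Rmin_l]. }
set (T := fun e => proj1_sig (IVT_gen f u w (cl e) Hf (Hcl e))).
assert (HT : forall e, u <= T e <= w /\ f (T e) = cl e).
{ intros e; unfold T; destruct (IVT_gen f u w (cl e) Hf (Hcl e)) as [x [H1 H2]]; simpl.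
  rewrite Rmin_left, Rmax_right in H1 by lra; tauto. }
assert (Hid : forall e, f u <= e <= f w -> cl e = e).
{ intros e He; unfold cl; rewrite Rmin_right, Rmax_right by lra; reflexivity. }
assert (Hmono : forall s t, u <= s <= w -> u <= t <= w -> f s < f t -> s < t).
{ intros s t Hs Ht H; destruct (Rlt_le_dec s t) as [|H1]; [assumption|].
  destruct (Req_dec s t) as [->|]; [lra|].
  assert (f t < f s) by (apply Hinc; lra); lra. }
assert (Hcont : continuity T).
{ intros e eps Heps.
  destruct (HT e) as [Hte Hfe].
  assert (HU : exists del, 0 < del /\ forall e', e' < e + del -> T e' < T e + eps).
  { destruct (Rle_dec (T e + eps / 2) w) as [H|H].
    - assert (Hlt : f (T e) < f (T e + eps / 2)) by (apply Hinc; lra).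
      exists (f (T e + eps / 2) - f (T e)); split; [lra|]; intros e' He'.
      destruct (HT e') as [Hte' Hfe'].
      assert (T e' < T e + eps / 2); [|lra].
      apply Hmono; try lra; rewrite Hfe'.
      rewrite Hfe in *; revert Hlt He'; clear; unfold cl.
      unfold Rmax, Rmin; repeat destruct (Rle_dec _ _); lra.
    - exists 1; split; [lra|]; intros e' _; destruct (HT e'); lra. }
  assert (HL : exists del, 0 < del /\ forall e', e - del < e' -> T e - eps < T e').
  { destruct (Rle_dec u (T e - eps / 2)) as [H|H].
    - assert (Hlt : f (T e - eps / 2) < f (T e)) by (apply Hinc; lra).
      exists (f (T e) - f (T e - eps / 2)); split; [lra|]; intros e' He'.
      destruct (HT e') as [Hte' Hfe'].
      assert (T e - eps / 2 < T e'); [|lra].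
      apply Hmono; try lra; rewrite Hfe'.
      assert (f (T e - eps / 2) < f w) by (apply Hinc; lra).
      rewrite Hfe in *; revert Hlt He' H0; clear; unfold cl.
      unfold Rmax, Rmin; repeat destruct (Rle_dec _ _); lra.
    - exists 1; split; [lra|]; intros e' _; destruct (HT e'); lra. }
  destruct HU as [d1 [Hd1 H1]]; destruct HL as [d2 [Hd2 H2]].
  exists (Rmin d1 d2); split; [apply Rmin_pos; lra|].
  intros e' [_ He']; simpl in *; unfold R_dist in *.
  assert (Rmin d1 d2 <= d1) by apply Rmin_l.
  assert (Rmin d1 d2 <= d2) by apply Rmin_r.
  apply Rabs_def2 in He'.
  apply Rabs_def1; [assert (T e' < T e + eps) by (apply H1; lra)
                   |assert (T e - eps < T e') by (apply H2; lra)]; lra. }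
exists T; split; [exact Hcont|].
split; [|split].
- intros t Ht; destruct (HT (f t)) as [H1 H2].
  assert (Hft : f u <= f t <= f w).
  { split; [destruct (Req_dec u t) as [->|]; [lra|]|
            destruct (Req_dec t w) as [->|]; [lra|]]; apply Rlt_le, Hinc; lra. }
  rewrite Hid in H2 by assumption.
  destruct (Rtotal_order (T (f t)) t) as [H|[H|H]]; auto.
  + assert (f (T (f t)) < f t) by (apply Hinc; lra); lra.
  + assert (f t < f (T (f t))) by (apply Hinc; lra); lra.
- intros e He; destruct (HT e) as [H1 H2]; rewrite Hid in H2 by assumption; tauto.
- intros e d He Hd Hder.
  apply is_derive_Reals; apply is_derive_Reals in Hder.
  intros eps Heps.
  (* if the difference quotient p of f satisfies |p - d| < eps', then p > d/2
     and |1/p - 1/d| = |p - d| / (p d) < eps *)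
  set (eps' := Rmin (d / 2) (eps * d * d / 2)).
  assert (Heps' : 0 < eps').
  { unfold eps'; apply Rmin_pos; [lra|].
    assert (0 < eps * d * d) by (repeat apply Rmult_lt_0_compat; lra); lra. }
  destruct (Hder eps' Heps') as [del Hdel].
  destruct (Hcont e del (cond_pos del)) as [alp [Halp Hal]].
  assert (Hm : 0 < Rmin alp (Rmin (e - f u) (f w - e))).
  { repeat apply Rmin_pos; lra. }
  exists (mkposreal _ Hm); intros h Hh0 Hh; simpl in Hh.
  assert (Rabs h < alp) by (eapply Rlt_le_trans; [exact Hh|apply Rmin_l]).
  assert (Hh2 : Rabs h < Rmin (e - f u) (f w - e))
    by (eapply Rlt_le_trans; [exact Hh|apply Rmin_r]).
  assert (Rabs h < e - f u) by (eapply Rlt_le_trans; [exact Hh2|apply Rmin_l]).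
  assert (Rabs h < f w - e) by (eapply Rlt_le_trans; [exact Hh2|apply Rmin_r]).
  apply Rabs_def2 in H0; apply Rabs_def2 in H1.
  destruct (HT e) as [He1 He2]; destruct (HT (e + h)) as [Hh3 Hh4].
  rewrite Hid in He2 by lra; rewrite Hid in Hh4 by lra.
  set (k := T (e + h) - T e).
  assert (Hk0 : k <> 0).
  { intros Hk; assert (T (e + h) = T e) by (unfold k in Hk; lra); rewrite H2 in Hh4; lra. }
  assert (Hkd : Rabs k < del).
  { unfold k; apply (Hal (e + h)); split.
    - split; [exact I|lra].
    - simpl; unfold R_dist; replace (e + h - e) with h by ring; assumption. }
  specialize (Hdel k Hk0 Hkd).
  replace (T e + k) with (T (e + h)) in Hdel by (unfold k; ring).
  rewrite Hh4, He2 in Hdel; replace (e + h - e) with h in Hdel by ring.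
  fold k; clear - Hdel Hk0 Hh0 Hd Heps.
  set (p := h / k) in *.
  assert (E1 : eps' <= d / 2) by apply Rmin_l.
  assert (E2 : eps' <= eps * d * d / 2) by apply Rmin_r.
  assert (Hp : d / 2 < p) by (apply Rabs_def2 in Hdel; lra).
  replace (k / h - / d) with ((d - p) * / (p * d))
    by (unfold p; field; repeat split; auto; lra).
  assert (0 < p * d) by (apply Rmult_lt_0_compat; lra).
  rewrite Rabs_mult, (Rabs_pos_eq (/ (p * d))) by (apply Rlt_le, Rinv_0_lt_compat; lra).
  apply Rmult_lt_reg_r with (p * d); [assumption|].
  rewrite Rmult_assoc, Rinv_l, Rmult_1_r by lra.
  rewrite Rabs_minus_sym.
  apply Rlt_le_trans with (1 := Hdel); apply Rle_trans with (1 := E2).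
  replace (eps * d * d / 2) with (eps * ((d / 2) * d)) by field.
  apply Rmult_le_compat_l; [lra|]; apply Rmult_le_compat_r; lra.
Qed.

(** * Comparison of two branches *)

(** One arc of the circle seen from three solutions, over the gap
    [e = y_c - y_b] as independent variable: [Y] stands for y_b, [d] for
    y_a - y_b, so that y_c = Y + e and y_a = Y + d, and [n] for - B/A. *)
Record branch (e0 e1 j : R) (n Y d : R -> R) : Prop := {
  branch_cont_Y : continuity Y;
  branch_cont_d : continuity d;
  branch_Y_pos : forall e, e0 <= e <= e1 -> 0 < Y e;
  branch_derive_Y : forall e, e0 < e < e1 -> e <> j ->
    is_derive Y e ((n e * Y e - 1) * (Y e + e) / e);
  branch_derive_d : forall e, e0 < e < e1 -> e <> j ->
    is_derive d e (d e * (Y e + e) / (e * (Y e + d e))) }.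

Section Compare.
Variables (e0 e1 j : R) (nP YP dP nQ YQ dQ : R -> R).
Hypothesis (He0 : 0 < e0) (He01 : e0 < e1).
Hypothesis HP : branch e0 e1 j nP YP dP.
Hypothesis HQ : branch e0 e1 j nQ YQ dQ.
Hypothesis (EY0 : YP e0 = YQ e0) (EY1 : YP e1 = YQ e1).
Hypothesis (Ed0 : dP e0 = dQ e0) (Ed1 : dP e1 = dQ e1).
Hypothesis nP_anti : forall e e', e0 < e -> e < e' -> e' < e1 -> e <> j -> e' <> j ->
  nP e' <= nP e.
Hypothesis nQ_mono : forall e e', e0 < e -> e < e' -> e' < e1 -> e <> j -> e' <> j ->
  nQ e <= nQ e'.
Hypothesis n_strict : forall e e', e0 < e -> e < e' -> e' < e1 -> e <> j -> e' <> j ->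
  nP e' - nQ e' < nP e - nQ e.

Let v e := YP e - YQ e.

Lemma branch_v_cont : continuity v.
Proof. apply continuity_sub; [apply HP|apply HQ]. Qed.

(** The difference of the two equations for Y, written as a forcing term that
    has the sign of nP - nQ plus a multiple of the difference itself; only nQ
    appears in the multiplier. *)
Lemma branch_v_derive e : e0 < e < e1 -> e <> j ->
  is_derive v e ((nP e - nQ e) * (YP e * (YP e + e) / e) +
     (nQ e * (YP e + YQ e + e) - 1) / e * v e).
Proof.
intros He Hj; evar_last.
- apply @is_derive_minus; [apply HP|apply HQ]; assumption.
- unfold minus, plus, opp, v; simpl; field; lra.
Qed.

(** Where nP >= nQ the same holds from [e0] up to there, by monotonicity, and nQ
    is bounded above on that range, so the comparison runs forward from [e0].
    Where nP < nQ the same holds from there up to [e1], and nQ is bounded below,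
    so it runs backward from [e1].  The functions nP and nQ may be unbounded at
    the ends, since A vanishes there. *)
Lemma branch_v_nonneg e : e0 < e < e1 -> e <> j -> 0 <= v e.
Proof.
intros He Hj.
assert (HS : continuity (fun e => YP e + YQ e + e)).
{ intros z; repeat apply continuity_pt_plus; [apply HP|apply HQ|].
  apply derivable_continuous_pt, derivable_pt_id. }
destruct (bounded_on _ e0 e1 HS) as [S HS1].
assert (HK : 0 <= S).
{ apply Rle_trans with (2 := HS1 e ltac:(lra)), Rabs_pos. }
assert (Hpos : forall z, e0 <= z <= e1 -> 0 < YP z + YQ z + z <= S).
{ intros z Hz; assert (0 < YP z) by (apply HP; auto); assert (0 < YQ z) by (apply HQ; auto).
  split; [lra|]; apply Rle_trans with (2 := HS1 z Hz), Rle_abs. }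
set (N := Rabs (nQ e)).
assert (HN : - N <= nQ e <= N).
{ apply Rabs_le_between; unfold N; lra. }
assert (HN0 : 0 <= N) by apply Rabs_pos.
assert (HD : forall z, e0 <= z <= e1 -> 0 <= YP z * (YP z + z) / z).
{ intros z Hz; assert (0 < YP z) by (apply HP; auto).
  apply Rlt_le, Rdiv_lt_0_compat; [|lra]; apply Rmult_lt_0_compat; lra. }
destruct (Rle_lt_dec (nQ e) (nP e)) as [Hn|Hn].
- apply (nonneg_forward_except v e0 e j (N * S / e0)); try lra.
  + exact branch_v_cont.
  + unfold v; lra.
  + intros z Hz Hzj Hv.
    eexists; split; [apply branch_v_derive; [lra|assumption]|].
    assert (nP e <= nP z) by (apply nP_anti; lra).
    assert (nQ z <= nQ e) by (apply nQ_mono; lra).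
    assert (0 <= (nP z - nQ z) * (YP z * (YP z + z) / z))
      by (apply Rmult_le_pos; [lra|apply HD; lra]).
    destruct (Hpos z) as [Hp1 Hp2]; [lra|].
    assert ((nQ z * (YP z + YQ z + z) - 1) / z <= N * S / e0).
    { unfold Rdiv; apply Rle_trans with (N * S * / z).
      - apply Rmult_le_compat_r; [apply Rlt_le, Rinv_0_lt_compat; lra|]. nra.
      - apply Rmult_le_compat_l; [nra|]; apply Rinv_le_contravar; lra. }
    nra.
- apply (nonneg_backward_except v e e1 j ((N * S + 1) / e0)); try lra.
  + exact branch_v_cont.
  + unfold v; lra.
  + intros z Hz Hzj Hv.
    eexists; split; [apply branch_v_derive; [lra|assumption]|].
    assert (nP z <= nP e) by (apply nP_anti; lra).
    assert (nQ e <= nQ z) by (apply nQ_mono; lra).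
    assert (0 <= (nQ z - nP z) * (YP z * (YP z + z) / z))
      by (apply Rmult_le_pos; [lra|apply HD; lra]).
    destruct (Hpos z) as [Hp1 Hp2]; [lra|].
    assert (- ((N * S + 1) / e0) <= (nQ z * (YP z + YQ z + z) - 1) / z).
    { assert ((- (nQ z * (YP z + YQ z + z) - 1)) / z <= (N * S + 1) / e0); [|lra].
      unfold Rdiv; apply Rle_trans with ((N * S + 1) * / z).
      - apply Rmult_le_compat_r; [apply Rlt_le, Rinv_0_lt_compat; lra|]. nra.
      - apply Rmult_le_compat_l; [nra|]; apply Rinv_le_contravar; lra. }
    nra.
Qed.

Variable kappa : R.
Hypothesis Hkappa : kappa <> 0.
Hypothesis third_side : forall e, e0 <= e <= e1 -> 0 < kappa * (dQ e * (dP e - e)).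
Hypothesis third_sign : forall e, e0 <= e <= e1 -> 0 < (YP e + dP e) * (YQ e + dQ e).

Let m e := kappa * (dP e - dQ e).

Lemma branch_m_cont : continuity m.
Proof.
intros e; apply (continuity_pt_scal (fun z => dP z - dQ z)).
apply continuity_sub; [apply HP|apply HQ].
Qed.

(** The quotient d (Y + e) / (Y + d) depends on d and Y only, and its variation
    in Y has the sign of d (d - e) = (y_a - y_b) (y_a - y_c), which is constant
    because the solutions do not meet.  The factor [kappa] absorbs that sign. *)
Lemma branch_m_derive e : e0 < e < e1 -> e <> j ->
  is_derive m e
   (YQ e * (YP e + e) / (e * ((YP e + dP e) * (YQ e + dQ e))) * m e
    + v e * (kappa * (dQ e * (dP e - e)) / (e * ((YP e + dP e) * (YQ e + dQ e))))).
Proof.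
intros He Hj; evar_last.
- apply is_derive_scal, @is_derive_minus; [apply HP|apply HQ]; assumption.
- unfold minus, plus, opp, v, m; simpl; field.
  assert (H := third_sign e ltac:(lra)).
  repeat split; try lra; intros E; rewrite E in H; lra.
Qed.

(** The difference m of the two functions d is nonnegative by comparison from
    [e0] and nonpositive by comparison from [e1]; so it vanishes, and the
    forcing terms in the equations for m and then for v vanish in turn. *)
Lemma no_two_branches : False.
Proof.
assert (Hden : forall e, e0 <= e <= e1 -> 0 < e * ((YP e + dP e) * (YQ e + dQ e))).
{ intros e He; apply Rmult_lt_0_compat; [lra|apply third_sign; auto]. }
set (r := fun e => YQ e * (YP e + e) / (e * ((YP e + dP e) * (YQ e + dQ e)))).
assert (Hr : exists K, forall e, e0 <= e <= e1 -> Rabs (r e) <= K).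
{ assert (Hrc : forall e, e0 <= e <= e1 -> continuity_pt r e).
  { intros e He; assert (cY := branch_cont_Y _ _ _ _ _ _ HP e).
    assert (cY' := branch_cont_Y _ _ _ _ _ _ HQ e).
    assert (cd := branch_cont_d _ _ _ _ _ _ HP e).
    assert (cd' := branch_cont_d _ _ _ _ _ _ HQ e).
    assert (ci : continuity_pt (fun z : R => z) e)
      by (apply derivable_continuous_pt, derivable_pt_id).
    unfold r; apply continuity_pt_div.
    - apply continuity_pt_mult; [|apply continuity_pt_plus]; assumption.
    - apply continuity_pt_mult; [assumption|apply continuity_pt_mult; apply continuity_pt_plus; assumption].
    - specialize (Hden e He); lra. }
  destruct (continuity_ab_maj (fun e => Rabs (r e)) e0 e1) as [x [Hx _]]; [lra| |].
  - intros c Hc; apply (continuity_pt_comp r Rabs); [auto|apply Rcontinuity_abs].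
  - exists (Rabs (r x)); exact Hx. }
destruct Hr as [K HK].
assert (Hc : forall e, e0 < e < e1 -> e <> j ->
  0 <= v e * (kappa * (dQ e * (dP e - e)) / (e * ((YP e + dP e) * (YQ e + dQ e))))).
{ intros e He Hj; apply Rmult_le_pos; [now apply branch_v_nonneg|].
  apply Rlt_le, Rdiv_lt_0_compat; [apply third_side|apply Hden]; lra. }
assert (M1 : forall e, e0 <= e <= e1 -> 0 <= m e).
{ apply (nonneg_forward_except m e0 e1 j K).
  - exact branch_m_cont.
  - unfold m; rewrite Ed0; lra.
  - intros e He Hj Hm; eexists; split; [apply branch_m_derive; assumption|].
    specialize (HK e ltac:(lra)); apply Rabs_le_between in HK.
    specialize (Hc e He Hj); fold (r e) in *.  nra. }
assert (M2 : forall e, e0 <= e <= e1 -> 0 <= - m e).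
{ apply (nonneg_backward_except (fun e => - m e) e0 e1 j K).
  - intros e; apply continuity_pt_opp, branch_m_cont.
  - unfold m; rewrite Ed1; lra.
  - intros e He Hj Hm; eexists; split; [apply @is_derive_opp, branch_m_derive; assumption|].
    specialize (HK e ltac:(lra)); apply Rabs_le_between in HK.
    specialize (Hc e He Hj); fold (r e) in *; unfold opp; simpl. nra. }
assert (Hder0 : forall (f : R -> R) e d, e0 < e < e1 -> e <> j ->
  (forall z, e0 < z < e1 -> z <> j -> f z = 0) -> is_derive f e d -> d = 0).
{ intros f e d He Hj Hf Hd.
  rewrite <- (is_derive_unique f e d Hd); apply is_derive_unique.
  apply (is_derive_ext_loc (fun _ => 0)).
  - assert (Hej : 0 < Rabs (e - j)) by (apply Rabs_pos_lt; lra).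
    assert (B1 := Rmin_l (Rabs (e - j)) (Rmin (e - e0) (e1 - e))).
    assert (B2 := Rmin_r (Rabs (e - j)) (Rmin (e - e0) (e1 - e))).
    assert (B3 := Rmin_l (e - e0) (e1 - e)); assert (B4 := Rmin_r (e - e0) (e1 - e)).
    apply locally_near with (eps := Rmin (Rabs (e - j)) (Rmin (e - e0) (e1 - e)));
      [repeat apply Rmin_pos; lra|]; intros z Hz.
    symmetry; apply Hf; [lra|]; intros ->.
    revert Hz B1; unfold Rabs; destruct (Rcase_abs _); lra.
  - apply @is_derive_const. }
assert (V0 : forall e, e0 < e < e1 -> e <> j -> v e = 0).
{ intros e He Hj.
  assert (M0 : forall z, e0 < z < e1 -> z <> j -> m z = 0).
  { intros z Hz _; specialize (M1 z); specialize (M2 z); lra. }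
  assert (E := Hder0 m e _ He Hj M0 (branch_m_derive e He Hj)).
  rewrite (M0 e He Hj), Rmult_0_r, Rplus_0_l in E.
  apply Rmult_integral in E; destruct E as [E|E]; [exact E|exfalso].
  assert (0 < kappa * (dQ e * (dP e - e)) / (e * ((YP e + dP e) * (YQ e + dQ e))))
    by (apply Rdiv_lt_0_compat; [apply third_side|apply Hden]; lra).
  lra. }
assert (N0 : forall e, e0 < e < e1 -> e <> j -> nP e = nQ e).
{ intros e He Hj.
  assert (E := Hder0 v e _ He Hj V0 (branch_v_derive e He Hj)).
  rewrite (V0 e He Hj), Rmult_0_r, Rplus_0_r in E.
  apply Rmult_integral in E; destruct E as [E|E]; [lra|exfalso].
  assert (0 < YP e) by (apply HP; lra).
  assert (0 < YP e * (YP e + e) / e)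
    by (apply Rdiv_lt_0_compat; [apply Rmult_lt_0_compat|]; lra).
  lra. }
set (h := (e1 - e0) / 4).
assert (Hh : 0 < h) by (unfold h; lra).
assert (E4 : e1 = e0 + 4 * h) by (unfold h; lra).
assert (X : exists s t, e0 < s /\ s < t /\ t < e1 /\ s <> j /\ t <> j).
{ destruct (Req_dec j (e0 + h)).
  - exists (e0 + 2 * h), (e0 + 3 * h); repeat split; lra.
  - destruct (Req_dec j (e0 + 2 * h)).
    + exists (e0 + h), (e0 + 3 * h); repeat split; lra.
    + exists (e0 + h), (e0 + 2 * h); repeat split; lra. }
destruct X as [s [t [Hs [Hst [Ht [Hsj Htj]]]]]].
assert (A1 := n_strict s t Hs Hst Ht Hsj Htj).
rewrite (N0 s), (N0 t) in A1 by (try assumption; lra); lra.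
Qed.
End Compare.

(** * Three solutions around the circle *)

(** [tau] is 1 for an increasing function and - 1 for a decreasing one. *)
Lemma monotone_inverse (f : R -> R) (u w j tau : R) :
  continuity f -> u < w -> tau = 1 \/ tau = - 1 ->
  (forall t, u < t < w -> t <> j -> exists d : R, is_derive f t d /\ 0 < tau * d) ->
  tau * f u < tau * f w /\
  exists T : R -> R,
    continuity T /\ T (f u) = u /\ T (f w) = w /\
    (forall x, tau * f u <= tau * x <= tau * f w -> u <= T x <= w /\ f (T x) = x) /\
    (forall x y, tau * f u <= tau * x -> tau * x < tau * y -> tau * y <= tau * f w ->
       T x < T y) /\
    (forall x d, tau * f u < tau * x < tau * f w -> 0 < tau * d ->
       is_derive f (T x) d -> is_derive T x (/ d)).
Proof.
intros Hf Huw Htau Hd.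
assert (T2 : tau * tau = 1) by (destruct Htau as [-> | ->]; ring).
set (g := fun t => tau * f t).
assert (Hg : continuity g) by (intros t; apply (continuity_pt_scal f), Hf).
assert (Hinc : forall s t, u <= s -> s < t -> t <= w -> g s < g t).
{ intros s t Hs Hst Ht; apply (increasing_of_derive_pos_except g s t j); auto.
  intros z Hz Hj; destruct (Hd z) as [d [H1 H2]]; [lra|assumption|].
  exists (tau * d); split; [now apply is_derive_scal|assumption]. }
split; [apply Hinc; lra|].
destruct (increasing_inverse g u w Hg ltac:(lra) Hinc) as [S [HS1 [HS2 [HS3 HS4]]]].
assert (Hback : forall x, tau * f u <= tau * x <= tau * f w ->
  u <= S (tau * x) <= w /\ f (S (tau * x)) = x).
{ intros x Hx; destruct (HS3 (tau * x) Hx) as [H1 H2]; split; [assumption|].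
  unfold g in H2; apply (Rmult_eq_compat_l tau) in H2.
  rewrite <- !Rmult_assoc, T2 in H2; lra. }
exists (fun x => S (tau * x)); refine (conj _ (conj _ (conj _ (conj _ (conj _ _))))).
- intros x; apply (continuity_pt_comp (fun x => tau * x) S); [|apply HS1].
  apply (continuity_pt_scal id); apply derivable_continuous_pt, derivable_pt_id.
- apply HS2; lra.
- apply HS2; lra.
- exact Hback.
- intros x y Hx Hxy Hy.
  destruct (HS3 (tau * x)) as [X1 X2]; [unfold g; lra|].
  destruct (HS3 (tau * y)) as [Y1 Y2]; [unfold g; lra|].
  destruct (Rlt_le_dec (S (tau * x)) (S (tau * y))) as [|H]; [assumption|exfalso].
  destruct (Req_dec (S (tau * x)) (S (tau * y))) as [E|].
  + rewrite E in X2; lra.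
  + assert (g (S (tau * y)) < g (S (tau * x))) by (apply Hinc; lra); lra.
- intros x d Hx Hdd Hder.
  assert (HT : is_derive S (tau * x) (/ (tau * d))).
  { apply HS4; [exact Hx|assumption|]; now apply is_derive_scal. }
  evar_last.
  + apply (is_derive_comp S (fun x => tau * x)); [exact HT|].
    instantiate (1 := tau); auto_derive; auto; ring.
  + unfold scal; simpl; unfold mult; simpl.
    assert (d <> 0) by (intros ->; lra).
    assert (tau <> 0) by (intros ->; lra).
    field; auto.
Qed.

(** The functions live on [[p, q]], where [p] and [q] represent the same point of
    the circle; [s] is the other sign change of A and [j] the gluing point.  The
    unknowns are the reciprocals y = 1/x. *)
Section Loop.
Variables (p s q j sigma omega : R) (A B ya yb yc : R -> R).
Hypotheses (Hps : p < s) (Hsq : s < q).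
Hypothesis (Hsigma : sigma = 1 \/ sigma = - 1).
Hypothesis (Homega : omega = 1 \/ omega = - 1).
Hypotheses (Ca : continuity ya) (Cb : continuity yb) (Cc : continuity yc).
Hypothesis Da : forall t, p < t < q -> t <> s -> t <> j -> is_derive ya t (- A t / ya t - B t).
Hypothesis Db : forall t, p < t < q -> t <> s -> t <> j -> is_derive yb t (- A t / yb t - B t).
Hypothesis Dc : forall t, p < t < q -> t <> s -> t <> j -> is_derive yc t (- A t / yc t - B t).
Hypothesis Hb : forall t, p <= t <= q -> 0 < yb t.
Hypothesis Hbc : forall t, p <= t <= q -> yb t < yc t.
Hypothesis Ha0 : forall t, p <= t <= q -> ya t <> 0.
Hypothesis Hab : forall t, p <= t <= q -> ya t - yb t <> 0.
Hypothesis Hac : forall t, p <= t <= q -> ya t - yc t <> 0.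
Hypotheses (Ea : ya p = ya q) (Eb : yb p = yb q) (Ec : yc p = yc q).
Hypothesis SA1 : forall t, p < t < s -> t <> j -> 0 < sigma * A t.
Hypothesis SA2 : forall t, s < t < q -> t <> j -> 0 < - sigma * A t.
Let n t := - B t / A t.
Hypothesis N1 : forall t t', p < t -> t < t' -> t' < s -> t <> j -> t' <> j ->
  omega * n t' < omega * n t.
Hypothesis N2 : forall t t', s < t -> t < t' -> t' < q -> t <> j -> t' <> j ->
  omega * n t' <= omega * n t.

Let e t := yc t - yb t.

Lemma gap_cont : continuity e.
Proof. now apply continuity_sub. Qed.

Lemma gap_derive t : p < t < q -> t <> s -> t <> j ->
  is_derive e t (A t * (e t / (yb t * yc t))).
Proof.
intros Ht Hs Hj; evar_last.
- apply @is_derive_minus; [apply Dc|apply Db]; assumption.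
- assert (0 < yb t) by (apply Hb; lra). assert (yb t < yc t) by (apply Hbc; lra).
  unfold minus, plus, opp, e; simpl; field; lra.
Qed.

Lemma gap_ratio_pos t : p <= t <= q -> 0 < e t / (yb t * yc t).
Proof.
intros Ht; assert (0 < yb t) by (apply Hb; lra). assert (yb t < yc t) by (apply Hbc; lra).
apply Rdiv_lt_0_compat; [unfold e; lra|apply Rmult_lt_0_compat; lra].
Qed.

(** The branch over an arc is parametrised by the inverse [T] of the gap, which
    is monotone there in the direction [tau], the sign of A. *)
Lemma arc_branch (u w tau : R) :
  p <= u -> w <= q -> u < w -> (w <= s \/ s <= u) -> tau = 1 \/ tau = - 1 ->
  (forall t, u < t < w -> t <> j -> 0 < tau * A t) ->
  tau * e u < tau * e w /\
  exists T : R -> R, T (e u) = u /\ T (e w) = w /\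
    (forall x, tau * e u <= tau * x <= tau * e w -> u <= T x <= w /\ e (T x) = x) /\
    (forall x y, tau * e u <= tau * x -> tau * x < tau * y -> tau * y <= tau * e w ->
       T x < T y) /\
    forall e0 e1, (forall x, e0 <= x <= e1 -> tau * e u <= tau * x <= tau * e w) ->
      (forall x, e0 < x < e1 -> tau * e u < tau * x < tau * e w) ->
      branch e0 e1 (e j) (fun x => n (T x)) (fun x => yb (T x))
        (fun x => ya (T x) - yb (T x)).
Proof.
intros Hu Hw Huw Hs Htau HA.
destruct (monotone_inverse e u w j tau) as [H0 [T [T1 [T2 [T3 [T4 [T5 T6]]]]]]]; auto.
{ apply gap_cont. }
{ intros t Ht Hj; eexists; split; [apply gap_derive; [lra|lra|assumption]|].
  rewrite <- Rmult_assoc; apply Rmult_lt_0_compat; [now apply HA|apply gap_ratio_pos; lra]. }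
split; [exact H0|]; exists T; split; [exact T2|split; [exact T3|]].
split; [exact T4|split; [exact T5|]].
intros e0 e1 Hcl Hop.
assert (Hint : forall x, e0 < x < e1 -> x <> e j -> u < T x < w /\ T x <> j /\
  is_derive T x (/ (A (T x) * (x / (yb (T x) * yc (T x)))))).
{ intros x Hx Hj; specialize (Hop x Hx).
  destruct (T4 x) as [H1 H2]; [lra|].
  assert (H3 : u < T x) by (rewrite <- T2; apply T5; lra).
  assert (H4 : T x < w) by (rewrite <- T3; apply T5; lra).
  assert (H5 : T x <> j) by (intros E; apply Hj; rewrite <- E; auto).
  split; [split; assumption|split; [assumption|]].
  apply (T6 x (A (T x) * (x / (yb (T x) * yc (T x))))); [assumption| |].
  - rewrite <- Rmult_assoc; apply Rmult_lt_0_compat; [now apply HA|].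
    assert (G := gap_ratio_pos (T x) ltac:(lra)); rewrite H2 in G; exact G.
  - assert (G := gap_derive (T x) ltac:(lra) ltac:(lra) H5); rewrite H2 in G; exact G. }
constructor.
- intros x; apply (continuity_pt_comp T yb); auto.
- intros x; apply (continuity_pt_minus (fun x => ya (T x)) (fun x => yb (T x)));
  [apply (continuity_pt_comp T ya)|apply (continuity_pt_comp T yb)]; auto.
- intros x Hx; destruct (T4 x (Hcl x Hx)); apply Hb; lra.
- intros x Hx Hj; destruct (Hint x Hx Hj) as [H1 [H2 H3]].
  destruct (T4 x) as [_ H4]; [apply Hcl; lra|].
  assert (0 < yb (T x)) by (apply Hb; lra). assert (yb (T x) < yc (T x)) by (apply Hbc; lra).
  assert (A (T x) <> 0) by (intros E; specialize (HA (T x) H1 H2); rewrite E in HA; lra).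
  evar_last.
  + apply (is_derive_comp yb T); [apply Db; try assumption; lra|exact H3].
  + assert (Hx0 : yc (T x) = yb (T x) + x) by (unfold e in H4; lra).
    unfold scal; simpl; unfold mult; simpl; unfold n; rewrite Hx0.
    field; repeat split; lra.
- intros x Hx Hj; destruct (Hint x Hx Hj) as [H1 [H2 H3]].
  destruct (T4 x) as [_ H4]; [apply Hcl; lra|].
  assert (0 < yb (T x)) by (apply Hb; lra). assert (yb (T x) < yc (T x)) by (apply Hbc; lra).
  assert (A (T x) <> 0) by (intros E; specialize (HA (T x) H1 H2); rewrite E in HA; lra).
  assert (ya (T x) <> 0) by (apply Ha0; lra).
  evar_last.
  + apply @is_derive_minus;
    [apply (is_derive_comp ya T)|apply (is_derive_comp yb T)];
    try exact H3; [apply Da|apply Db]; try assumption; lra.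
  + assert (Hx0 : yc (T x) = yb (T x) + x) by (unfold e in H4; lra).
    unfold minus, plus, opp, scal; simpl; unfold mult; simpl; rewrite Hx0.
    field; repeat split; try lra.
Qed.

(** The roles of the two arcs in [no_two_branches] depend on the sign of A on the
    first arc and on the direction in which n varies, whence four cases. *)
Lemma no_three_around_loop : False.
Proof.
assert (Hsig2 : - sigma = 1 \/ - sigma = - 1) by (destruct Hsigma; [right|left]; lra).
destruct (arc_branch p s sigma) as [X0 [T1 [X1 [X2 [X3 [X4 X5]]]]]]; auto; try lra.
destruct (arc_branch s q (- sigma)) as [Y0 [T2 [Y1 [Y2 [Y3 [Y4 Y5]]]]]]; auto; try lra.
assert (Eq : e p = e q) by (unfold e; lra).
assert (Hpq0 : p < q) by lra.
(* the factor kappa of no_two_branches: the constant sign of (y_a - y_b) (y_a - y_c) *)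
assert (Habs : exists kappa, kappa <> 0 /\
  (forall t t', p <= t <= q -> p <= t' <= q -> 0 < kappa * ((ya t - yb t) * (ya t' - yc t')))).
{ exists ((ya p - yb p) * (ya p - yc p)).
  assert (ya p - yb p <> 0) by (apply Hab; lra).
  assert (ya p - yc p <> 0) by (apply Hac; lra).
  split; [now apply Rmult_integral_contrapositive_currified|].
  intros t t' Ht Ht'.
  replace ((ya p - yb p) * (ya p - yc p) * ((ya t - yb t) * (ya t' - yc t'))) with
    (((ya p - yb p) * (ya t - yb t)) * ((ya p - yc p) * (ya t' - yc t'))) by ring.
  apply Rmult_lt_0_compat.
  - apply (same_sign (fun t => ya t - yb t) p q); auto; try lra. now apply continuity_sub.
  - apply (same_sign (fun t => ya t - yc t) p q); auto; try lra. now apply continuity_sub. }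
destruct Habs as [kappa [Hk0 Hk]].
set (BR := fun e0 e1 T => branch e0 e1 (e j) (fun x => n (T x)) (fun x => yb (T x))
        (fun x => ya (T x) - yb (T x))).
assert (KEY : forall e0 e1 P Q, 0 < e0 -> e0 < e1 ->
  BR e0 e1 P -> BR e0 e1 Q ->
  (forall x, e0 <= x <= e1 -> p <= P x <= q /\ e (P x) = x) ->
  (forall x, e0 <= x <= e1 -> p <= Q x <= q /\ e (Q x) = x) ->
  ya (P e0) = ya (Q e0) -> yb (P e0) = yb (Q e0) ->
  ya (P e1) = ya (Q e1) -> yb (P e1) = yb (Q e1) ->
  (forall x x', e0 < x -> x < x' -> x' < e1 -> x <> e j -> x' <> e j ->
     n (P x') <= n (P x)) ->
  (forall x x', e0 < x -> x < x' -> x' < e1 -> x <> e j -> x' <> e j ->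
     n (Q x) <= n (Q x')) ->
  (forall x x', e0 < x -> x < x' -> x' < e1 -> x <> e j -> x' <> e j ->
     n (P x') < n (P x) \/ n (Q x) < n (Q x')) -> False).
{ intros e0 e1 P Q He0 He1 HP HQ RP RQ a0 b0 a1 b1 MP MQ MS.
  apply (no_two_branches e0 e1 (e j) _ _ _ _ _ _ He0 He1 HP HQ) with (kappa := kappa); auto.
  - lra.
  - lra.
  - intros x x' ? ? ? ? ?.
    specialize (MP x x'); specialize (MQ x x'); destruct (MS x x'); auto; intuition lra.
  - intros x Hx; destruct (RP x Hx) as [P1 P2]; destruct (RQ x Hx) as [Q1 Q2].
    replace (ya (P x) - yb (P x) - x) with (ya (P x) - yc (P x)) by (unfold e in P2; lra).
    now apply Hk.
  - intros x Hx; destruct (RP x Hx) as [P1 P2]; destruct (RQ x Hx) as [Q1 Q2].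
    replace (yb (P x) + (ya (P x) - yb (P x))) with (ya (P x)) by ring.
    replace (yb (Q x) + (ya (Q x) - yb (Q x))) with (ya (Q x)) by ring.
    now apply (same_sign ya p q). }
assert (Hne1 : forall x, x <> e j -> T1 x <> j \/ e (T1 x) <> x).
{ intros x Hx; destruct (Req_dec (T1 x) j) as [E|E]; [right; rewrite E; auto|auto]. }
assert (Hne2 : forall x, x <> e j -> T2 x <> j \/ e (T2 x) <> x).
{ intros x Hx; destruct (Req_dec (T2 x) j) as [E|E]; [right; rewrite E; auto|auto]. }
assert (epos : forall t, p <= t <= q -> 0 < e t).
{ intros t Ht; specialize (Hbc t Ht); unfold e; lra. }
assert (es := epos s ltac:(lra)); assert (ep := epos p ltac:(lra)).
rewrite <- Eq in *.
(* time increases with sigma e on the first arc and with - sigma e on the second *)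
assert (M1 : forall x y, x <> e j -> y <> e j -> sigma * e p < sigma * x ->
  sigma * x < sigma * y -> sigma * y < sigma * e s -> omega * n (T1 y) < omega * n (T1 x)).
{ intros x y Hx Hy ? ? ?.
  destruct (X3 x) as [_ x2]; [lra|]; destruct (X3 y) as [_ y2]; [lra|].
  apply N1; try (apply X4; lra).
  - rewrite <- X1; apply X4; lra.
  - rewrite <- X2; apply X4; lra.
  - destruct (Hne1 x Hx); tauto.
  - destruct (Hne1 y Hy); tauto. }
assert (M2 : forall x y, x <> e j -> y <> e j -> - sigma * e s < - sigma * x ->
  - sigma * x < - sigma * y -> - sigma * y < - sigma * e p -> omega * n (T2 y) <= omega * n (T2 x)).
{ intros x y Hx Hy ? ? ?.
  destruct (Y3 x) as [_ x2]; [lra|]; destruct (Y3 y) as [_ y2]; [lra|].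
  apply N2; try (apply Y4; lra).
  - rewrite <- Y1; apply Y4; lra.
  - rewrite <- Y2; apply Y4; lra.
  - destruct (Hne2 x Hx); tauto.
  - destruct (Hne2 y Hy); tauto. }
assert (R1 : forall x, sigma * e p <= sigma * x <= sigma * e s -> p <= T1 x <= q /\ e (T1 x) = x).
{ intros x Hx; destruct (X3 x Hx); split; [lra|assumption]. }
assert (R2 : forall x, - sigma * e s <= - sigma * x <= - sigma * e p -> p <= T2 x <= q /\ e (T2 x) = x).
{ intros x Hx; destruct (Y3 x Hx); split; [lra|assumption]. }
clear X3 X4 Y3 Y4.
destruct Hsigma as [Es|Es]; rewrite Es in *; destruct Homega as [Eo|Eo]; rewrite Eo in *.
- apply (KEY (e p) (e s) T1 T2); try lra.
  + apply X5; intros; lra.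
  + apply Y5; intros; lra.
  + intros x Hx; apply R1; lra.
  + intros x Hx; apply R2; lra.
  + rewrite X1, Y2; auto.
  + rewrite X1, Y2; auto.
  + rewrite X2, Y1; auto.
  + rewrite X2, Y1; auto.
  + intros x x' ? ? ? ? ?; assert (H4 := M1 x x'); lra.
  + intros x x' ? ? ? ? ?; assert (H4 := M2 x' x); lra.
  + intros x x' ? ? ? ? ?; assert (H4 := M1 x x'); left; lra.
- apply (KEY (e p) (e s) T2 T1); try lra.
  + apply Y5; intros; lra.
  + apply X5; intros; lra.
  + intros x Hx; apply R2; lra.
  + intros x Hx; apply R1; lra.
  + rewrite X1, Y2; auto.
  + rewrite X1, Y2; auto.
  + rewrite X2, Y1; auto.
  + rewrite X2, Y1; auto.
  + intros x x' ? ? ? ? ?; assert (H4 := M2 x' x); lra.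
  + intros x x' ? ? ? ? ?; assert (H4 := M1 x x'); lra.
  + intros x x' ? ? ? ? ?; assert (H4 := M1 x x'); right; lra.
- apply (KEY (e s) (e p) T2 T1); try lra.
  + apply Y5; intros; lra.
  + apply X5; intros; lra.
  + intros x Hx; apply R2; lra.
  + intros x Hx; apply R1; lra.
  + rewrite X2, Y1; auto.
  + rewrite X2, Y1; auto.
  + rewrite X1, Y2; auto.
  + rewrite X1, Y2; auto.
  + intros x x' ? ? ? ? ?; assert (H4 := M2 x x'); lra.
  + intros x x' ? ? ? ? ?; assert (H4 := M1 x' x); lra.
  + intros x x' ? ? ? ? ?; assert (H4 := M1 x' x); right; lra.
- apply (KEY (e s) (e p) T1 T2); try lra.
  + apply X5; intros; lra.
  + apply Y5; intros; lra.
  + intros x Hx; apply R1; lra.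
  + intros x Hx; apply R2; lra.
  + rewrite X2, Y1; auto.
  + rewrite X2, Y1; auto.
  + rewrite X1, Y2; auto.
  + rewrite X1, Y2; auto.
  + intros x x' ? ? ? ? ?; assert (H4 := M1 x' x); lra.
  + intros x x' ? ? ? ? ?; assert (H4 := M2 x x'); lra.
  + intros x x' ? ? ? ? ?; assert (H4 := M1 x' x); left; lra.
Qed.
End Loop.

(** * Closed solutions extended to the real line *)

Definition clamp (t : R) : R := Rmax 0 (Rmin 1 t).

Lemma clamp_id t : 0 <= t <= 1 -> clamp t = t.
Proof. intros H; unfold clamp; rewrite Rmin_right, Rmax_right; lra. Qed.

Lemma clamp_range t : 0 <= clamp t <= 1.
Proof. unfold clamp, Rmax, Rmin; repeat destruct (Rle_dec _ _); lra. Qed.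

Lemma clamp_low t : t <= 0 -> clamp t = 0.
Proof. unfold clamp, Rmax, Rmin; repeat destruct (Rle_dec _ _); lra. Qed.

Lemma clamp_high t : 1 <= t -> clamp t = 1.
Proof. unfold clamp, Rmax, Rmin; repeat destruct (Rle_dec _ _); lra. Qed.

Lemma clamp_lipschitz s t : Rabs (clamp s - clamp t) <= Rabs (s - t).
Proof.
unfold clamp, Rmax, Rmin, Rabs; repeat destruct (Rle_dec _ _);
  repeat destruct (Rcase_abs _); lra.
Qed.

Lemma clamp_cont : continuity clamp.
Proof.
intros t e He; exists e; split; [exact He|]; intros z [_ Hz]; simpl in *; unfold R_dist in *.
apply Rle_lt_trans with (2 := Hz), clamp_lipschitz.
Qed.

(** A closed solution is made constant outside [0,1], so that it is continuous on
    the whole line; the one-sided derivatives at 0 and 1 are recovered from the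
    equation inside the interval by [closed_of_interior]. *)
Record periodic_solution (A B x : R -> R) : Prop := {
  periodic_cont : continuity x;
  periodic_derive : forall t, 0 < t < 1 -> is_derive x t (A t * x t ^ 3 + B t * x t ^ 2);
  periodic_closed : x 0 = x 1;
  periodic_clamp : forall t, x t = x (clamp t) }.

Lemma closed_periodic (A B x : R -> R) :
  closed_solution A B x -> periodic_solution A B (fun t => x (clamp t)).
Proof.
intros [Hx H01]; constructor.
- intros t eps Heps.
  assert (Hc := cont_deriv _ _ _ _ (Hx (clamp t) (clamp_range t))).
  destruct (Hc eps Heps) as [alp [Halp Hal]].
  exists alp; split; [assumption|]; intros z [_ Hz]; simpl in *; unfold R_dist in *.
  destruct (Req_dec (clamp z) (clamp t)) as [E|E].
  + rewrite E, Rminus_diag, Rabs_R0; exact Heps.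
  + apply Hal; split.
    * split; [apply clamp_range|auto].
    * apply Rle_lt_trans with (2 := Hz), clamp_lipschitz.
- intros t Ht; rewrite clamp_id by lra.
  apply (is_derive_ext_loc x).
  + apply locally_near with (eps := Rmin t (1 - t)); [apply Rmin_pos; lra|]; intros z Hz.
    assert (B1 := Rmin_l t (1 - t)); assert (B2 := Rmin_r t (1 - t)).
    rewrite clamp_id; [reflexivity|lra].
  + apply is_derive_Reals; intros eps Heps.
    destruct (Hx t ltac:(unfold unit_interval; lra) eps Heps) as [alp [Halp Hal]].
    assert (Hp : 0 < Rmin alp (Rmin t (1 - t))) by (repeat apply Rmin_pos; lra).
    exists (mkposreal _ Hp); intros h Hh0 Hh; simpl in Hh.
    assert (Rabs h < alp) by (eapply Rlt_le_trans; [exact Hh|apply Rmin_l]).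
    assert (Hh2 : Rabs h < Rmin t (1 - t)) by (eapply Rlt_le_trans; [exact Hh|apply Rmin_r]).
    assert (Rmin t (1 - t) <= t) by apply Rmin_l.
    assert (Rmin t (1 - t) <= 1 - t) by apply Rmin_r.
    apply Rabs_def2 in Hh2.
    specialize (Hal (t + h)); simpl in Hal; unfold R_dist in Hal.
    replace (t + h - t) with h in Hal by ring.
    apply Hal; split; [split|assumption]; [unfold unit_interval|]; lra.
- rewrite (clamp_low 0), (clamp_high 1) by lra; exact H01.
- intros t; now rewrite (clamp_id (clamp t)) by apply clamp_range.
Qed.

(** At the end points the one-sided difference quotients are values of the
    continuous right-hand side at intermediate points. *)
Lemma closed_of_interior (A B x : R -> R) :
  continuity A -> continuity B -> continuity x ->
  (forall t, 0 < t < 1 -> is_derive x t (A t * x t ^ 3 + B t * x t ^ 2)) ->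
  x 0 = x 1 -> closed_solution A B x.
Proof.
intros HA HB Hc Hd H01; split; [|exact H01].
set (r := fun s => A s * x s ^ 3 + B s * x s ^ 2).
assert (Hpow : forall k, continuity (fun s => x s ^ k)).
{ intros k s; apply (continuity_pt_comp x (fun y => y ^ k)); [apply Hc|].
  apply derivable_continuous_pt, derivable_pt_pow. }
assert (Hr : continuity r).
{ intros s; apply continuity_pt_plus; apply continuity_pt_mult;
  [apply HA|apply (Hpow 3%nat)|apply HB|apply (Hpow 2%nat)]. }
intros t Ht eps Heps; fold r.
destruct (Hr t eps Heps) as [alp [Halp Hal]].
exists alp; split; [assumption|]; intros z [[Hz Hzt] Hd']; simpl in *; unfold R_dist in *.
unfold unit_interval in *.
assert (X : exists c, Rmin t z < c < Rmax t z /\ (x z - x t) / (z - t) = r c).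
{ destruct (Rlt_le_dec z t) as [H|H].
  - destruct (mean_value x (fun c d => d = r c) z t (fun z _ => Hc z) H) as [c [d [H1 [H2 H3]]]].
    + intros c Hc'; exists (r c); split; [apply Hd; lra|reflexivity].
    + exists c; rewrite Rmin_right, Rmax_left by lra; split; [lra|].
      rewrite <- H2; replace (x z - x t) with (- (x t - x z)) by ring; rewrite H3; field; lra.
  - destruct (mean_value x (fun c d => d = r c) t z (fun z _ => Hc z)) as [c [d [H1 [H2 H3]]]]; [lra| |].
    + intros c Hc'; exists (r c); split; [apply Hd; lra|reflexivity].
    + exists c; rewrite Rmin_left, Rmax_right by lra; split; [lra|].
      rewrite <- H2, H3; field; lra. }
destruct X as [c [H1 H2]]; rewrite H2.
specialize (Hal c); apply Hal.
unfold D_x, no_cond; revert H1 Hd'; unfold Rmin, Rmax, Rabs;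
  repeat destruct (Rle_dec _ _); repeat destruct (Rcase_abs _); intros; repeat split; lra.
Qed.

(** The difference of two solutions satisfies a linear homogeneous equation with
    bounded coefficient. *)
Lemma periodic_unique (A B x y : R -> R) (t0 : R) :
  continuity A -> continuity B -> periodic_solution A B x -> periodic_solution A B y ->
  0 <= t0 <= 1 -> x t0 = y t0 -> forall t, x t = y t.
Proof.
intros HA HB [Cx Dx _ Kx] [Cy Dy _ Ky] Ht0 E.
enough (H : forall t, 0 <= t <= 1 -> x t = y t).
{ intros t; rewrite Kx, Ky; apply H, clamp_range. }
intros t Ht.
set (q := fun t => A t * (x t * x t + x t * y t + y t * y t) + B t * (x t + y t)).
assert (Hq : continuity q).
{ intros z; specialize (HA z); specialize (HB z); specialize (Cx z); specialize (Cy z).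
  apply (continuity_pt_plus (fun t => A t * (x t * x t + x t * y t + y t * y t)) (fun t => B t * (x t + y t))).
  - apply (continuity_pt_mult A); [assumption|].
    apply (continuity_pt_plus (fun t => x t * x t + x t * y t) (fun t => y t * y t));
     [apply (continuity_pt_plus (fun t => x t * x t) (fun t => x t * y t))|];
     apply continuity_pt_mult; assumption.
  - apply (continuity_pt_mult B); [assumption|].
    apply continuity_pt_plus; assumption. }
destruct (bounded_on q 0 1 Hq) as [K HK].
assert (x t - y t = 0); [|lra].
apply (linear_ode_zero (fun t => x t - y t) 0 1 t0 K); auto; try lra.
- now apply continuity_sub.
- intros z Hz; exists (q z); split; [|apply HK; lra].
  evar_last; [apply @is_derive_minus; [apply Dx|apply Dy]; assumption|].
  unfold minus, plus, opp, q; simpl; ring.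
Qed.

Lemma periodic_zero (A B : R -> R) : periodic_solution A B (fun _ => 0).
Proof.
constructor; auto.
- intros t; apply continuity_pt_const; intros ? ?; reflexivity.
- intros t _; evar_last; [apply @is_derive_const|]. unfold zero; simpl; ring.
Qed.

Lemma periodic_neq (A B x y : R -> R) :
  continuity A -> continuity B -> periodic_solution A B x -> periodic_solution A B y ->
  x 0 <> y 0 -> forall t, x t - y t <> 0.
Proof.
intros HA HB Hx Hy Hn t E; apply Hn.
rewrite (periodic_clamp _ _ _ Hx), (periodic_clamp _ _ _ Hy) in E.
apply (periodic_unique A B x y (clamp t)); auto; [apply clamp_range|lra].
Qed.

Lemma periodic_nonzero (A B x : R -> R) :
  continuity A -> continuity B -> periodic_solution A B x -> x 0 <> 0 ->
  forall t, x t <> 0.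
Proof.
intros HA HB Hx Hn t E.
apply (periodic_neq A B x (fun _ => 0) HA HB Hx (periodic_zero A B) Hn t); lra.
Qed.

Lemma periodic_opp (A B x : R -> R) :
  periodic_solution A B x -> periodic_solution A (fun t => - B t) (fun t => - x t).
Proof.
intros [Hc Hd H Hcl]; constructor.
- intros t; apply continuity_pt_opp, Hc.
- intros t Ht; evar_last; [apply @is_derive_opp, Hd, Ht|].
  unfold opp; simpl; ring.
- now rewrite H.
- intros t; now rewrite Hcl.
Qed.

(** * Combinations of the coefficients that keep their sign *)

Lemma periodic_sign (A B x : R -> R) :
  continuity A -> continuity B -> periodic_solution A B x -> x 0 <> 0 ->
  forall s t, 0 < x s * x t.
Proof.
intros HA HB Hx H0 s t.
assert (Hn := periodic_nonzero A B x HA HB Hx H0).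
apply (same_sign x (Rmin s t) (Rmax s t)); [apply Hx|auto| |];
 split; (apply Rmin_l || apply Rmin_r || apply Rmax_l || apply Rmax_r).
Qed.

Lemma periodic_gap_sign (A B x y : R -> R) :
  continuity A -> continuity B -> periodic_solution A B x -> periodic_solution A B y ->
  x 0 <> y 0 -> forall s t, 0 < (x s - y s) * (x t - y t).
Proof.
intros HA HB Hx Hy H0 s t.
apply (same_sign (fun t => x t - y t) (Rmin s t) (Rmax s t)).
- apply continuity_sub; [apply Hx|apply Hy].
- intros z _; now apply (periodic_neq A B).
- split; [apply Rmin_l|apply Rmax_l].
- split; [apply Rmin_r|apply Rmax_r].
Qed.

(** The quantity 1/y - 1/x has derivative A (x - y), of constant sign; this is
    the case k = infinity of [one_signed_same_side]. *)
Lemma one_signed_cubic (A B x y : R -> R) (sigma j : R) :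
  continuity A -> continuity B -> periodic_solution A B x -> periodic_solution A B y ->
  x 0 <> 0 -> y 0 <> 0 -> x 0 <> y 0 ->
  (forall t, 0 < t < 1 -> t <> j -> 0 < sigma * A t) -> False.
Proof.
intros HA HB Hx Hy Hx0 Hy0 Hxy HS.
assert (Nx := periodic_nonzero A B x HA HB Hx Hx0).
assert (Ny := periodic_nonzero A B y HA HB Hy Hy0).
set (k := sigma * (x 0 - y 0)).
assert (Hlt : k * (/ y 0 - / x 0) < k * (/ y 1 - / x 1)).
{ apply (increasing_of_derive_pos_except (fun t => k * (/ y t - / x t)) 0 1 j); [|lra|].
  - intros t; apply (continuity_pt_scal (fun t => / y t - / x t)).
    apply continuity_pt_minus; apply continuity_pt_inv; auto; [apply Hy|apply Hx].
  - intros t Ht Hj; exists ((sigma * A t) * ((x 0 - y 0) * (x t - y t))); split.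
    + evar_last.
      * apply is_derive_scal, @is_derive_minus; apply is_derive_inv; auto;
          [apply Hy|apply Hx]; assumption.
      * unfold minus, plus, opp, k; simpl; field; auto.
    + apply Rmult_lt_0_compat; [auto|]. now apply (periodic_gap_sign A B). }
rewrite (periodic_closed _ _ _ Hx), (periodic_closed _ _ _ Hy) in Hlt; lra.
Qed.

(** With C = k A + B, the function w = x - k satisfies w' = x^2 A w + x^2 C.  When
    C keeps its sign, w can pass through zero in one direction only, which
    contradicts w(0) = w(1). *)
Lemma never_meets_line (A B x : R -> R) (k sigma j : R) :
  continuity A -> continuity B -> periodic_solution A B x -> x 0 <> 0 ->
  (forall t, 0 < t < 1 -> t <> j -> 0 < sigma * (k * A t + B t)) ->
  forall t, x t <> k.
Proof.
intros HA HB Hx Hx0 HS.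
assert (Nx := periodic_nonzero A B x HA HB Hx Hx0).
enough (H : forall t, 0 <= t <= 1 -> x t <> k).
{ intros t; rewrite (periodic_clamp _ _ _ Hx); apply H, clamp_range. }
intros t0 Ht0 Ek.
set (w := fun t => sigma * (x t - k)).
assert (Cw : continuity w).
{ intros t; apply (continuity_pt_scal (fun t => x t - k)); apply continuity_pt_minus.
  - apply Hx.
  - apply continuity_pt_const; intros ? ?; reflexivity. }
assert (Dw : forall t, 0 < t < 1 ->
  is_derive w t (x t * x t * A t * w t + x t * x t * (sigma * (k * A t + B t)))).
{ intros t Ht; unfold w; evar_last.
  - apply is_derive_scal, @is_derive_minus; [apply Hx; assumption|apply @is_derive_const].
  - unfold minus, plus, opp, zero; simpl; ring. }
assert (Cq : continuity (fun t => x t * x t * A t)).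
{ intros t; assert (C := periodic_cont _ _ _ Hx t).
  apply continuity_pt_mult; [apply continuity_pt_mult|]; auto. }
destruct (bounded_on _ 0 1 Cq) as [K HK].
assert (Hpos : forall t, 0 < t < 1 -> t <> j -> 0 < x t * x t * (sigma * (k * A t + B t))).
{ intros t Ht Hj; apply Rmult_lt_0_compat; [|auto]; specialize (Nx t); nra. }
assert (F : forall s, 0 <= s <= 1 -> w s = 0 -> forall t, s <= t <= 1 -> 0 <= w t).
{ intros s Hs Es; apply (nonneg_forward_except w s 1 j K); [exact Cw|lra|].
  intros t Ht Hj Hn; eexists; split; [apply Dw; lra|].
  specialize (Hpos t ltac:(lra) Hj); specialize (HK t ltac:(lra)); apply Rabs_le_between in HK; nra. }
assert (G : forall s, 0 <= s <= 1 -> w s = 0 -> forall t, 0 <= t <= s -> 0 <= - w t).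
{ intros s Hs Es; apply (nonneg_backward_except (fun t => - w t) 0 s j K).
  - intros t; apply continuity_pt_opp, Cw.
  - lra.
  - intros t Ht Hj Hn; eexists; split; [apply @is_derive_opp, Dw; lra|].
    specialize (Hpos t ltac:(lra) Hj); specialize (HK t ltac:(lra)); apply Rabs_le_between in HK.
    unfold opp; simpl; nra. }
assert (W0 : w t0 = 0) by (unfold w; rewrite Ek; ring).
assert (E01 : w 0 = w 1) by (unfold w; rewrite (periodic_closed _ _ _ Hx); reflexivity).
assert (w 0 = 0).
{ assert (H1 := F t0 Ht0 W0 1 ltac:(lra)); assert (H2 := G t0 Ht0 W0 0 ltac:(lra)); lra. }
assert (Z : forall t, 0 <= t <= 1 -> w t = 0).
{ intros t Ht; assert (H1 := F 0 ltac:(lra) H t ltac:(lra)).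
  assert (H2 := G 1 ltac:(lra) ltac:(lra) t ltac:(lra)); lra. }
assert (X : exists t, 0 < t < 1 /\ t <> j).
{ destruct (Req_dec j (1/2)); [exists (1/3)|exists (1/2)]; lra. }
destruct X as [t [Ht Hj]].
assert (D := Dw t Ht); rewrite (Z t), Rmult_0_r, Rplus_0_l in D by lra.
assert (E : x t * x t * (sigma * (k * A t + B t)) = 0); [|specialize (Hpos t Ht Hj); lra].
rewrite <- (is_derive_unique _ _ _ D); apply is_derive_unique.
apply (is_derive_ext_loc (fun _ => 0)); [|apply @is_derive_const].
apply locally_near with (eps := Rmin t (1 - t)); [apply Rmin_pos; lra|]; intros z Hz.
assert (B1 := Rmin_l t (1 - t)); assert (B2 := Rmin_r t (1 - t)).
rewrite Z; [reflexivity|lra].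
Qed.

(** For k = 0 the poles merge and no logarithm occurs. *)
Lemma primitive_double_pole (k : R) :
  exists H : R -> R, forall z, z <> 0 -> z <> k -> is_derive H z (/ (z ^ 2 * (z - k))).
Proof.
destruct (Req_dec k 0) as [->|Hk].
- exists (fun z => - / (2 * z ^ 2)); intros z Hz _.
  auto_derive; [|field; auto]. simpl; nra.
- exists (fun z => - ln (z ^ 2) / (2 * k ^ 2) + / (k * z) + ln ((z - k) ^ 2) / (2 * k ^ 2)).
  intros z Hz Hzk; auto_derive.
  + assert (0 < z * z) by nra. assert (0 < (z - k) * (z - k)) by (assert (z - k <> 0) by lra; nra).
    repeat split; try lra; simpl.
    now apply Rmult_integral_contrapositive_currified.
  + field; repeat split; auto; lra.
Qed.

(** Along a solution the primitive H of 1/(x^2 (x - k)) has derivative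
    A + C/(x - k); in the difference of two solutions A cancels. *)
Lemma one_signed_same_side (A B x y : R -> R) (k sigma j : R) :
  continuity A -> continuity B -> periodic_solution A B x -> periodic_solution A B y ->
  x 0 <> 0 -> y 0 <> 0 -> x 0 <> y 0 -> 0 < (x 0 - k) * (y 0 - k) ->
  (forall t, 0 < t < 1 -> t <> j -> 0 < sigma * (k * A t + B t)) -> False.
Proof.
intros HA HB Hx Hy Hx0 Hy0 Hxy Hside HS.
assert (Nx := periodic_nonzero A B x HA HB Hx Hx0).
assert (Ny := periodic_nonzero A B y HA HB Hy Hy0).
assert (Lx := never_meets_line A B x k sigma j HA HB Hx Hx0 HS).
assert (Ly := never_meets_line A B y k sigma j HA HB Hy Hy0 HS).
assert (Hs : forall t, 0 < (x t - k) * (y t - k)).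
{ intros t.
  assert (S : forall z, continuity z -> (forall t, z t <> k) -> 0 < (z 0 - k) * (z t - k)).
  { intros z Cz Hz; apply (same_sign (fun t => z t - k) (Rmin 0 t) (Rmax 0 t)).
    - intros s; apply continuity_pt_minus; [apply Cz|apply continuity_pt_const; intros ? ?; reflexivity].
    - intros s _; specialize (Hz s); lra.
    - split; [apply Rmin_l|apply Rmax_l].
    - split; [apply Rmin_r|apply Rmax_r]. }
  assert (S1 := S x ltac:(apply Hx) Lx); assert (S2 := S y ltac:(apply Hy) Ly).
  assert (P := Rmult_lt_0_compat _ _ S1 S2).
  replace ((x 0 - k) * (x t - k) * ((y 0 - k) * (y t - k)))
    with (((x 0 - k) * (y 0 - k)) * ((x t - k) * (y t - k))) in P by ring.
  apply Rmult_lt_reg_l with (1 := Hside); lra. }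
destruct (primitive_double_pole k) as [H HH].
set (c := - sigma * (x 0 - y 0)).
assert (Hlt : c * (H (x 0) - H (y 0)) < c * (H (x 1) - H (y 1))).
{ apply (increasing_of_derive_pos_except (fun t => c * (H (x t) - H (y t))) 0 1 j); [|lra|].
  - intros t; apply (continuity_pt_scal (fun t => H (x t) - H (y t))).
    apply continuity_pt_minus.
    + apply (continuity_pt_comp x H); [apply Hx|eapply derivable_continuity_pt, HH; auto].
    + apply (continuity_pt_comp y H); [apply Hy|eapply derivable_continuity_pt, HH; auto].
  - intros t Ht Hj.
    exists ((sigma * (k * A t + B t)) * ((x 0 - y 0) * (x t - y t)) / ((x t - k) * (y t - k))); split.
    + evar_last.
      * apply is_derive_scal, @is_derive_minus.
        -- apply (is_derive_comp H x); [apply HH; auto|apply Hx; assumption].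
        -- apply (is_derive_comp H y); [apply HH; auto|apply Hy; assumption].
      * unfold minus, plus, opp, scal, c; simpl; unfold mult; simpl.
        specialize (Lx t); specialize (Ly t); field; repeat split; auto; lra.
    + apply Rdiv_lt_0_compat; [|apply Hs].
      apply Rmult_lt_0_compat; [auto|]. now apply (periodic_gap_sign A B). }
rewrite (periodic_closed _ _ _ Hx), (periodic_closed _ _ _ Hy) in Hlt; lra.
Qed.

Lemma one_signed_three (A B x y z : R -> R) (al be sigma j : R) :
  continuity A -> continuity B -> periodic_solution A B x -> periodic_solution A B y ->
  periodic_solution A B z ->
  x 0 <> 0 -> y 0 <> 0 -> z 0 <> 0 -> x 0 <> y 0 -> y 0 <> z 0 -> x 0 <> z 0 ->
  (forall t, 0 < t < 1 -> t <> j -> 0 < sigma * (al * A t + be * B t)) -> False.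
Proof.
intros HA HB Hx Hy Hz x0 y0 z0 xy yz xz HS.
destruct (Req_dec be 0) as [Eb|Hb].
- apply (one_signed_cubic A B x y (sigma * al) j); auto.
  intros t Ht Hj; specialize (HS t Ht Hj); rewrite Eb in HS; lra.
- set (k := al / be).
  assert (HS' : forall t, 0 < t < 1 -> t <> j -> 0 < (sigma * be) * (k * A t + B t)).
  { intros t Ht Hj; specialize (HS t Ht Hj).
    replace (sigma * be * (k * A t + B t)) with (sigma * (al * A t + be * B t))
      by (unfold k; field; auto); assumption. }
  assert (X : forall x, periodic_solution A B x -> x 0 <> 0 -> x 0 - k <> 0).
  { intros u Hu u0; assert (L := never_meets_line A B u k _ j HA HB Hu u0 HS' 0); lra. }
  assert (kx := X x Hx x0); assert (ky := X y Hy y0); assert (kz := X z Hz z0).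
  assert (D : 0 < (x 0 - k) * (y 0 - k) \/ 0 < (y 0 - k) * (z 0 - k) \/ 0 < (x 0 - k) * (z 0 - k)).
  { assert (S : forall u, u <> 0 -> 0 < u \/ u < 0) by (intros; lra).
    destruct (S _ kx); destruct (S _ ky); destruct (S _ kz);
    try (left; nra); try (right; left; nra); right; right; nra. }
  destruct D as [D|[D|D]].
  + now apply (one_signed_same_side A B x y k (sigma * be) j).
  + now apply (one_signed_same_side A B y z k (sigma * be) j).
  + now apply (one_signed_same_side A B x z k (sigma * be) j).
Qed.

(** * Signs of trinomials on the unit interval *)

Ltac splits := repeat match goal with |- _ /\ _ => split end.

Section Hat.
Variables (p q : nat).

(** A trinomial divided by its lowest power of t.  Its derivative is t^p times
    [slope], which is monotone in t because it has two terms only. *)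
Definition hat (c0 c1 c2 t : R) : R := c0 + c1 * t ^ S p + c2 * t ^ (S p + S q).
Definition slope (c1 c2 t : R) : R := INR (S p) * c1 + INR (S p + S q) * c2 * t ^ S q.

Lemma hat_derive c0 c1 c2 t : is_derive (hat c0 c1 c2) t (t ^ p * slope c1 c2 t).
Proof.
assert (H : forall n m, is_derive (fun t => c0 + c1 * t ^ n + c2 * t ^ m) t
  (c1 * (INR n * t ^ pred n) + c2 * (INR m * t ^ pred m)))
  by (intros n m; auto_derive; auto; ring).
evar_last; [apply H|]; unfold slope.
replace (pred (S p + S q)) with (p + S q)%nat by reflexivity.
replace (pred (S p)) with p by reflexivity.
rewrite pow_add; ring.
Qed.

Lemma hat_cont c0 c1 c2 : continuity (hat c0 c1 c2).
Proof. intros t; eapply derivable_continuity_pt, hat_derive. Qed.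

Lemma slope_cont c1 c2 : continuity (slope c1 c2).
Proof.
intros t.
assert (H : forall a b n, continuity_pt (fun t => a + b * t ^ n) t)
  by (intros a b n; eapply derivable_continuity_pt; auto_derive; auto; ring).
apply H.
Qed.

Lemma pow_lt_strict (u v : R) (k : nat) : 0 <= u < v -> u ^ S k < v ^ S k.
Proof.
intros H; induction k as [|k IH]; [simpl; lra|].
change (u * u ^ S k < v * v ^ S k).
assert (0 <= u ^ S k) by (apply pow_le; lra).
nra.
Qed.

Lemma slope_anti c1 c2 sigma u v : sigma * c2 < 0 -> 0 <= u < v ->
  sigma * slope c1 c2 v < sigma * slope c1 c2 u.
Proof.
intros Hc Huv; unfold slope.
assert (H := pow_lt_strict u v q Huv).
assert (0 < INR (S p + S q)) by (apply lt_0_INR; lia).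
assert (0 < (- (sigma * c2)) * (INR (S p + S q) * (v ^ S q - u ^ S q))); [|lra].
apply Rmult_lt_0_compat; [lra|apply Rmult_lt_0_compat; lra].
Qed.

Lemma hat_increasing c0 c1 c2 sigma u v :
  0 <= u < v -> (forall t, u < t < v -> 0 < sigma * slope c1 c2 t) ->
  sigma * hat c0 c1 c2 u < sigma * hat c0 c1 c2 v.
Proof.
intros Huv H.
apply (increasing_of_derive_pos (fun t => sigma * hat c0 c1 c2 t) u v); [|lra|].
- intros t _; apply (continuity_pt_scal (hat c0 c1 c2)), hat_cont.
- intros t Ht; eexists; split; [apply is_derive_scal, hat_derive|].
  specialize (H t Ht); assert (0 < t ^ p) by (apply pow_lt; lra).
  replace (sigma * (t ^ p * slope c1 c2 t)) with (t ^ p * (sigma * slope c1 c2 t)) by ring.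
  now apply Rmult_lt_0_compat.
Qed.

(** The slope changes sign at most once. *)
Lemma hat_unimodal c0 c1 c2 : c1 <> 0 \/ c2 <> 0 ->
  exists sigma tau, (sigma = 1 \/ sigma = - 1) /\ 0 <= tau <= 1 /\
   (forall u v, 0 <= u < v -> v <= tau -> sigma * hat c0 c1 c2 u < sigma * hat c0 c1 c2 v) /\
   (forall u v, tau <= u < v -> v <= 1 -> sigma * hat c0 c1 c2 v < sigma * hat c0 c1 c2 u) /\
   (forall t, 0 < t <= tau -> 0 <= sigma * slope c1 c2 t) /\
   (forall t, tau <= t < 1 -> sigma * slope c1 c2 t <= 0).
Proof.
intros Hc.
assert (X : exists sigma tau, (sigma = 1 \/ sigma = - 1) /\ 0 <= tau <= 1 /\
   (forall t, 0 < t < tau -> 0 < sigma * slope c1 c2 t) /\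
   (forall t, tau < t < 1 -> 0 < - sigma * slope c1 c2 t) /\
   (0 < tau < 1 -> slope c1 c2 tau = 0) /\
   (tau = 0 -> sigma * slope c1 c2 0 <= 0) /\
   (tau = 1 -> 0 <= sigma * slope c1 c2 1)).
{ destruct (Req_dec c2 0) as [E|E].
  - assert (Hs : forall t, slope c1 c2 t = INR (S p) * c1)
      by (intros t; unfold slope; rewrite E; ring).
    assert (Hp : 0 < INR (S p)) by (apply lt_0_INR; lia).
    assert (Hs' : exists sigma, (sigma = 1 \/ sigma = - 1) /\ 0 < sigma * (INR (S p) * c1)).
    { destruct (Rlt_le_dec 0 c1); [exists 1|exists (- 1)]; split; auto; [nra|].
      assert (c1 < 0) by (destruct Hc; lra). nra. }
    destruct Hs' as [sigma [S1 S2]].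
    exists sigma, 1; splits; intros; try rewrite Hs; auto; lra.
  - assert (Hs' : exists sigma, (sigma = 1 \/ sigma = - 1) /\ sigma * c2 < 0).
    { destruct (Rlt_le_dec 0 c2); [exists (- 1)|exists 1]; split; auto; lra. }
    destruct Hs' as [sigma [S1 S2]]; exists sigma.
    assert (M := fun u v => slope_anti c1 c2 sigma u v S2).
    destruct (Rle_lt_dec (sigma * slope c1 c2 0) 0) as [L0|L0].
    { exists 0; splits; try lra; auto; try (intros; lra).
      intros t Ht; specialize (M 0 t); lra. }
    destruct (Rle_lt_dec 0 (sigma * slope c1 c2 1)) as [L1|L1].
    { exists 1; splits; try lra; auto; try (intros; lra).
      intros t Ht; specialize (M t 1); lra. }
    destruct (IVT_cor (slope c1 c2) 0 1) as [tau [T1 T2]].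
    { apply slope_cont. } { lra. } { destruct S1 as [-> | ->]; nra. }
    exists tau.
    assert (tau <> 0) by (intros ->; rewrite T2 in L0; lra).
    assert (tau <> 1) by (intros ->; rewrite T2 in L1; lra).
    splits; try lra; auto; try (intros; lra); intros t Ht.
    + specialize (M t tau); rewrite T2 in M; lra.
    + specialize (M tau t); rewrite T2 in M; lra. }
destruct X as [sigma [tau [S1 [T [A1 [A2 [A3 [A4 A5]]]]]]]].
exists sigma, tau; split; [exact S1|split; [exact T|split; [|split; [|split]]]].
- intros u v Huv Hv; apply hat_increasing; [lra|]; intros; apply A1; lra.
- intros u v Huv Hv.
  assert (H := hat_increasing c0 c1 c2 (- sigma) u v ltac:(lra) ltac:(intros; apply A2; lra)); lra.
- intros t Ht; destruct (Req_dec t tau) as [E|].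
  + subst t; destruct (Req_dec tau 1) as [E|]; [rewrite E at 1; auto|rewrite A3; lra].
  + apply Rlt_le, A1; lra.
- intros t Ht; destruct (Req_dec t tau) as [E|].
  + subst t; destruct (Req_dec tau 0) as [E|]; [rewrite E at 1; apply A4; lra|rewrite A3; lra].
  + specialize (A2 t); lra.
Qed.

Lemma constant_or_not (c1 c2 : R) : (c1 = 0 /\ c2 = 0) \/ (c1 <> 0 \/ c2 <> 0).
Proof. destruct (Req_dec c1 0); destruct (Req_dec c2 0); auto. Qed.

(** Among four alternating values there is an inner local minimum and an inner
    local maximum; a unimodal function has only one of the two. *)
Lemma hat_no_alternation c0 c1 c2 k t1 t2 t3 t4 :
  0 <= t1 -> t1 < t2 -> t2 < t3 -> t3 < t4 -> t4 <= 1 ->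
  0 < k * hat c0 c1 c2 t1 -> k * hat c0 c1 c2 t2 < 0 ->
  0 < k * hat c0 c1 c2 t3 -> k * hat c0 c1 c2 t4 < 0 -> False.
Proof.
intros H1 H2 H3 H4 H5 P1 P2 P3 P4.
destruct (constant_or_not c1 c2) as [[E1 E2]|Hc].
{ unfold hat in *; rewrite E1, E2 in *; lra. }
assert (K : (0 < hat c0 c1 c2 t1 /\ hat c0 c1 c2 t2 < 0 /\ 0 < hat c0 c1 c2 t3 /\
    hat c0 c1 c2 t4 < 0) \/
  (hat c0 c1 c2 t1 < 0 /\ 0 < hat c0 c1 c2 t2 /\ hat c0 c1 c2 t3 < 0 /\ 0 < hat c0 c1 c2 t4))
  by (destruct (Rlt_le_dec 0 k); [left|right]; splits; nra).
destruct (hat_unimodal c0 c1 c2 Hc) as [sigma [tau [S1 [T [M1 [M2 _]]]]]].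
assert (A12 := M1 t1 t2); assert (A23 := M1 t2 t3); assert (A34 := M1 t3 t4).
assert (B12 := M2 t1 t2); assert (B23 := M2 t2 t3); assert (B34 := M2 t3 t4).
destruct (Rle_dec t2 tau); destruct (Rle_dec t3 tau); destruct S1 as [-> | ->];
  destruct K as [K|K]; lra.
Qed.

Lemma hat_double_zero c0 c1 c2 t0 :
  0 < t0 < 1 -> hat c0 c1 c2 t0 = 0 -> slope c1 c2 t0 = 0 ->
  c0 <> 0 \/ c1 <> 0 \/ c2 <> 0 ->
  exists sigma, forall t, 0 < t < 1 -> t <> t0 -> 0 < sigma * hat c0 c1 c2 t.
Proof.
intros Ht0 E1 E2 Hc.
assert (Hc2 : c2 <> 0).
{ intros E.
  assert (c1 = 0).
  { unfold slope in E2; rewrite E in E2.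
    assert (0 < INR (S p)) by (apply lt_0_INR; lia). nra. }
  unfold hat in E1; rewrite E, H in E1; lra. }
exists c2; intros t Ht Hn.
assert (Hs : - c2 * c2 < 0) by nra.
assert (M := fun u v => slope_anti c1 c2 (- c2) u v Hs).
destruct (Rlt_le_dec t t0) as [H|H].
- assert (G := hat_increasing c0 c1 c2 (- c2) t t0 ltac:(lra)).
  rewrite E1 in G; assert (- c2 * hat c0 c1 c2 t < - c2 * 0); [|lra].
  apply G; intros z Hz; specialize (M z t0 ltac:(lra)); rewrite E2 in M; lra.
- assert (G := hat_increasing c0 c1 c2 c2 t0 t ltac:(lra)).
  rewrite E1 in G; assert (c2 * 0 < c2 * hat c0 c1 c2 t); [|lra].
  apply G; intros z Hz; specialize (M t0 z ltac:(lra)); rewrite E2 in M; lra.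
Qed.

(** A unimodal function has one sign on an interval [(s1, s2)] and the opposite
    one on both sides of it; in the absence of double zeros the case of no sign
    change is [s1 = 0], [s2 = 1]. *)
Lemma hat_sign_interval c0 c1 c2 :
  c0 <> 0 \/ c1 <> 0 \/ c2 <> 0 ->
  (forall t, 0 < t < 1 -> hat c0 c1 c2 t = 0 -> slope c1 c2 t <> 0) ->
  exists sigma s1 s2, (sigma = 1 \/ sigma = - 1) /\ 0 <= s1 /\ s1 < s2 /\ s2 <= 1 /\
   (forall t, s1 < t < s2 -> 0 < sigma * hat c0 c1 c2 t) /\
   (forall t, 0 < t < s1 -> 0 < - sigma * hat c0 c1 c2 t) /\
   (forall t, s2 < t < 1 -> 0 < - sigma * hat c0 c1 c2 t) /\
   (0 < s1 -> hat c0 c1 c2 s1 = 0 /\ 0 <= sigma * slope c1 c2 s1) /\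
   (s2 < 1 -> hat c0 c1 c2 s2 = 0 /\ sigma * slope c1 c2 s2 <= 0).
Proof.
intros Hc Hd.
destruct (constant_or_not c1 c2) as [[E1 E2]|Hcc].
{ assert (E0 : forall t, hat c0 c1 c2 t = c0) by (intros t; unfold hat; rewrite E1, E2; ring).
  assert (X : exists sigma, (sigma = 1 \/ sigma = - 1) /\ 0 < sigma * c0).
  { destruct (Rlt_le_dec 0 c0); [exists 1|exists (- 1)]; split; auto; destruct Hc as [|[|]]; lra. }
  destruct X as [sigma [X1 X2]]; exists sigma, 0, 1.
  splits; intros; try rewrite E0; auto; lra. }
destruct (hat_unimodal c0 c1 c2 Hcc) as [sigma [tau [S1 [T [M1 [M2 [M3 M4]]]]]]].
set (h := hat c0 c1 c2) in *.
destruct (Rle_lt_dec (sigma * h tau) 0) as [Hm|Hm].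
{ exists (- sigma), 0, 1.
  split; [destruct S1; [right|left]; lra|]; splits; try lra; try (intros; lra).
  intros t Ht; destruct (Rtotal_order t tau) as [L|[L|L]];
    [specialize (M1 t tau); lra| |specialize (M2 tau t); lra].
  subst t; destruct (Req_dec (sigma * h tau) 0) as [Z|Z]; [exfalso|lra].
  apply (Hd tau Ht); [destruct S1 as [-> | ->]; unfold h in *; lra|].
  specialize (M3 tau); specialize (M4 tau); destruct S1 as [-> | ->]; lra. }
assert (Ch : continuity h) by apply hat_cont.
assert (L1 : exists s1, 0 <= s1 <= tau /\ (0 < tau -> s1 < tau) /\ 0 <= sigma * h s1 /\
  (0 < s1 -> h s1 = 0)).
{ destruct (Rle_lt_dec 0 (sigma * h 0)) as [H0|H0]; [exists 0; splits; lra|].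
  destruct (IVT_cor h 0 tau Ch) as [s1 [X1 X2]]; [lra| |].
  { destruct S1 as [-> | ->]; nra. }
  exists s1; rewrite X2; splits; try lra.
  intros _; destruct (Req_dec s1 tau) as [E|]; [rewrite <- E, X2 in Hm|]; lra. }
assert (L2 : exists s2, tau <= s2 <= 1 /\ (tau < 1 -> tau < s2) /\ 0 <= sigma * h s2 /\
  (s2 < 1 -> h s2 = 0)).
{ destruct (Rle_lt_dec 0 (sigma * h 1)) as [H0|H0]; [exists 1; splits; lra|].
  destruct (IVT_cor h tau 1 Ch) as [s2 [Y1 Y2]]; [lra| |].
  { destruct S1 as [-> | ->]; nra. }
  exists s2; rewrite Y2; splits; try lra.
  intros _; destruct (Req_dec s2 tau) as [E|]; [rewrite <- E, Y2 in Hm|]; lra. }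
destruct L1 as [s1 [Xa [Xb [Xc Xd]]]]; destruct L2 as [s2 [Ya [Yb [Yc Yd]]]].
exists sigma, s1, s2; split; [exact S1|]; splits; try lra.
- intros t Ht; destruct (Rtotal_order t tau) as [L|[L|L]];
  [specialize (M1 s1 t)|subst t|specialize (M2 t s2)]; lra.
- intros t Ht; specialize (M1 t s1); rewrite Xd in M1 by lra; lra.
- intros t Ht; specialize (M2 s2 t); rewrite Yd in M2 by lra; lra.
- intros Hs; split; [now apply Xd|apply M3; lra].
- intros Hs; split; [now apply Yd|apply M4; lra].
Qed.
End Hat.

(** * Three nonzero closed solutions force proportional coefficients *)

(** As x is constant outside [0,1] and x(0) = x(1), this sum is the function
    equal to x(t) for t <= 1 and to x(t - 1) for t >= 1; written in this way its
    continuity needs no case distinction. *)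
Definition ext (x : R -> R) (t : R) : R := x t + x (t - 1) - x 0.
Definition ext_coef (A : R -> R) (t : R) : R := if Rle_dec t 1 then A t else A (t - 1).

Lemma ext_left (A B x : R -> R) t : periodic_solution A B x -> t <= 1 -> ext x t = x t.
Proof.
intros Hx Ht; unfold ext.
rewrite (periodic_clamp _ _ _ Hx (t - 1)), clamp_low by lra; lra.
Qed.

Lemma ext_right (A B x : R -> R) t : periodic_solution A B x -> 1 <= t -> ext x t = x (t - 1).
Proof.
intros Hx Ht; unfold ext.
rewrite (periodic_clamp _ _ _ Hx t), clamp_high, <- (periodic_closed _ _ _ Hx) by lra; lra.
Qed.

Lemma ext_cont (A B x : R -> R) : periodic_solution A B x -> continuity (ext x).
Proof.
intros Hx t; unfold ext.
apply (continuity_pt_minus (fun t => x t + x (t - 1)) (fun _ => x 0)).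
- apply (continuity_pt_plus x (fun t => x (t - 1))); [apply Hx|].
  apply (continuity_pt_comp (fun t => t - 1) x); [|apply Hx].
  eapply derivable_continuity_pt; auto_derive; auto; ring.
- apply continuity_pt_const; intros ? ?; reflexivity.
Qed.

Lemma ext_inv_derive (A B x : R -> R) t :
  periodic_solution A B x -> (forall t, x t <> 0) -> 0 < t < 2 -> t <> 1 ->
  is_derive (fun t => / ext x t) t (- ext_coef A t / / ext x t - ext_coef B t).
Proof.
intros Hx Hn Ht H1.
assert (Ne : forall t, ext x t <> 0).
{ intros u; destruct (Rle_lt_dec u 1); [rewrite (ext_left A B)|rewrite (ext_right A B)]; auto; lra. }
evar_last.
- apply is_derive_inv; [|apply Ne].
  instantiate (1 := ext_coef A t * ext x t ^ 3 + ext_coef B t * ext x t ^ 2).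
  unfold ext_coef; destruct (Rle_dec t 1) as [L|L].
  + apply (is_derive_ext_loc x).
    * apply locally_near with (eps := 1 - t); [lra|]; intros z Hz.
      symmetry; apply (ext_left A B); [assumption|lra].
    * rewrite (ext_left A B x t Hx) by lra. apply Hx; lra.
  + apply (is_derive_ext_loc (fun z => x (z - 1))).
    * apply locally_near with (eps := t - 1); [lra|]; intros z Hz.
      symmetry; apply (ext_right A B); [assumption|lra].
    * rewrite (ext_right A B x t Hx) by lra.
      evar_last; [apply (is_derive_comp x (fun z => z - 1))|].
      -- apply Hx; lra.
      -- instantiate (1 := 1); auto_derive; auto; ring.
      -- unfold scal; simpl; unfold mult; simpl; ring.
- field; apply Ne.
Qed.

Lemma trinomial_hat m0 p q c0 c1 c2 t :
  trinomial m0 (m0 + S p) (m0 + (S p + S q)) c0 c1 c2 t = t ^ m0 * hat p q c0 c1 c2 t.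
Proof. unfold trinomial, hat; rewrite !pow_add; ring. Qed.

Lemma trinomial_cont m0 m1 m2 c0 c1 c2 : continuity (trinomial m0 m1 m2 c0 c1 c2).
Proof.
assert (H : forall c m, continuity (fun t => c * t ^ m)).
{ intros c m t; eapply derivable_continuity_pt; auto_derive; auto; ring. }
intros t; unfold trinomial.
apply (continuity_pt_plus (fun t => c0 * t ^ m0 + c1 * t ^ m1) (fun t => c2 * t ^ m2)); [|apply H].
apply (continuity_pt_plus (fun t => c0 * t ^ m0) (fun t => c1 * t ^ m1)); apply H.
Qed.

(** A B' - A' B up to a positive power of t: the common factor t^m0 of A and B
    contributes nothing but its square. *)
Definition wronskian p q a0 a1 a2 b0 b1 b2 t : R :=
  hat p q a0 a1 a2 t * slope p q b1 b2 t - slope p q a1 a2 t * hat p q b0 b1 b2 t.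
Section Pair.
Variables (m0 p q : nat) (a0 a1 a2 b0 b1 b2 : R).
Let m1 := (m0 + S p)%nat.
Let m2 := (m0 + (S p + S q))%nat.
Let A := trinomial m0 m1 m2 a0 a1 a2.
Let B := trinomial m0 m1 m2 b0 b1 b2.
Let HA : continuity A := trinomial_cont m0 m1 m2 a0 a1 a2.
Let HB : continuity B := trinomial_cont m0 m1 m2 b0 b1 b2.
Let hA := hat p q a0 a1 a2.
Let hB := hat p q b0 b1 b2.
Let W := wronskian p q a0 a1 a2 b0 b1 b2.
Variable omega : R.
Hypothesis Homega : omega = 1 \/ omega = - 1.
Hypothesis HW : forall t, 0 < t < 1 -> 0 < omega * W t.

(** The derivative of - B/A is - W/A^2. *)
Lemma nullcline_anti u v : 0 < u -> u < v -> v < 1 ->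
  (forall t, u <= t <= v -> hA t <> 0) ->
  omega * (- B v / A v) < omega * (- B u / A u).
Proof.
intros Hu Huv Hv Hn.
assert (E : forall t, 0 < t -> hA t <> 0 -> - B t / A t = - (hB t / hA t)).
{ intros t Ht Hh; unfold A, B, m1, m2; rewrite !trinomial_hat.
  assert (0 < t ^ m0) by (apply pow_lt; assumption).
  unfold hA, hB in Hh |- *; field; split; [assumption|lra]. }
rewrite !E by (try lra; apply Hn; lra).
assert (H : omega * (hB u / hA u) < omega * (hB v / hA v)); [|lra].
apply (increasing_of_derive_pos (fun t => omega * (hB t / hA t)) u v); [|lra|].
- intros t Ht; apply (continuity_pt_scal (fun t => hB t / hA t)).
  apply continuity_pt_div; [apply hat_cont|apply hat_cont|now apply Hn].
- intros t Ht; assert (hA t <> 0) by (apply Hn; lra).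
  exists (t ^ p * (omega * W t) / hA t ^ 2); split.
  + evar_last.
    * apply is_derive_scal, is_derive_div; [apply hat_derive|apply hat_derive|assumption].
    * unfold W, wronskian, hA, hB in H |- *; field; assumption.
  + apply Rdiv_lt_0_compat; [|assert (H0 := pow2_gt_0 _ H); exact H0].
    apply Rmult_lt_0_compat; [apply pow_lt; lra|apply HW; lra].
Qed.

(** Here the circle is cut at [s1], so that the first arc is [(s1, s2)] and the
    second one, [(s2, 1 + s1)], contains the gluing point 1. *)
Lemma no_three_positive xa xb xc :
  periodic_solution A B xa -> periodic_solution A B xb -> periodic_solution A B xc ->
  0 < xc 0 -> xc 0 < xb 0 -> xa 0 <> 0 -> xa 0 <> xb 0 -> xa 0 <> xc 0 -> False.
Proof.
intros Pa Pb Pc c0 bc na nab nac.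
assert (Ha : a0 <> 0 \/ a1 <> 0 \/ a2 <> 0).
{ destruct (Req_dec a0 0) as [E0|]; [|tauto].
  destruct (constant_or_not a1 a2) as [[E1 E2]|]; [|tauto].
  assert (H := HW (1/2) ltac:(lra)).
  unfold W, wronskian, hat, slope in H; rewrite E0, E1, E2 in H; lra. }
destruct (hat_sign_interval p q a0 a1 a2 Ha) as
  [sigma [s1 [s2 [Hs [H1 [H12 [H2 [I1 [I2 [I3 [I4 I5]]]]]]]]]]].
{ intros t Ht E0 E1; assert (H := HW t Ht).
  unfold W, wronskian in H; rewrite E0, E1 in H; lra. }
assert (SA : forall t k, 0 < t -> 0 < k * hA t -> 0 < k * A t).
{ intros t k Ht Hh; unfold A, m1, m2; rewrite trinomial_hat.
  replace (k * (t ^ m0 * hat p q a0 a1 a2 t)) with (t ^ m0 * (k * hA t)) by (unfold hA; ring).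
  apply Rmult_lt_0_compat; [now apply pow_lt|assumption]. }
(* s2 = 1 and s1 = 0: there is no second arc, but A keeps its sign *)
destruct (Rlt_le_dec s2 (1 + s1)) as [Hlt|Hge].
2:{ apply (one_signed_cubic A B xb xc sigma 0); auto; try lra.
    intros t Ht _; apply SA; [lra|apply I1; lra]. }
(* where A vanishes, W = - A' B, and the sign of A' is known *)
assert (sigma_sq : sigma * sigma = 1) by (destruct Hs as [-> | ->]; ring).
assert (B1 : 0 < s1 -> omega * sigma * hB s1 < 0).
{ intros Hp; destruct (I4 Hp) as [E1 E2]; assert (H := HW s1 ltac:(lra)).
  unfold W, wronskian in H; rewrite E1 in H; fold (hB s1) in H.
  revert H E2; generalize (slope p q a1 a2 s1) (hB s1); intros x y H E2.
  assert (X : (omega * sigma * y) * (sigma * x) < 0).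
  { replace (omega * sigma * y * (sigma * x)) with (sigma * sigma * (omega * (x * y))) by ring.
    rewrite sigma_sq; lra. }
  apply Rnot_le_lt; intros N; clear - X E2 N; nra. }
assert (B2 : s2 < 1 -> 0 < omega * sigma * hB s2).
{ intros Hp; destruct (I5 Hp) as [E1 E2]; assert (H := HW s2 ltac:(lra)).
  unfold W, wronskian in H; rewrite E1 in H; fold (hB s2) in H.
  revert H E2; generalize (slope p q a1 a2 s2) (hB s2); intros x y H E2.
  assert (X : (omega * sigma * y) * (sigma * x) < 0).
  { replace (omega * sigma * y * (sigma * x)) with (sigma * sigma * (omega * (x * y))) by ring.
    rewrite sigma_sq; lra. }
  apply Rnot_le_lt; intros N; clear - X E2 N; nra. }
set (n := fun t => - B t / A t).
assert (NZ : forall k t, 0 < k * hA t -> hA t <> 0) by (intros k t Hk E; rewrite E in Hk; lra).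
(* monotonicity of n across the gluing point: otherwise, for some k, the
   combination k A + B alternates in sign at t' < s1 < s2 < t *)
assert (J : forall t t', s2 < t < 1 -> 0 < t' < s1 -> omega * n t' <= omega * n t).
{ intros t t' Ht Ht'.
  destruct (Rle_lt_dec (omega * n t') (omega * n t)) as [|Hlt']; [assumption|exfalso].
  assert (X : exists k, omega * n t < omega * k < omega * n t').
  { exists ((n t + n t') / 2); destruct Homega as [-> | ->]; lra. }
  destruct X as [k Hk].
  assert (EC : forall z, k * hA z + hB z = hat p q (k * a0 + b0) (k * a1 + b1) (k * a2 + b2) z)
    by (intros z; unfold hA, hB, hat; ring).
  assert (EN : forall z, 0 < z -> hA z <> 0 -> k * hA z + hB z = hA z * (k - n z)).
  { intros z Hz Hh; unfold n, A, B, m1, m2; rewrite !trinomial_hat.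
    assert (0 < z ^ m0) by (apply pow_lt; assumption).
    unfold hA, hB in Hh |- *; field; split; [assumption|lra]. }
  assert (At := I3 t Ht); assert (At' := I2 t' Ht').
  apply (hat_no_alternation p q (k * a0 + b0) (k * a1 + b1) (k * a2 + b2) (omega * sigma) t' s1 s2 t);
    try lra; rewrite <- EC.
  - rewrite EN; [|lra|now apply (NZ (- sigma))]. fold (hA t') in At'.
    replace (omega * sigma * (hA t' * (k - n t'))) with
      ((- sigma * hA t') * (omega * n t' - omega * k)) by ring.
    apply Rmult_lt_0_compat; lra.
  - destruct (I4 ltac:(lra)) as [E _]; fold (hA s1) in E; rewrite E.
    assert (Q := B1 ltac:(lra)); lra.
  - destruct (I5 ltac:(lra)) as [E _]; fold (hA s2) in E; rewrite E.
    assert (Q := B2 ltac:(lra)); lra.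
  - rewrite EN; [|lra|now apply (NZ (- sigma))]. fold (hA t) in At.
    replace (omega * sigma * (hA t * (k - n t))) with
      (- ((- sigma * hA t) * (omega * k - omega * n t))) by ring.
    assert (0 < (- sigma * hA t) * (omega * k - omega * n t)); [|lra].
    apply Rmult_lt_0_compat; lra. }
assert (Na := periodic_nonzero A B xa HA HB Pa na).
assert (Sb := periodic_sign A B xb HA HB Pb ltac:(lra) 0).
assert (Sc := periodic_sign A B xc HA HB Pc ltac:(lra) 0).
assert (Sbc := periodic_gap_sign A B xb xc HA HB Pb Pc ltac:(lra) 0).
assert (Pos : forall t, 0 < xc t /\ xc t < xb t).
{ intros t; specialize (Sc t); specialize (Sbc t); clear - Sc Sbc c0 bc; split; nra. }
assert (Nab := periodic_neq A B xa xb HA HB Pa Pb nab).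
assert (Nac := periodic_neq A B xa xc HA HB Pa Pc nac).
assert (XS : forall t, exists u, ext xa t = xa u /\ ext xb t = xb u /\ ext xc t = xc u).
{ intros t; destruct (Rle_dec t 1).
  - exists t; splits; apply (ext_left A B); auto.
  - exists (t - 1); splits; apply (ext_right A B); auto; lra. }
assert (Hpos : forall t, 0 < ext xc t /\ ext xc t < ext xb t).
{ intros t; destruct (XS t) as [u [_ [-> ->]]]; apply Pos. }
assert (Ena : forall t, ext xa t <> 0 /\ ext xa t <> ext xb t /\ ext xa t <> ext xc t).
{ intros t; destruct (XS t) as [u [-> [-> ->]]].
  specialize (Nab u); specialize (Nac u); splits; auto; lra. }
assert (CI : forall x, periodic_solution A B x -> (forall t, ext x t <> 0) -> continuity (fun t => / ext x t)).
{ intros x Px Nx t; apply continuity_pt_inv; [now apply (ext_cont A B)|apply Nx]. }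
assert (EI : forall x, periodic_solution A B x -> / ext x s1 = / ext x (1 + s1)).
{ intros x Px; rewrite (ext_left A B), (ext_right A B) by (try assumption; lra).
  now replace (1 + s1 - 1) with s1 by ring. }
assert (INVN : forall u v, u <> 0 -> v <> 0 -> u <> v -> / u - / v <> 0).
{ clear; intros u v Hu Hv Huv E; apply Huv; rewrite <- (Rinv_inv u), <- (Rinv_inv v); f_equal; lra. }
clear B1 B2 I4 I5 Sb Sc Sbc XS Nab Nac.
apply (no_three_around_loop s1 s2 (1 + s1) 1 sigma omega (ext_coef A) (ext_coef B)
  (fun t => / ext xa t) (fun t => / ext xb t) (fun t => / ext xc t)); auto; try lra.
- apply CI; [assumption|]; intros t; apply Ena.
- apply CI; [assumption|]; intros t; specialize (Hpos t); lra.
- apply CI; [assumption|]; intros t; specialize (Hpos t); lra.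
- intros t Ht _ Ht1; apply ext_inv_derive; auto; lra.
- intros t Ht _ Ht1; apply ext_inv_derive; auto; try lra. intros u; specialize (Pos u); lra.
- intros t Ht _ Ht1; apply ext_inv_derive; auto; try lra. intros u; specialize (Pos u); lra.
- intros t _; apply Rinv_0_lt_compat; specialize (Hpos t); lra.
- intros t _; specialize (Hpos t); apply Rinv_lt_contravar; [|lra].
  apply Rmult_lt_0_compat; lra.
- intros t _; apply Rinv_neq_0_compat, Ena.
- intros t _; destruct (Ena t) as [? [? ?]]; specialize (Hpos t); apply INVN; auto; lra.
- intros t _; destruct (Ena t) as [? [? ?]]; specialize (Hpos t); apply INVN; auto; lra.
- intros t Ht _; unfold ext_coef; destruct (Rle_dec t 1); [|lra].
  apply SA; [lra|now apply I1].
- intros t Ht Ht1; unfold ext_coef; destruct (Rle_dec t 1).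
  + apply SA; [lra|apply I3; lra].
  + apply SA; [lra|apply I2; lra].
- intros t t' Ht Htt Ht' _ _; unfold ext_coef.
  destruct (Rle_dec t 1); [|lra]; destruct (Rle_dec t' 1); [|lra].
  apply nullcline_anti; try lra; intros z Hz; apply (NZ sigma), I1; lra.
- intros t t' Ht Htt Ht' Ht1 Ht1'; unfold ext_coef.
  destruct (Rle_dec t 1) as [L|L]; destruct (Rle_dec t' 1) as [L'|L']; try lra.
  + apply Rlt_le, nullcline_anti; try lra; intros z Hz; apply (NZ (- sigma)), I3; lra.
  + apply J; lra.
  + apply Rlt_le, nullcline_anti; try lra; intros z Hz; apply (NZ (- sigma)), I2; lra.
Qed.
End Pair.

Section Three.
Variables (m0 p q : nat) (a0 a1 a2 b0 b1 b2 : R).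
Let m1 := (m0 + S p)%nat.
Let m2 := (m0 + (S p + S q))%nat.
Let A := trinomial m0 m1 m2 a0 a1 a2.
Let B := trinomial m0 m1 m2 b0 b1 b2.

Lemma wronskian_cont : continuity (wronskian p q a0 a1 a2 b0 b1 b2).
Proof.
intros t; apply (continuity_pt_minus
  (fun t => hat p q a0 a1 a2 t * slope p q b1 b2 t) (fun t => slope p q a1 a2 t * hat p q b0 b1 b2 t));
apply continuity_pt_mult; try apply hat_cont; apply slope_cont.
Qed.

Lemma trinomial_opp c0 c1 c2 t :
  trinomial m0 m1 m2 (- c0) (- c1) (- c2) t = - trinomial m0 m1 m2 c0 c1 c2 t.
Proof. unfold trinomial; ring. Qed.

Lemma periodic_flip x : periodic_solution A B x ->
  periodic_solution A (trinomial m0 m1 m2 (- b0) (- b1) (- b2)) (fun t => - x t).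
Proof.
intros Hx; destruct (periodic_opp A B x Hx) as [C D E F]; constructor; auto.
intros t Ht; rewrite trinomial_opp; now apply D.
Qed.

(** The reflection x -> - x replaces B by - B and exchanges positive and negative
    solutions. *)
Lemma no_three_same_sign omega xa xb xc :
  omega = 1 \/ omega = - 1 ->
  (forall t, 0 < t < 1 -> 0 < omega * wronskian p q a0 a1 a2 b0 b1 b2 t) ->
  periodic_solution A B xa -> periodic_solution A B xb -> periodic_solution A B xc ->
  0 < xb 0 * xc 0 -> xc 0 <> xb 0 -> xa 0 <> 0 -> xa 0 <> xb 0 -> xa 0 <> xc 0 -> False.
Proof.
intros Ho HW Pa Pb Pc Hbc bc na nab nac.
assert (Hflip : forall t, 0 < t < 1 ->
  0 < - omega * wronskian p q a0 a1 a2 (- b0) (- b1) (- b2) t).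
{ intros t Ht; replace (- omega * wronskian p q a0 a1 a2 (- b0) (- b1) (- b2) t)
    with (omega * wronskian p q a0 a1 a2 b0 b1 b2 t) by (unfold wronskian, hat, slope; ring).
  now apply HW. }
assert (Ho' : - omega = 1 \/ - omega = - 1) by (destruct Ho; [right|left]; lra).
destruct (Rlt_le_dec 0 (xc 0)) as [H|H].
- assert (0 < xb 0) by (clear - Hbc H; nra).
  destruct (Rlt_le_dec (xc 0) (xb 0)).
  + apply (no_three_positive m0 p q a0 a1 a2 b0 b1 b2 omega Ho HW xa xb xc); auto.
  + apply (no_three_positive m0 p q a0 a1 a2 b0 b1 b2 omega Ho HW xa xc xb); auto; lra.
- assert (xc 0 < 0) by (destruct H as [H|H]; [exact H|rewrite H in Hbc; lra]).
  assert (xb 0 < 0) by (clear - Hbc H; nra).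
  assert (Fa := periodic_flip xa Pa); assert (Fb := periodic_flip xb Pb);
  assert (Fc := periodic_flip xc Pc).
  destruct (Rlt_le_dec (xc 0) (xb 0)).
  + apply (no_three_positive m0 p q _ _ _ _ _ _ (- omega) Ho' Hflip _ _ _ Fa Fc Fb); lra.
  + apply (no_three_positive m0 p q _ _ _ _ _ _ (- omega) Ho' Hflip _ _ _ Fa Fb Fc); lra.
Qed.

(** If W(t) = 0, the values and the slopes of A and B at t are proportional, so
    some combination has a double zero at t.  Otherwise W keeps its sign, and two
    of the three solutions are on the same side of zero. *)
Lemma three_periodic_dependent x y z :
  periodic_solution A B x -> periodic_solution A B y -> periodic_solution A B z ->
  x 0 <> 0 -> y 0 <> 0 -> z 0 <> 0 -> x 0 <> y 0 -> y 0 <> z 0 -> x 0 <> z 0 ->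
  exists al be, (al <> 0 \/ be <> 0) /\
    al * a0 + be * b0 = 0 /\ al * a1 + be * b1 = 0 /\ al * a2 + be * b2 = 0.
Proof.
intros Px Py Pz x0 y0 z0 xy yz xz.
assert (CA := trinomial_cont m0 m1 m2 a0 a1 a2); fold A in CA.
assert (CB := trinomial_cont m0 m1 m2 b0 b1 b2); fold B in CB.
set (W := wronskian p q a0 a1 a2 b0 b1 b2).
destruct (Classical_Prop.classic (exists t, 0 < t < 1 /\ W t = 0)) as [[t [Ht E]]|Hn].
- assert (X : exists al be, (al <> 0 \/ be <> 0) /\
    al * hat p q a0 a1 a2 t + be * hat p q b0 b1 b2 t = 0 /\
    al * slope p q a1 a2 t + be * slope p q b1 b2 t = 0).
  { unfold W, wronskian in E; revert E.
    generalize (hat p q a0 a1 a2 t) (hat p q b0 b1 b2 t) (slope p q a1 a2 t) (slope p q b1 b2 t).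
    intros ha hb sa sb E.
    destruct (constant_or_not ha hb) as [[-> ->]|H1].
    - destruct (constant_or_not sa sb) as [[-> ->]|H2].
      + exists 1, 0; splits; lra.
      + exists sb, (- sa); splits; lra.
    - exists hb, (- ha); splits; lra. }
  destruct X as [al [be [Hab [E1 E2]]]].
  set (d0 := al * a0 + be * b0); set (d1 := al * a1 + be * b1); set (d2 := al * a2 + be * b2).
  assert (Eh : forall s, hat p q d0 d1 d2 s = al * hat p q a0 a1 a2 s + be * hat p q b0 b1 b2 s)
    by (intros s; unfold hat, d0, d1, d2; ring).
  assert (Es : slope p q d1 d2 t = al * slope p q a1 a2 t + be * slope p q b1 b2 t)
    by (unfold slope, d1, d2; ring).
  destruct (Req_dec d0 0) as [D0|D0];
  [destruct (constant_or_not d1 d2) as [[D1 D2]|D]; [exists al, be; auto|]|].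
  all: exfalso.
  all: destruct (hat_double_zero p q d0 d1 d2 t Ht) as [sigma HS]; [rewrite Eh; lra|lra|tauto|].
  all: apply (one_signed_three A B x y z al be sigma t); auto.
  all: intros s Hs Hst; unfold A, B, m1, m2; rewrite !trinomial_hat.
  all: replace (sigma * (al * (s ^ m0 * hat p q a0 a1 a2 s) + be * (s ^ m0 * hat p q b0 b1 b2 s)))
    with (s ^ m0 * (sigma * hat p q d0 d1 d2 s)) by (rewrite Eh; ring).
  all: apply Rmult_lt_0_compat; [apply pow_lt; lra|now apply HS].
- exfalso.
  assert (NW : forall t, 0 < t < 1 -> W t <> 0) by (intros t Ht E; apply Hn; now exists t).
  assert (X : exists omega, (omega = 1 \/ omega = - 1) /\ forall t, 0 < t < 1 -> 0 < omega * W t).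
  { assert (S : forall t, 0 < t < 1 -> 0 < W (1/2) * W t).
    { intros t Ht; apply (same_sign W (Rmin (1/2) t) (Rmax (1/2) t)).
      - apply wronskian_cont.
      - intros u Hu; apply NW; revert Hu; unfold Rmin, Rmax; destruct (Rle_dec _ _); lra.
      - split; [apply Rmin_l|apply Rmax_l].
      - split; [apply Rmin_r|apply Rmax_r]. }
    assert (S2 := NW (1/2) ltac:(lra)).
    destruct (Rlt_le_dec 0 (W (1/2))); [exists 1|exists (- 1)]; split; auto;
    intros t Ht; specialize (S t Ht); clear - S S2 r; nra. }
  destruct X as [omega [Ho HW]].
  assert (D : 0 < x 0 * y 0 \/ 0 < y 0 * z 0 \/ 0 < x 0 * z 0).
  { clear - x0 y0 z0.
    assert (S : forall u, u <> 0 -> 0 < u \/ u < 0) by (intros; lra).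
    destruct (S _ x0); destruct (S _ y0); destruct (S _ z0);
    try (left; nra); try (right; left; nra); right; right; nra. }
  destruct D as [D|[D|D]].
  + apply (no_three_same_sign omega z x y); auto.
  + apply (no_three_same_sign omega x y z); auto.
  + apply (no_three_same_sign omega y x z); auto.
Qed.
End Three.

(** * Limit cycles: the proportional case and the count *)

Lemma nonzero_neighbourhood (g : R -> R) (m M : R) :
  continuity g -> m <= M -> (forall u, m <= u <= M -> g u <> 0) ->
  exists eta, 0 < eta /\ forall u, m - eta <= u <= M + eta -> g u <> 0.
Proof.
intros Hg HmM Hn.
assert (L : forall c, g c <> 0 -> exists eta, 0 < eta /\ forall u, c - eta <= u <= c + eta -> g u <> 0).
{ intros c Hc; destruct (Hg c (Rabs (g c))) as [alp [Ha Hal]]; [now apply Rabs_pos_lt|].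
  exists (alp / 2); split; [lra|]; intros u Hu E.
  destruct (Req_dec u c) as [->|Hne]; [contradiction|].
  assert (H : Rabs (g u - g c) < Rabs (g c)).
  { apply (Hal u); split; [split; [exact I|auto]|].
    simpl; unfold R_dist; apply Rabs_def1; lra. }
  rewrite E, Rminus_0_l, Rabs_Ropp in H; lra. }
destruct (L m) as [e1 [P1 Q1]]; [apply Hn; lra|].
destruct (L M) as [e2 [P2 Q2]]; [apply Hn; lra|].
assert (B1 := Rmin_l e1 e2); assert (B2 := Rmin_r e1 e2).
exists (Rmin e1 e2); split; [apply Rmin_pos; assumption|]; intros u Hu.
destruct (Rle_dec u m); [apply Q1; lra|].
destruct (Rle_dec M u); [apply Q2; lra|apply Hn; lra].
Qed.

(** If A and B are proportional to f, the equation reads x' = f(t) g(x) with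
    g(x) = x^2 (be x - al).  Let G be a primitive of a multiple of 1/g.  For a
    closed solution x that avoids the zeros of g and for any small del, the
    function y with G(y) = G(x) + del is again a solution, it is closed because x
    is, and it is close to x. *)
Lemma dependent_limit_cycle (A B x : R -> R) (al be : R) :
  continuity A -> continuity B -> (al <> 0 \/ be <> 0) ->
  (forall t, al * A t + be * B t = 0) ->
  limit_cycle A B x -> x 0 ^ 2 * (be * x 0 - al) = 0.
Proof.
intros HA HB Hab Hdep [Hx [eps [Heps Hiso]]].
set (g := fun u => u ^ 2 * (be * u - al)); fold (g (x 0)).
apply NNPP; intros Hg0.
assert (Hgc : continuity g).
{ intros u; eapply derivable_continuity_pt; unfold g; auto_derive; auto; ring. }
assert (Hden : al * al + be * be <> 0) by (destruct Hab; nra).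
set (f := fun t => (be * A t - al * B t) / (al * al + be * be)).
assert (Hrhs : forall t u, A t * u ^ 3 + B t * u ^ 2 = f t * g u).
{ intros t u; assert (H := Hdep t).
  assert (EA : A t = be * f t).
  { unfold f; apply (Rmult_eq_reg_r (al * al + be * be)); [|assumption].
    transitivity (be * (be * A t - al * B t)); [|field; assumption].
    replace (A t * (al * al + be * be))
      with (al * (al * A t + be * B t) - al * be * B t + be * be * A t) by ring.
    rewrite H; ring. }
  assert (EB : B t = - al * f t).
  { unfold f; apply (Rmult_eq_reg_r (al * al + be * be)); [|assumption].
    transitivity (- al * (be * A t - al * B t)); [|field; assumption].
    replace (B t * (al * al + be * be))
      with (be * (al * A t + be * B t) - al * be * A t + al * al * B t) by ring.
    rewrite H; ring. }
  rewrite EA, EB; unfold g; ring. }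
set (X := fun t => x (clamp t)).
assert (HX : periodic_solution A B X) by now apply closed_periodic.
assert (X0 : X 0 = x 0) by (unfold X; now rewrite clamp_low by lra).
assert (HgX : forall t, g (X t) <> 0).
{ intros t E; apply Hg0; rewrite <- X0.
  assert (P : periodic_solution A B (fun _ => X t)).
  { constructor; auto.
    - intros s; apply continuity_pt_const; intros ? ?; reflexivity.
    - intros s _; rewrite Hrhs, E; evar_last; [apply @is_derive_const|]; unfold zero; simpl; ring. }
  rewrite (periodic_unique A B X (fun _ => X t) (clamp t)); auto; [apply clamp_range|].
  symmetry; apply HX. }
assert (CX := periodic_cont _ _ _ HX).
destruct (continuity_ab_maj X 0 1) as [tM [HM1 HM2]]; [lra|intros; apply CX|].
destruct (continuity_ab_min X 0 1) as [tm [Hm1 Hm2]]; [lra|intros; apply CX|].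
set (M := X tM) in *; set (m := X tm) in *.
assert (HmM : m <= M) by (apply Hm1; assumption).
assert (HXr : forall t, m <= X t <= M).
{ intros t; rewrite (periodic_clamp _ _ _ HX); split; [apply Hm1|apply HM1]; apply clamp_range. }
(* [m, M] is the range of x; the room eta is where y lives *)
destruct (nonzero_neighbourhood g m M Hgc HmM) as [eta [Heta Hg]].
{ intros u Hu; destruct (IVT_gen X tm tM u CX) as [t [_ <-]]; [|apply HgX].
  fold m M; rewrite Rmin_left, Rmax_right; lra. }
set (u0 := m - eta) in *; set (w0 := M + eta) in *.
assert (Huw : u0 < w0) by (unfold u0, w0; lra).
set (s := g m).
assert (Hs : forall u, u0 <= u <= w0 -> 0 < s * g u).
{ intros u Hu; apply (same_sign g u0 w0); auto; unfold u0, w0; lra. }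
set (pr := fun u => Rmax u0 (Rmin w0 u)).
assert (Hpr : forall u, u0 <= pr u <= w0).
{ intros u; unfold pr, Rmax, Rmin; repeat destruct (Rle_dec _ _); lra. }
assert (Hpr_id : forall u, u0 <= u <= w0 -> pr u = u).
{ intros u Hu; unfold pr, Rmax, Rmin; repeat destruct (Rle_dec _ _); lra. }
assert (Hprc : continuity pr).
{ intros u e He; exists e; split; [exact He|]; intros z [_ Hz]; simpl in *; unfold R_dist in *.
  apply Rle_lt_trans with (2 := Hz).
  unfold pr, Rmax, Rmin, Rabs; repeat destruct (Rle_dec _ _); repeat destruct (Rcase_abs _); lra. }
assert (Hs0 : s <> 0) by (intros E; specialize (Hs u0 ltac:(lra)); rewrite E in Hs; lra).
set (phi := fun u => s / g (pr u)).
assert (Hphi_pos : forall u, 0 < phi u).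
{ intros u; specialize (Hs (pr u) (Hpr u)); specialize (Hg (pr u) (Hpr u)); unfold phi.
  replace (s / g (pr u)) with ((s * g (pr u)) / (g (pr u)) ^ 2) by (field; assumption).
  apply Rdiv_lt_0_compat; [assumption|]. now apply pow2_gt_0. }
assert (Hphic : continuity phi).
{ intros u; apply (continuity_pt_div (fun _ => s) (fun u => g (pr u))).
  - apply continuity_pt_const; intros ? ?; reflexivity.
  - apply (continuity_pt_comp pr g); [apply Hprc|apply Hgc].
  - apply Hg, Hpr. }
set (G := fun u => RInt phi m u).
assert (DG : forall u, is_derive G u (phi u)) by now apply is_derive_primitive.
assert (CG : continuity G) by (intros u; eapply derivable_continuity_pt, DG).
assert (HGinc : forall u v, u < v -> G u < G v).
{ intros u v Huv; apply increasing_of_derive_pos; auto.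
  intros z _; exists (phi z); auto. }
destruct (increasing_inverse G u0 w0 CG) as [T [CT [T1 [T2 T3]]]]; [lra|auto|].
destruct (bounded_on g u0 w0 Hgc) as [K HK].
assert (HK0 : 0 <= K) by (apply Rle_trans with (2 := HK u0 ltac:(lra)), Rabs_pos).
set (c0 := Rabs s / (K + 1)).
assert (Hc0 : 0 < c0) by (apply Rdiv_lt_0_compat; [now apply Rabs_pos_lt|lra]).
assert (Hphi_low : forall u, c0 <= phi u).
{ intros u; rewrite <- (Rabs_pos_eq (phi u)) by (apply Rlt_le; auto).
  unfold phi, c0; rewrite Rabs_div by (apply Hg, Hpr).
  apply Rmult_le_compat_l; [apply Rabs_pos|].
  apply Rinv_le_contravar; [apply Rabs_pos_lt, Hg, Hpr|].
  specialize (HK (pr u) (Hpr u)); lra. }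
assert (GM : G M < G w0) by (apply HGinc; unfold w0; lra).
set (del := Rmin ((G w0 - G M) / 2) (c0 * eps / 2)).
assert (Hce : 0 < c0 * eps) by (apply Rmult_lt_0_compat; lra).
assert (Hdel : 0 < del) by (apply Rmin_pos; lra).
assert (Hdel1 : del <= (G w0 - G M) / 2) by apply Rmin_l.
assert (Hdel2 : del <= c0 * eps / 2) by apply Rmin_r.
assert (HGX : forall t, G u0 < G (X t) /\ G (X t) + del < G w0).
{ intros t; specialize (HXr t); split; [apply HGinc; unfold u0; lra|].
  assert (G (X t) <= G M); [|lra].
  destruct (Req_dec (X t) M) as [->|]; [lra|apply Rlt_le, HGinc; lra]. }
set (y := fun t => T (G (X t) + del)).
assert (Hy : forall t, u0 <= y t <= w0 /\ G (y t) = G (X t) + del).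
{ intros t; apply T2; specialize (HGX t); lra. }
assert (Cy : closed_solution A B y).
{ apply closed_of_interior; auto.
  - intros t; apply (continuity_pt_comp (fun t => G (X t) + del) T); [|apply CT].
    apply (continuity_pt_plus (fun t => G (X t)) (fun _ => del)).
    + apply (continuity_pt_comp X G); auto.
    + apply continuity_pt_const; intros ? ?; reflexivity.
  - intros t Ht; rewrite Hrhs; destruct (Hy t) as [Y1 Y2].
    assert (DT : is_derive T (G (X t) + del) (/ phi (y t))).
    { apply T3; [specialize (HGX t); lra|auto|apply DG]. }
    assert (DX := periodic_derive _ _ _ HX t Ht); rewrite Hrhs in DX.
    evar_last.
    + apply (is_derive_comp T (fun t => G (X t) + del)); [exact DT|].
      apply @is_derive_plus; [|apply @is_derive_const].
      apply (is_derive_comp G X); [apply DG|exact DX].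
    + unfold plus, zero, scal; simpl; unfold mult; simpl; unfold phi.
      rewrite !Hpr_id by (try assumption; specialize (HXr t); unfold u0, w0; lra).
      specialize (HgX t); specialize (Hg (y t) Y1); field; auto.
  - unfold y; now rewrite (periodic_closed _ _ _ HX). }
assert (Hclose : forall t, 0 <= t <= 1 -> Rabs (y t - x t) < eps).
{ intros t Ht; replace (x t) with (X t) by (unfold X; now rewrite clamp_id).
  destruct (Hy t) as [_ E].
  assert (L : X t < y t).
  { destruct (Rlt_le_dec (X t) (y t)) as [|H]; [assumption|exfalso].
    assert (G (y t) <= G (X t)); [|lra].
    destruct (Req_dec (y t) (X t)) as [->|]; [lra|apply Rlt_le, HGinc; lra]. }
  destruct (mean_value G (fun _ d => c0 <= d) (X t) (y t)) as [c [d [_ [H1 H2]]]]; auto.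
  { intros z _; exists (phi z); auto. }
  rewrite Rabs_pos_eq by lra.
  assert (c0 * (y t - X t) <= d * (y t - X t)) by (apply Rmult_le_compat_r; lra).
  apply Rmult_lt_reg_l with c0; lra. }
assert (E := Hiso y Cy Hclose 0 ltac:(unfold unit_interval; lra)).
destruct (Hy 0) as [_ E2]; rewrite E, <- X0 in E2; lra.
Qed.

Lemma closed_eq01 (A B x y : R -> R) :
  continuity A -> continuity B -> closed_solution A B x -> closed_solution A B y ->
  x 0 = y 0 -> eq01 x y.
Proof.
intros HA HB Hx Hy E t Ht; unfold unit_interval in Ht.
assert (H := periodic_unique A B _ _ 0 HA HB (closed_periodic A B x Hx) (closed_periodic A B y Hy)).
simpl in H; rewrite clamp_low in H by lra.
specialize (H ltac:(lra) E t); now rewrite clamp_id in H.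
Qed.

Lemma limit_cycle_proper (A B x y : R -> R) :
  eq01 x y -> limit_cycle A B x -> limit_cycle A B y.
Proof.
intros E [[Hs Hc] [eps [He Hi]]].
assert (U0 : unit_interval 0) by (unfold unit_interval; lra).
assert (U1 : unit_interval 1) by (unfold unit_interval; lra).
split; [split|].
- intros t Ht d Hd; destruct (Hs t Ht d Hd) as [alp [Ha Hal]].
  exists alp; split; [exact Ha|]; intros z [[Hz Hzt] Hzd].
  rewrite <- (E t Ht), <- (E z Hz); apply Hal; split; [split|]; assumption.
- rewrite <- (E 0 U0), <- (E 1 U1); exact Hc.
- exists eps; split; [exact He|]; intros z Hz Hclose t Ht.
  rewrite <- (E t Ht); apply Hi; auto.
  intros u Hu; rewrite (E u Hu); now apply Hclose.
Qed.

Lemma eq01_equiv : Equivalence eq01.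
Proof.
split.
- intros x t _; reflexivity.
- intros x y H t Ht; symmetry; auto.
- intros x y z H1 H2 t Ht; rewrite H1, H2; auto.
Qed.

(** A duplicate-free list of maximal length exhausts the property. *)
Lemma finite_enumeration (P : (R -> R) -> Prop) (N : nat) :
  (forall x y, eq01 x y -> P x -> P y) ->
  (forall l, NoDupA eq01 l -> (forall x, In x l -> P x) -> (length l <= N)%nat) ->
  exists l, NoDupA eq01 l /\ (length l <= N)%nat /\ forall x, P x <-> InA eq01 x l.
Proof.
intros Hprop; induction N as [|N IH]; intros HN.
- exists nil; split; [constructor|split; [auto|]]; intros x; split.
  + intros Hx; specialize (HN (x :: nil)).
    assert (length (x :: nil) <= 0)%nat; [|simpl in *; lia].
    apply HN; [constructor; [intros H; inversion H|constructor]|].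
    intros z [<-|[]]; assumption.
  + intros H; inversion H.
- destruct (classic (exists l, NoDupA eq01 l /\ (forall x, In x l -> P x) /\ length l = S N))
    as [[l [H1 [H2 H3]]]|Hno].
  + exists l; split; [exact H1|split; [lia|]]; intros x; split.
    * intros Hx; apply NNPP; intros Hn.
      assert (length (x :: l) <= S N)%nat; [|simpl in *; lia].
      apply HN; [constructor; assumption|]; intros z [<-|Hz]; auto.
    * intros Hx; apply InA_alt in Hx; destruct Hx as [z [E Hz]].
      apply Hprop with z; auto. now apply eq01_equiv.
  + destruct IH as [l [H1 [H2 H3]]].
    * intros l H1 H2; specialize (HN l H1 H2).
      destruct (Nat.eq_dec (length l) (S N)) as [E|E]; [|lia].
      exfalso; apply Hno; exists l; auto.
    * exists l; auto.
Qed.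

Lemma three_closed_dependent (m0 m1 m2 : nat) (a0 a1 a2 b0 b1 b2 : R) (x y z : R -> R) :
  (m0 < m1)%nat -> (m1 < m2)%nat ->
  let A := trinomial m0 m1 m2 a0 a1 a2 in
  let B := trinomial m0 m1 m2 b0 b1 b2 in
  closed_solution A B x -> closed_solution A B y -> closed_solution A B z ->
  x 0 <> 0 -> y 0 <> 0 -> z 0 <> 0 -> x 0 <> y 0 -> y 0 <> z 0 -> x 0 <> z 0 ->
  exists al be, (al <> 0 \/ be <> 0) /\
    al * a0 + be * b0 = 0 /\ al * a1 + be * b1 = 0 /\ al * a2 + be * b2 = 0.
Proof.
intros H01 H12 A B Hx Hy Hz.
assert (Ep : exists p q, m1 = (m0 + S p)%nat /\ m2 = (m0 + (S p + S q))%nat).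
{ exists (m1 - m0 - 1)%nat, (m2 - m1 - 1)%nat; lia. }
destruct Ep as [p [q [E1 E2]]]; unfold A, B in *; subst m1 m2.
assert (C : clamp 0 = 0) by (apply clamp_low; lra).
intros x0 y0 z0 xy yz xz.
apply (three_periodic_dependent m0 p q a0 a1 a2 b0 b1 b2
  (fun t => x (clamp t)) (fun t => y (clamp t)) (fun t => z (clamp t)));
  try (now apply closed_periodic); rewrite ?C; assumption.
Qed.

(** With proportional coefficients the only candidate besides zero is the
    constant al / be. *)
Lemma no_three_nonzero_limit_cycles (m0 m1 m2 : nat) (a0 a1 a2 b0 b1 b2 : R) (x y z : R -> R) :
  (m0 < m1)%nat -> (m1 < m2)%nat ->
  let A := trinomial m0 m1 m2 a0 a1 a2 in
  let B := trinomial m0 m1 m2 b0 b1 b2 in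
  limit_cycle A B x -> limit_cycle A B y -> limit_cycle A B z ->
  x 0 <> 0 -> y 0 <> 0 -> z 0 <> 0 -> x 0 <> y 0 -> y 0 <> z 0 -> x 0 <> z 0 -> False.
Proof.
intros H01 H12 A B Lx Ly Lz x0 y0 z0 xy yz xz.
destruct (three_closed_dependent m0 m1 m2 a0 a1 a2 b0 b1 b2 x y z H01 H12
  (proj1 Lx) (proj1 Ly) (proj1 Lz) x0 y0 z0 xy yz xz) as [al [be [Hab [E0 [E1 E2]]]]].
assert (Hdep : forall t, al * A t + be * B t = 0).
{ intros t; unfold A, B, trinomial.
  transitivity ((al * a0 + be * b0) * t ^ m0 + (al * a1 + be * b1) * t ^ m1
    + (al * a2 + be * b2) * t ^ m2); [ring|rewrite E0, E1, E2; ring]. }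
assert (K : forall u, limit_cycle A B u -> u 0 <> 0 -> be * u 0 = al).
{ intros u Lu u0.
  assert (E := dependent_limit_cycle A B u al be (trinomial_cont _ _ _ _ _ _)
    (trinomial_cont _ _ _ _ _ _) Hab Hdep Lu).
  apply Rmult_integral in E; destruct E as [E|E]; [|lra].
  exfalso; apply u0; simpl in E; rewrite Rmult_1_r in E; apply Rmult_integral in E; tauto. }
assert (Kx := K x Lx x0); assert (Ky := K y Ly y0).
assert (E : be * (x 0 - y 0) = 0) by lra.
apply Rmult_integral in E; destruct E as [E|E]; [|lra].
rewrite E in Kx; lra.
Qed.

Lemma limit_cycles_at_most_three (m0 m1 m2 : nat) (a0 a1 a2 b0 b1 b2 : R) (l : list (R -> R)) :
  (m0 < m1)%nat -> (m1 < m2)%nat ->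
  let A := trinomial m0 m1 m2 a0 a1 a2 in
  let B := trinomial m0 m1 m2 b0 b1 b2 in
  NoDupA eq01 l -> (forall x, In x l -> limit_cycle A B x) -> (length l <= 3)%nat.
Proof.
intros H01 H12 A B Hl HP.
destruct l as [|x [|y [|z [|w l]]]]; try (simpl; lia); exfalso.
assert (Hd : forall u v, In u (x :: y :: z :: w :: l) -> In v (x :: y :: z :: w :: l) ->
  ~ eq01 u v -> u 0 <> v 0).
{ intros u v Hu Hv Hn E; apply Hn, (closed_eq01 A B); auto;
  try apply trinomial_cont; [apply HP, Hu|apply HP, Hv]. }
assert (Hn : forall u v k, ~ InA eq01 u k -> In v k -> ~ eq01 u v).
{ intros u v k H Hv E; apply H, InA_alt; now exists v. }
inversion_clear Hl as [|? ? N1 Hl1]; inversion_clear Hl1 as [|? ? N2 Hl2];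
inversion_clear Hl2 as [|? ? N3 _].
assert (xy : x 0 <> y 0) by (apply Hd; simpl; auto; apply (Hn _ _ _ N1); simpl; auto).
assert (xz : x 0 <> z 0) by (apply Hd; simpl; auto; apply (Hn _ _ _ N1); simpl; auto).
assert (xw : x 0 <> w 0) by (apply Hd; simpl; auto; apply (Hn _ _ _ N1); simpl; auto).
assert (yz : y 0 <> z 0) by (apply Hd; simpl; auto; apply (Hn _ _ _ N2); simpl; auto).
assert (yw : y 0 <> w 0) by (apply Hd; simpl; auto; apply (Hn _ _ _ N2); simpl; auto).
assert (zw : z 0 <> w 0) by (apply Hd; simpl; auto 6; apply (Hn _ _ _ N3); simpl; auto).
assert (Lx : limit_cycle A B x) by (apply HP; simpl; auto).
assert (Ly : limit_cycle A B y) by (apply HP; simpl; auto).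
assert (Lz : limit_cycle A B z) by (apply HP; simpl; auto).
assert (Lw : limit_cycle A B w) by (apply HP; simpl; auto 6).
assert (N := no_three_nonzero_limit_cycles m0 m1 m2 a0 a1 a2 b0 b1 b2).
destruct (Req_dec (x 0) 0); [apply (N y z w); auto; lra|].
destruct (Req_dec (y 0) 0); [apply (N x z w); auto; lra|].
destruct (Req_dec (z 0) 0); [apply (N x y w); auto; lra|].
apply (N x y z); auto.
Qed.

Lemma limit_cycles_enumeration (m0 m1 m2 : nat) (a0 a1 a2 b0 b1 b2 : R) :
  (m0 < m1)%nat -> (m1 < m2)%nat ->
  exists n : nat, (n <= 3)%nat /\
    has_exactly_limit_cycles
      (trinomial m0 m1 m2 a0 a1 a2) (trinomial m0 m1 m2 b0 b1 b2) n.
Proof.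
intros H01 H12.
destruct (finite_enumeration (limit_cycle (trinomial m0 m1 m2 a0 a1 a2)
  (trinomial m0 m1 m2 b0 b1 b2)) 3) as [l [H1 [H2 H3]]].
- intros x y; apply limit_cycle_proper.
- intros l; now apply limit_cycles_at_most_three.
- exists (length l); split; [exact H2|]; exists l; auto.
Qed.

(** Closed solutions with distinct initial values are at a positive distance, so
    finitely many of them are all isolated. *)
Lemma exactly_three (m0 m1 m2 : nat) (a0 a1 a2 b0 b1 b2 : R) (x y : R -> R) :
  (m0 < m1)%nat -> (m1 < m2)%nat ->
  let A := trinomial m0 m1 m2 a0 a1 a2 in
  let B := trinomial m0 m1 m2 b0 b1 b2 in
  (forall al be, al * a0 + be * b0 = 0 -> al * a1 + be * b1 = 0 -> al * a2 + be * b2 = 0 ->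
     al = 0 /\ be = 0) ->
  closed_solution A B x -> closed_solution A B y ->
  x 0 <> 0 -> y 0 <> 0 -> x 0 <> y 0 ->
  has_exactly_limit_cycles A B 3.
Proof.
intros H01 H12 A B Hind Hx Hy x0 y0 xy.
assert (CA : continuity A) by apply trinomial_cont.
assert (CB : continuity B) by apply trinomial_cont.
set (o := fun _ : R => 0).
assert (Ho : closed_solution A B o).
{ apply closed_of_interior; auto; apply (periodic_zero A B). }
assert (Only : forall z, closed_solution A B z -> z 0 = 0 \/ z 0 = x 0 \/ z 0 = y 0).
{ intros z Hz; apply NNPP; intros N.
  destruct (three_closed_dependent m0 m1 m2 a0 a1 a2 b0 b1 b2 x y z H01 H12 Hx Hy Hz)
    as [al [be [Hab [E0 [E1 E2]]]]]; auto.
  destruct (Hind al be E0 E1 E2); tauto. }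
set (d := Rmin (Rabs (x 0)) (Rmin (Rabs (y 0)) (Rabs (x 0 - y 0)))).
assert (Hd : 0 < d) by (repeat apply Rmin_pos; apply Rabs_pos_lt; lra).
assert (D1 : d <= Rabs (x 0)) by apply Rmin_l.
assert (D2 : d <= Rabs (y 0)) by (eapply Rle_trans; [apply Rmin_r|apply Rmin_l]).
assert (D3 : d <= Rabs (x 0 - y 0)) by (eapply Rle_trans; [apply Rmin_r|apply Rmin_r]).
assert (Iso : forall z, closed_solution A B z -> limit_cycle A B z).
{ intros z Hz; split; [exact Hz|]; exists d; split; [exact Hd|]; intros w Hw Hc.
  apply (closed_eq01 A B); auto.
  specialize (Hc 0 ltac:(unfold unit_interval; lra)).
  destruct (Only z Hz) as [Ez|[Ez|Ez]]; destruct (Only w Hw) as [Ew|[Ew|Ew]];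
  rewrite Ez, Ew in *; try reflexivity; exfalso; revert Hc D1 D2 D3;
  unfold Rabs; repeat destruct (Rcase_abs _); lra. }
assert (Ne : forall u v, u 0 <> v 0 -> ~ eq01 u v).
{ intros u v N E; apply N, E; unfold unit_interval; lra. }
exists (o :: x :: y :: nil); split; [|split; [reflexivity|]].
- constructor; [|constructor; [|constructor; [|constructor]]].
  + intros H; inversion_clear H as [? ? E|? ? H']; [|inversion_clear H' as [? ? E|? ? H'']].
    * revert E; apply Ne; unfold o; auto.
    * revert E; apply Ne; unfold o; auto.
    * inversion H''.
  + intros H; inversion_clear H as [? ? E|? ? H']; [|inversion H'].
    revert E; now apply Ne.
  + intros H; inversion H.
- intros z; split.
  + intros [Hz _]; destruct (Only z Hz) as [E|[E|E]].
    * apply InA_cons_hd, (closed_eq01 A B); auto.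
    * apply InA_cons_tl, InA_cons_hd, (closed_eq01 A B); auto.
    * apply InA_cons_tl, InA_cons_tl, InA_cons_hd, (closed_eq01 A B); auto.
  + intros H; apply InA_alt in H; destruct H as [w [E Hw]].
    apply limit_cycle_proper with w; [now apply eq01_equiv|].
    destruct Hw as [<-|[<-|[<-|[]]]]; apply Iso; assumption.
Qed.

(** * The Cauchy problem *)

(** The Lipschitz constant of the right-hand side is at most 1/2, so the integral
    operator contracts the uniform distance on [0,1] without a change of norm. *)
Section Picard.
Variables (a b h : R -> R) (L : R).
Hypotheses (Ca : continuity a) (Cb : continuity b).
Hypothesis HL : 0 <= L.
Hypothesis Hh : forall u v, Rabs (h u - h v) <= L * Rabs (u - v).
Hypothesis Hb : forall t, 0 <= t <= 1 -> Rabs (b t) * L <= 1 / 2.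

Lemma lipschitz_cont : continuity h.
Proof.
intros u e He; exists (e / (L + 1)).
assert (0 < L + 1) by lra.
split; [apply Rdiv_lt_0_compat; lra|]; intros z [_ Hz]; simpl in *; unfold R_dist in *.
apply Rle_lt_trans with (1 := Hh z u).
apply Rle_lt_trans with ((L + 1) * Rabs (z - u)).
- apply Rmult_le_compat_r; [apply Rabs_pos|lra].
- apply (Rmult_lt_compat_l (L + 1)) in Hz; [|assumption].
  replace ((L + 1) * (e / (L + 1))) with e in Hz by (field; lra); exact Hz.
Qed.

Let field_along (y : R -> R) (s : R) : R := a s + b s * h (y s).

Lemma field_along_cont y : continuity y -> continuity (field_along y).
Proof.
intros Hy s; apply (continuity_pt_plus a (fun s => b s * h (y s))); [apply Ca|].
apply (continuity_pt_mult b (fun s => h (y s))); [apply Cb|].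
apply (continuity_pt_comp y h); [apply Hy|apply lipschitz_cont].
Qed.

(* clamping t makes every bound on [0,1] a bound on the whole line *)
Let step (rho : R) (y : R -> R) (t : R) : R := rho + RInt (field_along y) 0 (clamp t).

Lemma step_cont rho y : continuity y -> continuity (step rho y).
Proof.
intros Hy t; apply (continuity_pt_plus (fun _ => rho) (fun t => RInt (field_along y) 0 (clamp t))).
- apply continuity_pt_const; intros ? ?; reflexivity.
- apply (continuity_pt_comp clamp (fun u => RInt (field_along y) 0 u)); [apply clamp_cont|].
  eapply derivable_continuity_pt, (is_derive_primitive (field_along y) 0), field_along_cont, Hy.
Qed.

Lemma field_along_int y u v : continuity y -> ex_RInt (field_along y) u v.
Proof.
intros Hy; apply @ex_RInt_continuous; intros z _.
apply continuity_pt_filterlim, field_along_cont, Hy.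
Qed.

Lemma step_contract rho rho' y y' D :
  continuity y -> continuity y' -> (forall t, 0 <= t <= 1 -> Rabs (y t - y' t) <= D) ->
  forall t, Rabs (step rho y t - step rho' y' t) <= Rabs (rho - rho') + D / 2.
Proof.
intros Hy Hy' HD t.
assert (HD0 : 0 <= D) by (apply Rle_trans with (2 := HD 0 ltac:(lra)), Rabs_pos).
destruct (clamp_range t) as [c1 c2].
assert (E : step rho y t - step rho' y' t =
  (rho - rho') + RInt (fun s => field_along y s - field_along y' s) 0 (clamp t)).
{ assert (E := @RInt_minus R_CompleteNormedModule (field_along y) (field_along y') 0 (clamp t)
    (field_along_int y _ _ Hy) (field_along_int y' _ _ Hy')).
  transitivity ((rho - rho') + (RInt (field_along y) 0 (clamp t) - RInt (field_along y') 0 (clamp t)));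
    [unfold step; ring|f_equal; symmetry; exact E]. }
rewrite E; apply Rle_trans with (1 := Rabs_triang _ _), Rplus_le_compat_l.
apply Rle_trans with ((clamp t - 0) * (D / 2)).
- apply abs_RInt_le_const; [assumption|apply (@ex_RInt_minus R_NormedModule); now apply field_along_int|].
  intros s Hs; unfold field_along.
  replace (a s + b s * h (y s) - (a s + b s * h (y' s)))
    with (b s * (h (y s) - h (y' s))) by ring.
  rewrite Rabs_mult.
  apply Rle_trans with (Rabs (b s) * (L * Rabs (y s - y' s))).
  + apply Rmult_le_compat_l; [apply Rabs_pos|apply Hh].
  + rewrite <- Rmult_assoc.
    apply Rle_trans with (1 / 2 * D); [|lra].
    apply Rmult_le_compat.
    * apply Rmult_le_pos; [apply Rabs_pos|assumption].
    * apply Rabs_pos.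
    * apply Hb; lra.
    * apply HD; lra.
- assert (0 <= D / 2) by lra. nra.
Qed.

Fixpoint picard (rho : R) (n : nat) : R -> R :=
  match n with O => fun _ => rho | S n => step rho (picard rho n) end.

Lemma picard_cont rho n : continuity (picard rho n).
Proof.
induction n as [|n IH]; simpl; [|now apply step_cont].
intros t; apply continuity_pt_const; intros ? ?; reflexivity.
Qed.

Lemma picard_step rho : exists M, 0 <= M /\
  forall n t, Rabs (picard rho (S n) t - picard rho n t) <= M / 2 ^ n.
Proof.
destruct (bounded_on (fun t => step rho (fun _ => rho) t - rho) 0 1) as [M HM].
{ apply (continuity_sub (step rho (fun _ => rho)) (fun _ => rho)); [apply (step_cont rho (picard rho 0)), (picard_cont rho 0)|].
  intros t; apply continuity_pt_const; intros ? ?; reflexivity. }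
exists M; split; [apply Rle_trans with (2 := HM 0 ltac:(lra)), Rabs_pos|].
induction n as [|n IH]; intros t.
- simpl; rewrite Rdiv_1_r.
  assert (E : step rho (fun _ => rho) t = step rho (fun _ => rho) (clamp t)).
  { unfold step; now rewrite (clamp_id (clamp t)) by apply clamp_range. }
  rewrite E; apply HM, clamp_range.
- assert (H := step_contract rho rho (picard rho (S n)) (picard rho n) (M / 2 ^ n)
    (picard_cont rho (S n)) (picard_cont rho n) (fun s _ => IH s) t).
  rewrite Rminus_diag, Rabs_R0, Rplus_0_l in H.
  change (picard rho (S (S n)) t) with (step rho (picard rho (S n)) t).
  change (picard rho (S n) t) with (step rho (picard rho n) t).
  apply Rle_trans with (1 := H); right; simpl; field.
  apply pow_nonzero; lra.
Qed.

(** The right-hand side is the sum of the bounds M / 2^i for n <= i < n + k. *)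
Lemma picard_tail rho M n k t :
  0 <= M -> (forall n t, Rabs (picard rho (S n) t - picard rho n t) <= M / 2 ^ n) ->
  Rabs (picard rho (n + k) t - picard rho n t) <= 2 * M / 2 ^ n - 2 * M / 2 ^ (n + k).
Proof.
intros HM H; induction k as [|k IH].
- rewrite Nat.add_0_r, !Rminus_diag, Rabs_R0; lra.
- rewrite Nat.add_succ_r.
  replace (picard rho (S (n + k)) t - picard rho n t) with
    ((picard rho (S (n + k)) t - picard rho (n + k) t) + (picard rho (n + k) t - picard rho n t)) by ring.
  apply Rle_trans with (1 := Rabs_triang _ _).
  specialize (H (n + k)%nat t).
  assert (E : 2 * M / 2 ^ S (n + k) = M / 2 ^ (n + k)).
  { simpl; field; apply pow_nonzero; lra. }
  assert (E2 : 2 * M / 2 ^ (n + k) = 2 * (M / 2 ^ (n + k))) by (unfold Rdiv; ring).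
  lra.
Qed.

Lemma small_power (M e : R) : 0 < e -> exists N, forall n, (N <= n)%nat -> Rabs (M / 2 ^ n) < e.
Proof.
intros He.
assert (H := cv_pow_half M e He); destruct H as [N HN].
exists N; intros n Hn; specialize (HN n Hn); unfold R_dist in HN; now rewrite Rminus_0_r in HN.
Qed.

Lemma picard_fixpoint rho : exists y, continuity y /\ forall t, y t = step rho y t.
Proof.
destruct (picard_step rho) as [M [HM HS]].
assert (Htail := fun n k t => picard_tail rho M n k t HM HS).
assert (Hpow : forall n, 0 <= 2 * M / 2 ^ n).
{ intros n; apply Rmult_le_pos; [lra|]; apply Rlt_le, Rinv_0_lt_compat, pow_lt; lra. }
assert (Hcau : forall t, Cauchy_crit (fun n => picard rho n t)).
{ intros t e He; destruct (small_power (2 * M) e He) as [N HN].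
  assert (W : forall n k, (N <= n)%nat -> Rabs (picard rho (n + k) t - picard rho n t) < e).
  { intros n k Hn; apply Rle_lt_trans with (1 := Htail n k t).
    specialize (HN n Hn); rewrite Rabs_pos_eq in HN by apply Hpow.
    specialize (Hpow (n + k)%nat); lra. }
  exists N; intros n m Hn Hm; unfold R_dist; destruct (Nat.le_ge_cases n m) as [H|H].
  - replace m with (n + (m - n))%nat by lia; rewrite Rabs_minus_sym; now apply W.
  - replace n with (m + (n - m))%nat by lia; now apply W. }
set (y := fun t => proj1_sig (Rcomplete.R_complete _ (Hcau t))).
assert (Hy : forall n t, Rabs (y t - picard rho n t) <= 2 * M / 2 ^ n).
{ intros n t; unfold y; destruct (Rcomplete.R_complete _ (Hcau t)) as [l Hl]; simpl.
  destruct (Rle_lt_dec (Rabs (l - picard rho n t)) (2 * M / 2 ^ n)) as [H|H]; [exact H|exfalso].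
  destruct (Hl (Rabs (l - picard rho n t) - 2 * M / 2 ^ n)) as [N HN]; [lra|].
  specialize (HN (n + N)%nat ltac:(lia)); unfold R_dist in HN.
  specialize (Htail n N t); specialize (Hpow (n + N)%nat).
  replace (l - picard rho n t) with
    (- (picard rho (n + N) t - l) + (picard rho (n + N) t - picard rho n t)) in HN, H by ring.
  assert (T := Rabs_triang (- (picard rho (n + N) t - l)) (picard rho (n + N) t - picard rho n t)).
  rewrite Rabs_Ropp in T; lra. }
assert (Cy : continuity y).
{ intros t e He; destruct (small_power (2 * M) (e / 3)) as [N HN]; [lra|].
  specialize (HN N (le_n N)); rewrite Rabs_pos_eq in HN by apply Hpow.
  destruct (picard_cont rho N t (e / 3)) as [d [Hd Hc]]; [lra|].
  exists d; split; [exact Hd|]; intros z Hz; specialize (Hc z Hz); simpl in *; unfold R_dist in *.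
  assert (H1 := Hy N z); assert (H2 := Hy N t).
  revert HN Hc H1 H2; generalize (2 * M / 2 ^ N) (picard rho N z) (picard rho N t) (y z) (y t).
  clear; intros; unfold Rabs in *; repeat destruct (Rcase_abs _); lra. }
exists y; split; [exact Cy|]; intros t.
apply Rminus_diag_uniq; apply NNPP; intros Hne.
destruct (small_power (2 * M) (Rabs (y t - step rho y t) / 2)) as [N HN].
{ assert (H := Rabs_pos_lt _ Hne); lra. }
specialize (HN N (le_n N)); rewrite Rabs_pos_eq in HN by apply Hpow.
assert (H1 := Hy (S N) t).
assert (H2 := step_contract rho rho (picard rho N) y (2 * M / 2 ^ N) (picard_cont rho N) Cy
  (fun s _ => eq_ind _ (fun r => r <= _) (Hy N s) _ (Rabs_minus_sym _ _)) t).
rewrite Rminus_diag, Rabs_R0, Rplus_0_l in H2.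
change (picard rho (S N) t) with (step rho (picard rho N) t) in H1.
assert (E : 2 * M / 2 ^ S N = 2 * M / 2 ^ N / 2) by (simpl; field; apply pow_nonzero; lra).
rewrite E in H1; revert HN H1 H2.
generalize (2 * M / 2 ^ N) (step rho (picard rho N) t) (y t) (step rho y t).
clear; intros; unfold Rabs in *; repeat destruct (Rcase_abs _); lra.
Qed.

(** Continuity in the initial value follows from the contraction: the distance D
    of two solutions satisfies D <= |rho - rho'| + D / 2. *)
Lemma cauchy_problem : exists sol : R -> R -> R,
  (forall rho, continuity (sol rho) /\ sol rho 0 = rho /\
     forall t, 0 < t < 1 -> is_derive (sol rho) t (a t + b t * h (sol rho t))) /\
  continuity (fun rho => sol rho 1).
Proof.
assert (X : exists sol, forall rho, continuity (sol rho) /\ forall t, sol rho t = step rho (sol rho) t).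
{ exists (fun rho => proj1_sig (constructive_indefinite_description _ (picard_fixpoint rho))).
  intros rho; destruct (constructive_indefinite_description _ (picard_fixpoint rho)); assumption. }
destruct X as [sol H]; exists sol; split.
- intros rho; destruct (H rho) as [Cy Hy]; split; [exact Cy|split].
  + rewrite Hy; unfold step; rewrite clamp_low, RInt_point by lra; unfold zero; simpl; ring.
  + intros t Ht.
    apply (is_derive_ext_loc (fun t => rho + RInt (field_along (sol rho)) 0 t)).
    * apply locally_near with (eps := Rmin t (1 - t)); [apply Rmin_pos; lra|]; intros z Hz.
      assert (B1 := Rmin_l t (1 - t)); assert (B2 := Rmin_r t (1 - t)).
      rewrite Hy; unfold step; rewrite clamp_id by lra; reflexivity.
    * evar_last.
      -- apply @is_derive_plus; [apply @is_derive_const|].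
         apply (is_derive_primitive (field_along (sol rho)) 0), field_along_cont, Cy.
      -- unfold plus, zero, field_along; simpl; ring.
- intros rho e He; exists (e / 2); split; [lra|]; intros rho' [_ Hr]; simpl in *; unfold R_dist in *.
  destruct (H rho) as [Cy Hy]; destruct (H rho') as [Cy' Hy'].
  destruct (continuity_ab_maj (fun t => Rabs (sol rho' t - sol rho t)) 0 1) as [x [Hx1 Hx2]]; [lra| |].
  { intros c _; apply (continuity_pt_comp (fun t => sol rho' t - sol rho t) Rabs);
    [now apply continuity_sub|apply Rcontinuity_abs]. }
  assert (S := step_contract rho' rho (sol rho') (sol rho) _ Cy' Cy Hx1 x).
  rewrite <- Hy, <- Hy' in S; specialize (Hx1 1 ltac:(lra)); lra.
Qed.
End Picard.

(** * Three limit cycles by perturbation *)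

Lemma pow_unit (t : R) (n : nat) : 0 <= t <= 1 -> 0 <= t ^ n <= 1.
Proof.
intros Ht; split; [apply pow_le; lra|].
rewrite <- (pow1 n); apply pow_incr; lra.
Qed.

Lemma scale_unit (a b : R) : 0 <= a -> 0 <= b <= 1 -> 0 <= a * b <= a.
Proof. intros Ha Hb; split; nra. Qed.

(** The right-hand side - A/y - B is made globally Lipschitz by freezing 1/y below
    y = 1/4, a level that the orbits under study do not reach. *)
Definition cutoff_inv (u : R) : R := / Rmax u (1 / 4).

Lemma cutoff_inv_eq u : 1 / 4 <= u -> cutoff_inv u = / u.
Proof. intros H; unfold cutoff_inv; now rewrite Rmax_left. Qed.

Lemma cutoff_inv_range u : 0 < cutoff_inv u <= 4.
Proof.
unfold cutoff_inv; assert (H := Rmax_r u (1 / 4)); split.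
- apply Rinv_0_lt_compat; lra.
- apply Rle_trans with (/ (1 / 4)); [apply Rinv_le_contravar|]; lra.
Qed.

Lemma cutoff_inv_lipschitz u v : Rabs (cutoff_inv u - cutoff_inv v) <= 16 * Rabs (u - v).
Proof.
assert (Hu := cutoff_inv_range u); assert (Hv := cutoff_inv_range v).
unfold cutoff_inv in *.
assert (H1 := Rmax_r u (1 / 4)); assert (H2 := Rmax_r v (1 / 4)).
replace (/ Rmax u (1 / 4) - / Rmax v (1 / 4)) with
  ((/ Rmax u (1 / 4) * / Rmax v (1 / 4)) * (Rmax v (1 / 4) - Rmax u (1 / 4)))
  by (field; lra).
rewrite Rabs_mult, (Rabs_pos_eq (/ _ * / _)) by (apply Rmult_le_pos; lra).
apply Rmult_le_compat.
- apply Rmult_le_pos; lra.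
- apply Rabs_pos.
- replace 16 with (4 * 4) by ring; apply Rmult_le_compat; lra.
- unfold Rmax, Rabs; repeat destruct (Rle_dec _ _); repeat destruct (Rcase_abs _); lra.
Qed.

Section Sharp.
Variables m0 m1 m2 : nat.
Hypotheses (H01 : (m0 < m1)%nat) (H12 : (m1 < m2)%nat).
Let n0 := INR (S m0).
Let n1 := INR (S m1).
Let n2 := INR (S m2).

(** The integral over [0,1] of (n2 t^m2 - n1 t^m1) (t^n1 - t^n0), where n_i
    stands for m_i + 1. *)
Definition melnikov (n0 n1 n2 : R) : R :=
  (n1 - n0) * (n2 - n1) * (n2 - n0) / (2 * (n0 + n1) * (n1 + n2) * (n0 + n2)).
Let c := melnikov n0 n1 n2.

Lemma exponents_pos : 0 < n0 /\ n0 < n1 /\ n1 < n2.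
Proof. unfold n0, n1, n2; splits; [apply lt_0_INR|apply lt_INR|apply lt_INR]; lia. Qed.

Lemma melnikov_pos : 0 < c.
Proof.
destruct exponents_pos as [P0 [P1 P2]].
unfold c, melnikov; apply Rdiv_lt_0_compat; repeat apply Rmult_lt_0_compat; lra.
Qed.

(* At eps = 0 both trinomials have mean value zero, and they alone would give
   y(1) - y(0) the leading term - c eps^3 / rho^2.  The eps-dependent parts of the
   lowest coefficients are chosen to contribute 3 c eps^3 / rho and - 2 c eps^3,
   which makes the leading term - c (1/rho - 1) (1/rho - 2) eps^3. *)
Let A (eps : R) := trinomial m0 m1 m2 (- 3 * c * eps * n0) (- n1) n2.
Let B (eps : R) := trinomial m0 m1 m2 ((2 * c * eps ^ 2 - 1) * n0) n1 0.
(* beta is the primitive of B at eps = 0, alpha that of A, gamma that of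
   A beta *)
Let beta (t : R) := t ^ S m1 - t ^ S m0.

Let alpha (eps t : R) := - 3 * c * eps * t ^ S m0 - t ^ S m1 + t ^ S m2.
Let cross (m k : nat) (t : R) : R := t ^ (S m + S k) / (INR (S m) + INR (S k)).
Let gamma (eps t : R) :=
  - 3 * c * eps * n0 * (cross m0 m1 t - cross m0 m0 t)
  - n1 * (cross m1 m1 t - cross m1 m0 t) + n2 * (cross m2 m1 t - cross m2 m0 t).

Lemma power_derive m t : is_derive (fun t => t ^ S m) t (INR (S m) * t ^ m).
Proof.
assert (H : forall n, is_derive (fun t => t ^ n) t (INR n * t ^ pred n))
  by (intros n; auto_derive; auto; ring).
exact (H (S m)).
Qed.

Lemma cross_derive m k t : is_derive (cross m k) t (t ^ m * t ^ S k).
Proof.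
assert (0 < INR (S m) + INR (S k)) by (apply Rplus_lt_0_compat; apply lt_0_INR; lia).
unfold cross; evar_last.
- apply (is_derive_ext (fun t => / (INR (S m) + INR (S k)) * t ^ S (m + S k))).
  + intros u; unfold Rdiv; rewrite Rmult_comm; reflexivity.
  + apply is_derive_scal, power_derive.
- replace (INR (S (m + S k))) with (INR (S m) + INR (S k))
    by (rewrite <- plus_INR; reflexivity).
  rewrite pow_add; field; lra.
Qed.

Lemma beta_derive t : is_derive beta t (n1 * t ^ m1 - n0 * t ^ m0).
Proof. apply is_derive_sub; apply power_derive. Qed.

Lemma alpha_derive eps t : is_derive (alpha eps) t (A eps t).
Proof.
unfold alpha; evar_last.
- apply is_derive_add; [apply is_derive_sub|]; [apply is_derive_scal| |]; apply power_derive.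
- unfold A, trinomial; fold n0 n1 n2; ring.
Qed.

Lemma gamma_derive eps t : is_derive (gamma eps) t (A eps t * beta t).
Proof.
unfold gamma; evar_last.
- apply is_derive_add; [apply is_derive_sub|];
  apply is_derive_scal, is_derive_sub; apply cross_derive.
- unfold A, trinomial, beta; ring.
Qed.

Let kap := n0 * (/ (n0 + n1) - / (n0 + n0)).

Lemma gamma_end eps : gamma eps 1 - gamma eps 0 = c - 3 * c * eps * kap.
Proof.
destruct exponents_pos as [P0 [P1 P2]].
assert (E1 : forall m k, cross m k 1 = / (INR (S m) + INR (S k)))
  by (intros m k; unfold cross; rewrite pow1; unfold Rdiv; ring).
assert (E0 : forall m k, cross m k 0 = 0).
{ intros m k; unfold cross; rewrite pow_i by lia; unfold Rdiv; ring. }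
unfold gamma; rewrite !E1, !E0; fold n0 n1 n2; unfold kap, c, melnikov; field; lra.
Qed.

Lemma alpha_end eps : alpha eps 1 - alpha eps 0 = - 3 * c * eps.
Proof. unfold alpha; rewrite !pow1, !pow_i by lia; ring. Qed.

Let KA := 3 * c * n0 + n1 + n2.

Lemma A_bound eps t : 0 < eps <= 1 -> 0 <= t <= 1 -> Rabs (A eps t) <= KA.
Proof.
intros He Ht; destruct exponents_pos as [P0 [P1 P2]]; assert (Hc := melnikov_pos).
unfold A, trinomial, KA.
assert (Q0 := pow_unit t m0 Ht); assert (Q1 := pow_unit t m1 Ht); assert (Q2 := pow_unit t m2 Ht).
assert (Hcn : 0 < c * n0) by (apply Rmult_lt_0_compat; lra).
assert (S0 := scale_unit eps (t ^ m0) ltac:(lra) Q0).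
assert (R0 := scale_unit (3 * c * n0) (eps * t ^ m0) ltac:(lra) ltac:(lra)).
assert (R1 := scale_unit n1 (t ^ m1) ltac:(lra) Q1).
assert (R2 := scale_unit n2 (t ^ m2) ltac:(lra) Q2).
replace (- 3 * c * eps * n0 * t ^ m0) with (- (3 * c * n0 * (eps * t ^ m0))) by ring.
apply Rabs_le; lra.
Qed.

(* bounds for the successive steps below: y + eps beta, y, 1/y and y(1) *)
Let K1 := 2 * c * n0 + 4 * KA.
Let K2 := 1 + K1.
Let K3 := 9 * K1 + 36 * K2 ^ 2.
Let K4 := KA * K3 + 27 * c * Rabs kap.

Lemma constants_pos : 0 < KA /\ 0 < K1 /\ 0 < K2 /\ 0 < K3 /\ 0 < K4.
Proof.
destruct exponents_pos as [P0 [P1 P2]]; assert (Hc := melnikov_pos).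
assert (0 < c * n0) by (apply Rmult_lt_0_compat; lra).
assert (HA : 0 < KA) by (unfold KA; lra).
assert (H1 : 0 < K1) by (unfold K1; lra).
assert (H2 : 0 < K2) by (unfold K2; lra).
assert (H3 : 0 < K3) by (unfold K3; assert (0 < K2 ^ 2) by (apply pow_lt; lra); lra).
assert (0 < KA * K3) by (apply Rmult_lt_0_compat; lra).
assert (0 <= c * Rabs kap) by (apply Rmult_le_pos; [lra|apply Rabs_pos]).
splits; try assumption; unfold K4; lra.
Qed.

Section Orbit.
Variables (eps rho : R) (y : R -> R).
Hypothesis He : 0 < eps <= 1.
Hypothesis He2 : 12 * K2 * eps <= 1.
Hypothesis Hrho : 1 / 3 <= rho <= 2.
Hypothesis Cy : continuity y.
Hypothesis Hy0 : y 0 = rho.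
Hypothesis Dy : forall t, 0 < t < 1 ->
  is_derive y t (- eps * B eps t + - eps ^ 2 * A eps t * cutoff_inv (y t)).

Lemma orbit_first_order t : 0 <= t <= 1 -> Rabs (y t - rho + eps * beta t) <= K1 * eps ^ 2.
Proof.
intros Ht; destruct exponents_pos as [P0 [P1 P2]]; assert (Hc := melnikov_pos).
assert (Cb : continuity beta) by (intros z; eapply derivable_continuity_pt, beta_derive).
assert (b0 : beta 0 = 0) by (unfold beta; rewrite !pow_i by lia; ring).
replace (y t - rho + eps * beta t) with ((y t + eps * beta t) - (y 0 + eps * beta 0))
  by (rewrite Hy0, b0; ring).
apply (mean_value_bound (fun t => y t + eps * beta t)); [| |exact Ht].
- intros z; apply (continuity_pt_plus y (fun t => eps * beta t)); [apply Cy|].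
  apply (continuity_pt_scal beta), Cb.
- intros z Hz; exists (- (2 * c * n0 * z ^ m0 * eps) * eps ^ 2
    + - (A eps z * cutoff_inv (y z)) * eps ^ 2); split.
  + evar_last; [apply is_derive_add; [apply Dy, Hz|apply is_derive_scal, beta_derive]|].
    unfold B, trinomial; ring.
  + assert (HA := A_bound eps z He ltac:(lra)); assert (Hh := cutoff_inv_range (y z)).
    assert (Q := pow_unit z m0 ltac:(lra)).
    assert (0 < eps ^ 2) by (apply pow_lt; lra).
    rewrite <- Rmult_plus_distr_r, Rabs_mult, (Rabs_pos_eq (eps ^ 2)) by lra.
    apply Rmult_le_compat_r; [lra|].
    apply Rle_trans with (1 := Rabs_triang _ _); unfold K1; apply Rplus_le_compat.
    * assert (Hcn : 0 < c * n0) by (apply Rmult_lt_0_compat; lra).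
      rewrite Rabs_Ropp, Rabs_pos_eq.
      -- assert (S1 := scale_unit (z ^ m0) eps ltac:(lra) ltac:(lra)).
         assert (S2 := scale_unit (2 * c * n0) (z ^ m0 * eps) ltac:(lra) ltac:(lra)); lra.
      -- apply Rmult_le_pos; [apply Rmult_le_pos|]; lra.
    * rewrite Rabs_Ropp, Rabs_mult, (Rabs_pos_eq (cutoff_inv _)), Rmult_comm by lra.
      apply Rmult_le_compat; try lra. apply Rabs_pos.
Qed.

Lemma orbit_near t : 0 <= t <= 1 -> Rabs (y t - rho) <= K2 * eps.
Proof.
intros Ht; assert (H := orbit_first_order t Ht).
destruct constants_pos as [_ [HK1 _]].
assert (Q0 := pow_unit t (S m0) Ht); assert (Q1 := pow_unit t (S m1) Ht).
assert (Hb : Rabs (eps * beta t) <= eps).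
{ rewrite Rabs_mult, (Rabs_pos_eq eps) by lra.
  assert (Rabs (beta t) <= 1) by (unfold beta; apply Rabs_le; lra). nra. }
assert (K1 * eps ^ 2 <= K1 * eps) by (apply Rmult_le_compat_l; [lra|simpl; nra]).
replace (y t - rho) with ((y t - rho + eps * beta t) + - (eps * beta t)) by ring.
apply Rle_trans with (1 := Rabs_triang _ _); rewrite Rabs_Ropp; unfold K2; lra.
Qed.

Lemma orbit_low t : 0 <= t <= 1 -> 1 / 4 <= y t.
Proof.
intros Ht; assert (H := orbit_near t Ht); apply Rabs_le_between in H; lra.
Qed.

(** With w = y - rho one has 1/y = 1/rho - w/rho^2 + w^2/(rho^2 y), and w differs
    from - eps beta by O(eps^2). *)
Lemma orbit_inverse t : 0 <= t <= 1 ->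
  Rabs (cutoff_inv (y t) - / rho - eps * beta t / rho ^ 2) <= K3 * eps ^ 2.
Proof.
intros Ht; assert (Hl := orbit_low t Ht); rewrite cutoff_inv_eq by exact Hl.
assert (H1 := orbit_first_order t Ht); assert (H2 := orbit_near t Ht).
set (w := y t - rho) in *.
replace (/ y t - / rho - eps * beta t / rho ^ 2) with
  ((- (w + eps * beta t)) * (/ rho ^ 2) + w ^ 2 * / (rho ^ 2 * y t))
  by (unfold w; field; lra).
assert (Hr : / rho ^ 2 <= 9).
{ replace 9 with (/ ((1 / 3) ^ 2)) by field; apply Rinv_le_contravar; [lra|].
  apply pow_incr; lra. }
assert (Hr0 : 0 < rho ^ 2) by (apply pow_lt; lra).
assert (Hry : / (rho ^ 2 * y t) <= 36).
{ replace 36 with (9 * / (1 / 4)) by field; rewrite Rinv_mult.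
  apply Rmult_le_compat; try lra.
  - apply Rlt_le, Rinv_0_lt_compat; lra.
  - apply Rlt_le, Rinv_0_lt_compat; lra.
  - apply Rinv_le_contravar; lra. }
apply Rle_trans with (1 := Rabs_triang _ _).
rewrite !Rabs_mult, Rabs_Ropp.
rewrite (Rabs_pos_eq (/ rho ^ 2)) by (apply Rlt_le, Rinv_0_lt_compat; lra).
rewrite (Rabs_pos_eq (/ (rho ^ 2 * y t))) by (apply Rlt_le, Rinv_0_lt_compat, Rmult_lt_0_compat; lra).
replace (K3 * eps ^ 2) with (K1 * eps ^ 2 * 9 + (K2 * eps) ^ 2 * 36) by (unfold K3; ring).
apply Rplus_le_compat.
- apply Rmult_le_compat; try assumption; [apply Rabs_pos|].
  apply Rlt_le, Rinv_0_lt_compat; lra.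
- apply Rmult_le_compat; try assumption; [apply Rabs_pos| |].
  + apply Rlt_le, Rinv_0_lt_compat, Rmult_lt_0_compat; lra.
  + rewrite <- RPow_abs; apply pow_incr; split; [apply Rabs_pos|assumption].
Qed.

(** Adding to y explicit primitives of the first terms of the expansion of its
    derivative leaves a function [E] whose derivative is O(eps^4); the values of
    these primitives at 0 and 1 give the leading term. *)
Lemma orbit_displacement :
  Rabs (y 1 - rho + c * (/ rho - 1) * (/ rho - 2) * eps ^ 3) <= K4 * eps ^ 4.
Proof.
assert (Hc := melnikov_pos); destruct constants_pos as [HKA [_ [_ [HK3 _]]]].
set (E := fun t => y t + eps * (beta t + 2 * c * eps ^ 2 * t ^ S m0)
   + eps ^ 2 * (/ rho * alpha eps t + eps / rho ^ 2 * gamma eps t)).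
assert (DE : forall t, 0 < t < 1 -> is_derive E t
  (- eps ^ 2 * A eps t * (cutoff_inv (y t) - / rho - eps * beta t / rho ^ 2))).
{ intros t Ht; unfold E; evar_last.
  - apply is_derive_add; [apply is_derive_add|]; [apply Dy, Ht| |].
    + apply is_derive_scal, is_derive_add; [apply beta_derive|apply is_derive_scal, power_derive].
    + apply is_derive_scal, is_derive_add; apply is_derive_scal;
      [apply alpha_derive|apply gamma_derive].
  - unfold B, trinomial; fold n0; field; lra. }
assert (CE : continuity E).
{ intros t; unfold E.
  apply (continuity_pt_plus (fun t => y t + eps * (beta t + 2 * c * eps ^ 2 * t ^ S m0))
    (fun t => eps ^ 2 * (/ rho * alpha eps t + eps / rho ^ 2 * gamma eps t))).
  - apply (continuity_pt_plus y (fun t => eps * (beta t + 2 * c * eps ^ 2 * t ^ S m0))); [apply Cy|].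
    eapply derivable_continuity_pt, is_derive_scal, is_derive_add;
    [apply beta_derive|apply is_derive_scal, power_derive].
  - eapply derivable_continuity_pt, is_derive_scal, is_derive_add; apply is_derive_scal;
      [apply alpha_derive|apply gamma_derive]. }
assert (He3 : 0 < eps ^ 2) by (apply pow_lt; lra).
assert (HE : Rabs (E 1 - E 0) <= KA * K3 * eps ^ 4).
{ apply mean_value_bound; [exact CE| |lra].
  intros t Ht; eexists; split; [now apply DE|].
  assert (HA := A_bound eps t He ltac:(lra)).
  assert (HI := orbit_inverse t ltac:(lra)).
  rewrite !Rabs_mult, Rabs_Ropp, (Rabs_pos_eq (eps ^ 2)) by lra.
  replace (KA * K3 * eps ^ 4) with (eps ^ 2 * KA * (K3 * eps ^ 2)) by ring.
  apply Rmult_le_compat; try assumption; try apply Rabs_pos.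
  - apply Rmult_le_pos; [lra|apply Rabs_pos].
  - apply Rmult_le_compat_l; lra. }
set (r := eps ^ 2 * (eps / rho ^ 2 * (3 * c * eps * kap))).
assert (Hr : Rabs r <= 27 * c * Rabs kap * eps ^ 4).
{ unfold r; replace (eps ^ 2 * (eps / rho ^ 2 * (3 * c * eps * kap)))
    with ((3 * c * eps ^ 4) * (/ rho ^ 2 * kap)) by (field; lra).
  assert (0 < eps ^ 4) by (apply pow_lt; lra).
  assert (0 < c * eps ^ 4) by (apply Rmult_lt_0_compat; lra).
  assert (Hq : / rho ^ 2 <= 9).
  { replace 9 with (/ ((1 / 3) ^ 2)) by field; apply Rinv_le_contravar; [lra|].
    apply pow_incr; lra. }
  assert (Hr0 : 0 < / rho ^ 2) by (apply Rinv_0_lt_compat, pow_lt; lra).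
  rewrite !Rabs_mult, (Rabs_pos_eq (/ rho ^ 2)), (Rabs_pos_eq c), (Rabs_pos_eq 3),
    (Rabs_pos_eq (eps ^ 4)) by lra.
  replace (27 * c * Rabs kap * eps ^ 4) with (3 * c * eps ^ 4 * (9 * Rabs kap)) by ring.
  apply Rmult_le_compat_l; [lra|]; apply Rmult_le_compat_r; [apply Rabs_pos|assumption]. }
assert (EE : y 1 - rho + c * (/ rho - 1) * (/ rho - 2) * eps ^ 3 = (E 1 - E 0) + r).
{ assert (X : E 1 - E 0 = y 1 - rho + 2 * c * eps ^ 3
    + eps ^ 2 * (/ rho * (alpha eps 1 - alpha eps 0) + eps / rho ^ 2 * (gamma eps 1 - gamma eps 0))).
  { unfold E, beta; rewrite !pow1, !pow_i, Hy0 by lia; ring. }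
  rewrite X, alpha_end, gamma_end; unfold r; field; lra. }
rewrite EE; apply Rle_trans with (1 := Rabs_triang _ _); unfold K4; lra.
Qed.
End Orbit.

(** The product (1/rho - 1) (1/rho - 2) changes sign between rho = 1/3 and 2/3
    and again between 2/3 and 2, and eps is taken so small that the displacement
    does the same. *)
Lemma sharp_example : exists a0 a1 a2 b0 b1 b2 : R,
  has_exactly_limit_cycles (trinomial m0 m1 m2 a0 a1 a2) (trinomial m0 m1 m2 b0 b1 b2) 3.
Proof.
destruct exponents_pos as [P0 [P1 P2]]; assert (Hc := melnikov_pos).
destruct constants_pos as [HA [_ [H2 [_ H4]]]].
assert (X : exists eps, 0 < eps <= 1 /\ 12 * K2 * eps <= 1 /\ 32 * KA * eps <= 1 /\
  8 * K4 * eps <= c).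
{ assert (HK : 0 < 8 * K4 / c) by (apply Rdiv_lt_0_compat; lra).
  set (D := 1 + 32 * KA + 12 * K2 + 8 * K4 / c); assert (HD : 0 < D) by (unfold D; lra).
  assert (E : forall k, k <= D -> k * / D <= 1).
  { intros k Hk; apply (Rmult_le_reg_r D); [exact HD|].
    rewrite Rmult_assoc, Rinv_l by lra; lra. }
  exists (/ D); splits; try (apply E; unfold D; lra).
  - now apply Rinv_0_lt_compat.
  - rewrite <- (Rmult_1_l (/ D)); apply E; unfold D; lra.
  - replace (8 * K4 * / D) with (c * (8 * K4 / c * / D)) by (field; lra).
    assert (Y := E (8 * K4 / c) ltac:(unfold D; lra)).
    assert (c * (8 * K4 / c * / D) <= c * 1) by (apply Rmult_le_compat_l; lra); lra. }
destruct X as [eps [He [He2 [He3 He4]]]].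
assert (Hsq : 0 < eps ^ 2) by (apply pow_lt; lra).
assert (Ca : continuity (fun t => - eps * B eps t)).
{ intros t; apply (continuity_pt_scal (B eps)), trinomial_cont. }
assert (Cb : continuity (fun t => - eps ^ 2 * A eps t)).
{ intros t; apply (continuity_pt_scal (A eps)), trinomial_cont. }
destruct (cauchy_problem _ _ cutoff_inv 16 Ca Cb ltac:(lra) cutoff_inv_lipschitz) as [sol [Hsol Cend]].
{ intros t Ht; assert (Q := A_bound eps t He Ht).
  rewrite Rabs_mult, Rabs_Ropp, (Rabs_pos_eq (eps ^ 2)) by lra.
  assert (eps ^ 2 * Rabs (A eps t) <= eps * KA); [|lra].
  apply Rmult_le_compat; try lra; [apply Rabs_pos|simpl; nra]. }
assert (Disp : forall rho, 1 / 3 <= rho <= 2 ->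
  Rabs (sol rho 1 - rho + c * (/ rho - 1) * (/ rho - 2) * eps ^ 3) <= c * eps ^ 3 / 8).
{ intros rho Hr; destruct (Hsol rho) as [C [I D]].
  apply Rle_trans with (1 := orbit_displacement eps rho (sol rho) He He2 Hr C I D).
  replace (K4 * eps ^ 4) with ((8 * K4 * eps) * (eps ^ 3 / 8)) by field.
  replace (c * eps ^ 3 / 8) with (c * (eps ^ 3 / 8)) by field.
  apply Rmult_le_compat_r; [|lra].
  assert (0 < eps ^ 3) by (apply pow_lt; lra); lra. }
set (disp := fun rho => sol rho 1 - rho).
assert (Cd : continuity disp).
{ apply (continuity_sub (fun rho => sol rho 1) (fun rho => rho)); [exact Cend|].
  intros r; apply derivable_continuous_pt, derivable_pt_id. }
assert (Hce : 0 < c * eps ^ 3) by (apply Rmult_lt_0_compat; [lra|apply pow_lt; lra]).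
assert (V1 : disp (1 / 3) < 0).
{ assert (H := Disp (1 / 3) ltac:(lra)); fold (disp (1 / 3)) in H.
  replace (c * (/ (1 / 3) - 1) * (/ (1 / 3) - 2) * eps ^ 3) with (2 * (c * eps ^ 3)) in H by field.
  apply Rabs_le_between in H; lra. }
assert (V2 : 0 < disp (2 / 3)).
{ assert (H := Disp (2 / 3) ltac:(lra)); fold (disp (2 / 3)) in H.
  replace (c * (/ (2 / 3) - 1) * (/ (2 / 3) - 2) * eps ^ 3) with (- (1 / 4) * (c * eps ^ 3)) in H by field.
  apply Rabs_le_between in H; lra. }
assert (V3 : disp 2 < 0).
{ assert (H := Disp 2 ltac:(lra)); fold (disp 2) in H.
  replace (c * (/ 2 - 1) * (/ 2 - 2) * eps ^ 3) with (3 / 4 * (c * eps ^ 3)) in H by field.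
  apply Rabs_le_between in H; lra. }
destruct (IVT_cor disp (1 / 3) (2 / 3) Cd) as [r [Hr Zr]]; [lra|nra|].
destruct (IVT_cor disp (2 / 3) 2 Cd) as [s [Hs Zs]]; [lra|nra|].
assert (Hrs : r < 2 / 3 < s).
{ split; [destruct (Req_dec r (2 / 3)) as [E|]|destruct (Req_dec s (2 / 3)) as [E|]];
  try (rewrite E in *; lra); lra. }
exists (eps ^ 2 * (- 3 * c * eps * n0)), (eps ^ 2 * - n1), (eps ^ 2 * n2),
  (eps * ((2 * c * eps ^ 2 - 1) * n0)), (eps * n1), (eps * 0).
assert (Closed : forall rho, 1 / 3 <= rho <= 2 -> disp rho = 0 -> closed_solution
  (trinomial m0 m1 m2 (eps ^ 2 * (- 3 * c * eps * n0)) (eps ^ 2 * - n1) (eps ^ 2 * n2))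
  (trinomial m0 m1 m2 (eps * ((2 * c * eps ^ 2 - 1) * n0)) (eps * n1) (eps * 0))
  (fun t => cutoff_inv (sol rho t))).
{ intros rho Hrho Z; destruct (Hsol rho) as [C [I D]].
  assert (Low := orbit_low eps rho (sol rho) He He2 Hrho C I D).
  apply closed_of_interior; try apply trinomial_cont.
  - intros t; apply (continuity_pt_comp (sol rho) cutoff_inv); [apply C|].
    apply (lipschitz_cont cutoff_inv 16); [lra|apply cutoff_inv_lipschitz].
  - intros t Ht; apply (is_derive_ext_loc (fun t => / sol rho t)).
    + apply locally_near with (eps := Rmin t (1 - t)); [apply Rmin_pos; lra|]; intros z Hz.
      assert (B1 := Rmin_l t (1 - t)); assert (B2 := Rmin_r t (1 - t)).
      symmetry; apply cutoff_inv_eq, Low; lra.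
    + assert (L := Low t ltac:(lra)).
      evar_last; [apply is_derive_inv; [apply D, Ht|lra]|].
      rewrite cutoff_inv_eq by exact L; unfold A, B, trinomial; field; lra.
  - rewrite I; unfold disp in Z; replace (sol rho 1) with rho by lra; reflexivity. }
assert (Val : forall rho, 1 / 3 <= rho <= 2 -> cutoff_inv (sol rho 0) = / rho).
{ intros rho Hrho; destruct (Hsol rho) as [_ [-> _]]; apply cutoff_inv_eq; lra. }
apply (exactly_three m0 m1 m2 _ _ _ _ _ _ (fun t => cutoff_inv (sol r t))
  (fun t => cutoff_inv (sol s t))); auto.
- intros al be _ E1 E2.
  assert (Hal : al = 0).
  { assert (E : al * (eps ^ 2 * n2) = 0) by lra.
    apply Rmult_integral in E; destruct E as [E|E]; [exact E|exfalso].
    assert (0 < eps ^ 2 * n2) by (apply Rmult_lt_0_compat; lra); lra. }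
  split; [exact Hal|]; rewrite Hal in E1.
  assert (E : be * (eps * n1) = 0) by lra.
  apply Rmult_integral in E; destruct E as [E|E]; [exact E|exfalso].
  assert (0 < eps * n1) by (apply Rmult_lt_0_compat; lra); lra.
- apply Closed; [lra|exact Zr].
- apply Closed; [lra|exact Zs].
- rewrite Val by lra; apply Rinv_neq_0_compat; lra.
- rewrite Val by lra; apply Rinv_neq_0_compat; lra.
- rewrite !Val by lra; intros E; apply (f_equal Rinv) in E; rewrite !Rinv_inv in E; lra.
Qed.
End Sharp.

Theorem theorem4 :
  forall m0 m1 m2 : nat, (m0 < m1)%nat -> (m1 < m2)%nat ->
    (forall a0 a1 a2 b0 b1 b2 : R,
       exists n : nat, (n <= 3)%nat /\
         has_exactly_limit_cycles
           (trinomial m0 m1 m2 a0 a1 a2) (trinomial m0 m1 m2 b0 b1 b2) n) /\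
    (exists a0 a1 a2 b0 b1 b2 : R,
       has_exactly_limit_cycles
         (trinomial m0 m1 m2 a0 a1 a2) (trinomial m0 m1 m2 b0 b1 b2) 3).
Proof.
intros m0 m1 m2 H01 H12; split.
- intros a0 a1 a2 b0 b1 b2; now apply limit_cycles_enumeration.
- now apply sharp_example.
Qed.
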